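(* Let $N\ge1$ be an integer, $p=2N+1$, let $v\in\mathbb{R}^p$ satisfy $v_1<v_2<\dots<v_p$, and let $H(t)=\Delta+tV$ with coupling constant $t\to+\infty$. Let $\sigma_j(tv)=[\lambda_j^-(t),\lambda_j^+(t)]$, $j\in\{-N,\dots,N\}$, be the spectral bands of $H(t)$ (see the context). Then for every $k\in\{1,\dots,p\}$, with $s=(-1)^k$, $$\lambda_{k-N-1}^{\pm s}(t)=tv_k-\frac{\xi_k^\pm+O(t^{-1})}{t},\qquad \xi_k^\pm=\frac{r_k^\pm}{v_{k-1}-v_k}+\frac{r_{k+1}^\pm}{v_{k+1}-v_k},$$ where $v_0=v_{p+1}=0$, $r_1^\pm=r_{p+1}^\pm=0$, and $r_{2n+1}^\pm=1$, $r_{2n}^-=0$, $r_{2n}^+=4$ for $n\in\{1,\dots,N\}$ (the terms containing $r_1^\pm$ and $r_{p+1}^\pm$ are understood to be zero). Here $\lambda^{\pm s}$ means $\lambda^{\pm}$ if $s=1$ and $\lambda^{\mp}$ if $s=-1$. Moreover, the lengths of the bands satisfy $$|\sigma_{k-N-1}(tv)|=\frac{4+O(t^{-1})}{t\,|v_{k-(-1)^k}-v_k|},\quad k\in\{1,\dots,p-1\},\qquad |\sigma_N(tv)|=O(t^{-2}),$$ and, for $t$ sufficiently large, each spectral band $\sigma_j(tv)$ with $j\in\{-N,\dots,N-1\}$ has multiplicity $2$ (as part of the spectrum of $H(t)$).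
   Context: Notation: $\mathbb{N}_p=\{1,\dots,p\}$, $p=2N+1$. The Hilbert space $\ell^2(\Gamma)$ consists of $f=(f_{n,k})_{(n,k)\in\mathbb{Z}\times\mathbb{N}_p}$ with $\sum|f_{n,k}|^2<\infty$. With $f_{n,0}=f_{n,p+1}=0$ for all $n\in\mathbb{Z}$, $$(\Delta f)_{n,2k+1}=f_{n,2k}+f_{n-1,2k+2}+f_{n,2k+2},\quad k=0,1,\dots,N,$$ $$(\Delta f)_{n,2k}=f_{n,2k-1}+f_{n+1,2k-1}+f_{n,2k+1},\quad k=1,\dots,N,$$ $$(Vf)_{n,k}=v_kf_{n,k},\quad (n,k)\in\mathbb{Z}\times\mathbb{N}_p.$$ For $a\in[0,2]$, $J_a(t)$ is the symmetric tridiagonal $p\times p$ matrix with diagonal $(tv_1,\dots,tv_p)$ and off-diagonal entries $(a,1,a,1,\dots,a,1)$ (the $(n,n+1)$ entry is $a$ for odd $n$ and $1$ for even $n$); $\lambda_{-N}(a,tv)\le\dots\le\lambda_N(a,tv)$ are its eigenvalues. The spectrum of $H(t)$ is $\bigcup_{j=-N}^N\sigma_j(tv)$, where $\sigma_j(tv)=\{\lambda_j(a,tv):a\in[0,2]\}$ is a compact interval, whose lower and upper endpoints are denoted $\lambda_j^-(t)$ and $\lambda_j^+(t)$, respectively, for every $j\in\{-N,\dots,N\}$. *)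

(* Defs.v *)
From HB Require Import structures.
From mathcomp Require Import all_boot all_order all_algebra complex.
From mathcomp Require Import all_classical all_reals all_analysis.

Set Implicit Arguments.
Unset Strict Implicit.
Unset Printing Implicit Defensive.

Import Order.TTheory GRing.Theory Num.Theory.
Import numFieldNormedType.Exports.

Local Open Scope classical_set_scope.
Local Open Scope ring_scope.
Local Open Scope complex_scope.

(* v_k for k = 1, ..., p, and 0 for every other k (in particular v_0 and
   v_{p+1}); the row vector itself is indexed from 0 *)
Definition vcoord (R : realType) (p : nat) (v : 'rV[R]_p) (k : nat) : R :=
  if k is k'.+1 then oapp (v 0) 0 (insub k') else 0.

(* the filter t --> +oo, packaged for the Landau notation f =O_ F g *)
Definition pinfty_filter (R : realType) : filter_on R :=
  FilterType (+oo_R) (@proper_pinfty_nbhs R : Filter _).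

Section Nanoribbon.
Variable R : realType.
Variable N : nat.
Notation p := (N.*2.+1).

(* Rows and columns are indexed from 0: the entry in row n and column n + 1,
   counted from 1, is [a] for n odd and 1 for n even. *)
Definition jacobi (v : 'rV[R]_p) (a t : R) : 'M[R]_p :=
  \matrix_(i < p, j < p)
    if i == j then t * v 0 i
    else if j == i.+1 :> nat then (if odd i.+1 then a else 1)
    else if i == j.+1 :> nat then (if odd j.+1 then a else 1)
    else 0.

Definition ordered_eigenvalues (n : nat) (A : 'M[R]_n) (s : seq R) : Prop :=
  sorted <=%R s /\ char_poly A = \prod_(x <- s) ('X - x%:P).

(* The list is unique when it exists, and exists as soon as A is symmetric:
   see [eigenvaluesP] below. *)
Definition eigenvalues (n : nat) (A : 'M[R]_n) : seq R :=
  xget [::] [set s | ordered_eigenvalues A s].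

Lemma eigenvaluesP (n : nat) (A : 'M[R]_n) :
  A^T = A -> ordered_eigenvalues A (eigenvalues A).
Proof.
move=> symA; rewrite /eigenvalues.
suff [s sP] : exists s, ordered_eigenvalues A s.
  by case: xgetP => [? _ //|/(_ s)]; case.
set f := real_complex R; set B := map_mx f A.
have hB : B \is hermsymmx.
  apply/is_hermitianmxP; rewrite expr0 scale1r; apply/matrixP => i j.
  rewrite !mxE -[in LHS]symA mxE.
  by apply/eqP; rewrite eq_complex /= oppr0 !eqxx.
have /orthomx_spectralP eB := hermitian_normalmx hB.
have /mxOverP Dr := hermitian_spectral_diag_real hB.
have Pu := spectral_unit B.
set D := spectral_diag B in eB Dr; set P := spectralmx B in eB Pu.
have dE i : D 0 i = f (complex.Re (D 0 i)).
  by rewrite /f RRe_real.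
pose s := [seq complex.Re (D 0 i) | i : 'I_n].
exists (sort <=%R s); split; first exact/sort_sorted/le_total.
rewrite (perm_big s) ?perm_sort//=; apply: (map_poly_inj f).
have -> : map_poly f (char_poly A) = char_poly (diag_mx D).
  rewrite map_char_poly -/B /char_poly /char_poly_mx eB !map_mxM /=.
  set U := map_mx polyC (invmx P); set Q := map_mx polyC P.
  have UQ : U *m Q = 1%:M by rewrite -map_mxM mulVmx// map_mx1.
  have -> : 'X%:M - U *m map_mx polyC (diag_mx D) *m Q =
            U *m ('X%:M - map_mx polyC (diag_mx D)) *m Q.
    by rewrite mulmxBr mulmxBl mul_mx_scalar -scalemxAl UQ scalemx1.
  by rewrite !det_mulmx mulrAC -det_mulmx UQ det1 mul1r.
rewrite char_poly_trig ?diag_mx_is_trig// rmorph_prod /= big_map big_enum.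
apply: eq_bigr => i _.
by rewrite mxE eqxx mulr1n map_polyXsubC {1}dE.
Qed.

(* lambda_j(a, tv), meaningful for -N <= j <= N *)
Definition band_fun (v : 'rV[R]_p) (t : R) (j : int) (a : R) : R :=
  (eigenvalues (jacobi v a t))`_(absz (j + N%:Z)).

Definition band (v : 'rV[R]_p) (t : R) (j : int) : set R :=
  [set band_fun v t j a | a in `[0, 2]%classic].

(* [true] stands for the sign +, [false] for the sign - *)
Definition band_end (v : 'rV[R]_p) (sgn : bool) (j : int) (t : R) : R :=
  if sgn then sup (band v t j) else inf (band v t j).

Definition band_length (v : 'rV[R]_p) (j : int) (t : R) : R :=
  band_end v true j t - band_end v false j t.

Definition rcoef (sgn : bool) (k : nat) : R :=
  if (k == 1%N) || (k == p.+1) then 0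
  else if odd k then 1
  else if sgn then 4 else 0.

(* At k = 1 and k = p one numerator vanishes, so the corresponding term is 0
   whatever its denominator (division is total, with 0 / 0 = 0). *)
Definition xi (v : 'rV[R]_p) (sgn : bool) (k : nat) : R :=
  rcoef sgn k / (vcoord v k.-1 - vcoord v k)
  + rcoef sgn k.+1 / (vcoord v k.+1 - vcoord v k).

(* Vertex (n, k) of Z x {1, ..., p} is encoded as (n, k - 1). *)
Definition vertex : Type := (int * 'I_p)%type.

(* f_{n,k} for k = 1, ..., p, and 0 for every other k *)
Definition fcoord (f : vertex -> R[i]) (n : int) (k : nat) : R[i] :=
  if k is k'.+1 then oapp (fun i : 'I_p => f (n, i)) 0 (insub k') else 0.

Definition laplacian (f : vertex -> R[i]) : vertex -> R[i] :=
  fun x => let n := x.1 in let k := (x.2 : nat).+1 in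
    if odd k then fcoord f n k.-1 + fcoord f (n - 1) k.+1 + fcoord f n k.+1
    else fcoord f n k.-1 + fcoord f (n + 1) k.-1 + fcoord f n k.+1.

Definition hamiltonian (v : 'rV[R]_p) (t : R) (f : vertex -> R[i]) :
    vertex -> R[i] :=
  fun x => laplacian f x + (t * v 0 x.2)%:C * f x.

End Nanoribbon.

Section Multiplicity.
Variable R : realType.
Local Open Scope ereal_scope.

Definition sqmod (z : R[i]) : R := (complex.Re z ^+ 2 + complex.Im z ^+ 2)%R.

Variable G : choiceType.
Implicit Types (f : G -> R[i]) (H : (G -> R[i]) -> (G -> R[i])).

Definition l2norm2 f : \bar R := \esum_(x in [set: G]) (sqmod (f x))%:E.

Definition in_l2 f : Prop := l2norm2 f < +oo.

Definition poly_op H (q : {poly R}) f : G -> R[i] :=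
  fun x => (\sum_(i < size q) (q`_i)%:C * iter i H f x)%R.

(* For a bounded self-adjoint H: the spectral measure A |-> <1_A(H) f, f>,
   characterized by || q(H) f ||^2 = \int |q|^2 for every real polynomial q
   (by polarization this prescribes all the moments <H^m f, f>). *)
Definition is_spectral_measure H f
    (nu : {finite_measure set (measurableTypeR R) -> \bar R}) : Prop :=
  forall q : {poly R},
    l2norm2 (poly_op H q f) = \int[nu]_x ((q.[x]) ^+ 2)%:E.

(* The range of the spectral projection 1_S(H), for S compact: the vectors
   whose spectral measure is concentrated on S. *)
Definition spectral_subspace H (S : set R) f : Prop :=
  in_l2 f /\
  exists nu : {finite_measure set (measurableTypeR R) -> \bar R},
    is_spectral_measure H f nu /\ {ae nu, forall x, S x}.

(* S is the topological support of mu (for S closed) *)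
Definition is_support (S : set R)
    (mu : {finite_measure set (measurableTypeR R) -> \bar R}) : Prop :=
  {ae mu, forall x, S x} /\
  forall U : set R, open U -> (U `&` S) !=set0 -> 0 < mu U.

(* representatives of the elements of L^2(mu; C^m) *)
Definition in_L2 (m : nat)
    (mu : {finite_measure set (measurableTypeR R) -> \bar R})
    (g : 'I_m -> R -> R[i]) : Prop :=
  forall i : 'I_m,
    [/\ measurable_fun [set: measurableTypeR R] (fun x => complex.Re (g i x)),
        measurable_fun [set: measurableTypeR R] (fun x => complex.Im (g i x)) &
        \int[mu]_x (sqmod (g i x))%:E < +oo].

(* H has uniform spectral multiplicity m on S: its restriction to the spectral
   subspace of S is unitarily equivalent to multiplication by the variable in
   L^2(mu; C^m), for some measure mu with support S. The unitary map is W; being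
   linear and isometric, it does not depend on the chosen representatives. *)
Definition has_multiplicity H (m : nat) (S : set R) : Prop :=
  exists (mu : {finite_measure set (measurableTypeR R) -> \bar R})
         (W : ('I_m -> R -> R[i]) -> (G -> R[i])),
    [/\ is_support S mu,
        (forall (c : R[i]) (g h : 'I_m -> R -> R[i]),
           in_L2 mu g -> in_L2 mu h -> forall y,
           W (fun i x => c * g i x + h i x)%R y = (c * W g y + W h y)%R),
        (forall g, in_L2 mu g ->
           l2norm2 (W g) = \sum_(i < m) \int[mu]_x (sqmod (g i x))%:E),
        (forall g, in_L2 mu g -> forall y,
           H (W g) y = W (fun i x => x%:C * g i x)%R y) &
        (forall f, spectral_subspace H S f <->
           exists2 g, in_L2 mu g & forall y, f y = W g y)].

End Multiplicity.

(* Main.v *)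
Require Import Defs.
From HB Require Import structures.
From mathcomp Require Import all_boot all_order all_algebra complex.
From mathcomp Require Import all_classical all_reals all_analysis.
From mathcomp Require Import measurable_realfun.
From mathcomp Require Import ring lra zify.
From mathcomp Require polyrcf.
Set Implicit Arguments.
Unset Strict Implicit.
Unset Printing Implicit Defensive.
Import Order.TTheory GRing.Theory Num.Theory.
Import numFieldNormedType.Exports.
Local Open Scope classical_set_scope.
Local Open Scope ring_scope.

(** The statements on the ends of the bands are perturbation theory for the
    matrix J_a(t), uniform in a. For t large its diagonal entries t v_k are
    separated by gaps of order t, whereas every row carries at most a + 1 <= 3
    off the diagonal. Hence the disc of radius 4 around t v_k contains exactly
    the k-th eigenvalue [eigval_near], and an eigenvector normalized to have
    k-th entry 1 has entries O(1/t) elsewhere [eigvec_small]. Let sigma k and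
    tau k be the neighbours of k across the bonds of weight a and 1. Inserting
    the rows of the two neighbours into row k gives [eigvec_expansion]:
      x = t v_k + a^2 / (t v_k - t v_(sigma k)) + 1 / (t v_k - t v_(tau k))
          + O(t^-2).
    Up to the error this is monotone in a^2, which runs over [0, 4]. So a = 0
    and a = 2 give the two ends, with the coefficients 0 and 4 of xi, and the
    parity of k decides which one is the upper end [band_end_expansion]. The
    number 4 is also the coefficient in the length of the band; the last site
    has no bond of weight a, so the top band has length O(t^-2).

    For the multiplicity, H(t) is diagonalized. A Fourier transform in n and a
    change of phase turn H(t) into the matrices J_a(t) with
    a = |1 + e^(i th)| = |2 cos (th / 2)|. The momenta th and - th have the
    same energies, which is the source of the multiplicity 2. In real terms, for
    th in [0, pi] and each band there are two generalized eigenfunctions, a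
    cosine and a sine multiplied by the eigenvector of the fiber: these are
    the functions [bloch]. As vectors indexed by the vertices of the graph
    they are orthonormal [bloch_orth] and total [bloch_total] in
    L^2([0, pi]), so they define a unitary map onto l^2 of the vertices
    [bloch_isometry, bloch_onto], which turns H(t) into multiplication by the
    energy [rhamiltonian_invbloch]. Totality comes down to that of the
    cosines [cos_total].

    The bands lie in disjoint discs, so the spectral subspace of band k
    consists of the functions carried by that band [spectral_concentrated]. For
    every band but the last the energy is strictly monotone in th
    [eigval_strict_mono], hence a coordinate on [0, pi]. In this coordinate the
    spectral subspace becomes L^2(mu; C^2), with mu the law of the energy of a
    uniformly distributed momentum [band_multiplicity]. *)

(** * Determinants of diagonally dominant matrices *)

Section DiagonalDominance.
Variable R : realType.

Definition diag_dominant n (M : 'M[R]_n) :=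
  forall i, \sum_(j | j != i) `|M i j| < `|M i i|.

Lemma finite_argmax (n : nat) (f : 'I_n.+1 -> R) :
  exists i, forall j, f j <= f i.
Proof.
by exists [arg max_(i > ord0) f i]%O => j; case: arg_maxP => // i _; exact.
Qed.

(** The row where a kernel vector is largest in modulus contradicts
    dominance. *)
Lemma diag_dominant_det_neq0 n (M : 'M[R]_n) : diag_dominant M -> \det M != 0.
Proof.
case: n M => [|n] M dM; first by rewrite det_mx00 oner_neq0.
apply/negP; rewrite -det_tr => /det0P[u u0 uM].
have [i imax] := finite_argmax (fun i => `|u 0 i|).
have ui0 : 0 < `|u 0 i|.
  rewrite lt_neqAle normr_ge0 andbT eq_sym; apply: contra_neq u0 => ui0.
  apply/rowP => j; rewrite mxE; apply/eqP; rewrite -normr_le0 -ui0; exact: imax.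
have /(congr1 (fun A : 'rV__ => A 0 i)) := uM.
rewrite !mxE (bigD1 i)//= mxE => /eqP; rewrite addr_eq0 => /eqP E.
have : `|u 0 i| * `|M i i| <= `|u 0 i| * \sum_(j | j != i) `|M i j|.
  rewrite -normrM E normrN mulr_sumr (le_trans (ler_norm_sum _ _ _))//.
  by apply: ler_sum => j _; rewrite normrM mxE ler_wpM2r.
by rewrite ler_pM2l// leNgt dM.
Qed.

(** Multiplying the off-diagonal part by s in [0, 1] preserves dominance. The
    determinant is polynomial in s and never vanishes on [0, 1], so it keeps the
    sign that it has at s = 0, where the matrix is diagonal. *)
Lemma diag_dominant_det_sign n (M : 'M[R]_n) :
  diag_dominant M -> 0 < \det M * \prod_i M i i.
Proof.
move=> dM.
pose B : 'M[{poly R}]_n :=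
  \matrix_(i, j) if j == i then (M i j)%:P else M i j *: 'X.
pose q := \det B.
have qE s : q.[s] = \det (\matrix_(i, j) if j == i then M i j else M i j * s).
  rewrite -[q.[s]]/(horner_eval s q) -det_map_mx; congr (\det _).
  apply/matrixP => i j; rewrite !mxE; case: ifP => _ /=.
    by rewrite /horner_eval hornerE.
  by rewrite /horner_eval !hornerE.
have q1 : q.[1] = \det M.
  rewrite qE; congr (\det _); apply/matrixP => i j; rewrite !mxE mulr1.
  by case: ifP.
have q0 : q.[0] = \prod_i M i i.
  rewrite qE det_trig.
    by apply: eq_bigr => i _; rewrite mxE eqxx.
  by apply/is_trig_mxP => i j ij; rewrite mxE ifN ?mulr0// gt_eqF.
have qn0 s : 0 <= s <= 1 -> q.[s] != 0.
  move=> /andP[s0 s1]; rewrite qE; apply: diag_dominant_det_neq0 => i.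
  rewrite mxE eqxx; apply: le_lt_trans (dM i); apply: ler_sum => j ji.
  by rewrite mxE (negbTE ji) normrM (ger0_norm s0) ler_piMr.
rewrite -q1 -q0 [X in 0 < X]mulrC ltNge; apply/negP => q01.
have {}q01 : q.[0] * q.[1] < 0.
  rewrite lt_neqAle mulf_neq0 ?qn0 ?lexx ?ler01//.
have [s] := polyrcf.poly_ivtoo ler01 q01.
rewrite in_itv/= => /andP[s0 s1] /rootP/eqP; apply/negP/qn0.
by rewrite !ltW.
Qed.
End DiagonalDominance.

(** * The eigenvalue equation of the Jacobi matrix *)

Section Jacobi.
Variables (R : realType) (N : nat).
Notation p := (N.*2.+1).

(** The entries are numbered from 1 and extended by 0, so that the two ends of
    the chain need no separate treatment: a missing neighbour has entry 0. *)
Definition ecoord (A : nmodType) (u : 'I_p -> A) (k : nat) : A :=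
  if k is k'.+1 then oapp u 0 (insub k') else 0.

(** In the chain 1, ..., p the bonds have weights a, 1, a, 1, ... in turn.
    [sigma k] is the neighbour of [k] across the bond of weight [a], and [tau k]
    the one across the bond of weight 1; both are involutions. *)
Definition sigma (k : nat) := if odd k then k.+1 else k.-1.
Definition tau (k : nat) := if odd k then k.-1 else k.+1.

Lemma ecoord_ord (A : nmodType) (u : 'I_p -> A) (i : 'I_p) : ecoord u i.+1 = u i.
Proof. by rewrite /ecoord valK. Qed.

Variant ecoord_spec (k : nat) : Prop :=
  | EcoordIn (i : 'I_p) of k = i.+1
  | EcoordOut of (k = 0%N \/ p < k)%N &
      (forall (A : nmodType) (u : 'I_p -> A), ecoord u k = 0).

Lemma ecoordP k : ecoord_spec k.
Proof.
case: k => [|k]; first by apply: EcoordOut; [left|].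
have [kp|kp] := ltnP k p; first exact: (@EcoordIn _ (Ordinal kp)).
by apply: EcoordOut; [right|move=> A u; rewrite /ecoord insubF// ltnNge kp].
Qed.

Lemma ecoordE (A : nmodType) (u : 'I_p -> A) k :
  ecoord u k = \sum_(j < p) u j *+ (j.+1 == k).
Proof.
have [i ->|ko ->] := ecoordP k.
  rewrite ecoord_ord (bigD1 i)//= eqxx mulr1n big1 ?addr0// => j ji.
  by rewrite eqSS (negbTE (ji : (j : nat) != i)).
rewrite big1// => j _; case: eqP => // jk; have := ltn_ord j.
by case: ko; lia.
Qed.

Lemma ecoord_eq (A : nmodType) (u w : 'I_p -> A) k : u =1 w ->
  ecoord u k = ecoord w k.
Proof. by move=> uw; rewrite !ecoordE; apply: eq_bigr => j _; rewrite uw. Qed.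

Lemma ecoordB (A : zmodType) (u w : 'I_p -> A) k :
  ecoord (fun i => u i - w i) k = ecoord u k - ecoord w k.
Proof.
by rewrite !ecoordE -sumrB; apply: eq_bigr => j _; rewrite mulrnBl.
Qed.

Lemma ecoordZ (u : 'I_p -> R) c k :
  ecoord (fun i => c * u i) k = c * ecoord u k.
Proof. by rewrite !ecoordE mulr_sumr; apply: eq_bigr => j _; rewrite mulrnAr. Qed.

Lemma le_norm_ecoord (u : 'I_p -> R) k M : 0 <= M ->
  (forall j : 'I_p, j.+1 = k -> `|u j| <= M) -> `|ecoord u k| <= M.
Proof.
move=> M0 uM; have [i ki|_ ->] := ecoordP k; last by rewrite normr0.
by rewrite ki ecoord_ord; exact: uM.
Qed.

Lemma sigmaC (i j : nat) : (i.+1 == sigma j.+1) = (j.+1 == sigma i.+1).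
Proof.
have := odd_double_half i; have := odd_double_half j; rewrite /sigma /=.
by case: (odd i); case: (odd j) => /=; lia.
Qed.

Lemma tauC (i j : nat) : (i.+1 == tau j.+1) = (j.+1 == tau i.+1).
Proof.
have := odd_double_half i; have := odd_double_half j; rewrite /tau /=.
by case: (odd i); case: (odd j) => /=; lia.
Qed.

Lemma sigma_neq k : sigma k.+1 != k.+1.
Proof. by rewrite /sigma; case: ifP => _; apply/eqP => /=; lia. Qed.

Lemma tau_neq k : tau k.+1 != k.+1.
Proof. by rewrite /tau; case: ifP => _; apply/eqP => /=; lia. Qed.

Lemma sigma_tau_neq k q : q.+1 = tau k.+1 -> k.+1 != sigma q.+1.
Proof.
move=> ->; apply/eqP; rewrite /sigma /tau /=.
by have := odd_double_half k; case: (odd k) => /=; case: ifP => /=; lia.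
Qed.

Lemma tau_sigma_neq k q : q.+1 = sigma k.+1 -> k.+1 != tau q.+1.
Proof.
move=> ->; apply/eqP; rewrite /sigma /tau /=.
by have := odd_double_half k; case: (odd k) => /=; case: ifP => /=; lia.
Qed.

Lemma sigma_odd k q : sigma k.+1 = q.+1 -> odd k -> (q < k)%N.
Proof. by rewrite /sigma /= => + ok; rewrite ok /=; lia. Qed.

Lemma sigma_even k q : sigma k.+1 = q.+1 -> ~~ odd k -> (k < q)%N.
Proof. by rewrite /sigma /= => + ok; rewrite ok /=; lia. Qed.

Lemma sigma_in (k : 'I_p) : (k.+1 < p)%N -> exists q : 'I_p, sigma k.+1 = q.+1.
Proof.
move=> kp; case: (ecoordP (sigma k.+1)) => [q|ko _]; first by exists q.
exfalso; move: ko; rewrite /sigma /=; have := odd_double_half k.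
by case: (odd k) => /=; lia.
Qed.

Lemma jacobiE (v : 'rV[R]_p) a t i j :
  jacobi v a t i j =
  t * v 0 i *+ (j == i) + a *+ (j.+1 == sigma i.+1) + 1 *+ (j.+1 == tau i.+1).
Proof.
rewrite mxE /sigma /tau -(inj_eq val_inj) -[j == i](inj_eq val_inj) /=.
rewrite [j == i :> nat]eq_sym.
case: (eqVneq (i : nat) j) => [<-|ij].
  have -> : (i.+1 == if ~~ odd i then i.+2 else i) = false.
    by case: ifP => _; apply/eqP; lia.
  have -> : (i.+1 == if ~~ odd i then (i : nat) else i.+2) = false.
    by case: ifP => _; apply/eqP; lia.
  by rewrite mulr1n !addr0.
rewrite mulr0n add0r.
case: (eqVneq (j : nat) i.+1) => [ji|ji]; last case: (eqVneq (i : nat) j.+1) => [ij'|ij'] /=.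
- rewrite ji /=; case: (odd i) => /=; do 2 (case: eqP => ?; try lia);
  by rewrite ?mulr1n ?mulr0n ?addr0 ?add0r.
- rewrite ij' /=; case: (odd j) => /=; do 2 (case: eqP => ?; try lia);
  by rewrite ?mulr1n ?mulr0n ?addr0 ?add0r.
- case: (odd i) => /=; do 2 (case: eqP => ?; try lia);
  by rewrite ?mulr1n ?mulr0n ?addr0 ?add0r.
Qed.

Lemma jacobi_sym (v : 'rV[R]_p) a t : (jacobi v a t)^T = jacobi v a t.
Proof.
apply/matrixP => i j; rewrite mxE !jacobiE sigmaC tauC eq_sym.
by case: eqP => [->|].
Qed.

Definition eigeneq (v : 'rV[R]_p) (t a x : R) (u : 'I_p -> R) := forall i : 'I_p,
  x * u i = t * v 0 i * u i + a * ecoord u (sigma i.+1) + ecoord u (tau i.+1).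

Lemma char_poly_jacobiE (v : 'rV[R]_p) a t x :
  (char_poly (jacobi v a t)).[x] = \det (x%:M - jacobi v a t).
Proof.
rewrite -[LHS]/(horner_eval x _) -det_map_mx; congr (\det _).
apply/matrixP => i j; rewrite !mxE /= /horner_eval !hornerE.
by rewrite hornerMn hornerX.
Qed.

Lemma root_eigeneq (v : 'rV[R]_p) a t x : root (char_poly (jacobi v a t)) x ->
  exists2 u : 'I_p -> R, eigeneq v t a x u & exists i, u i != 0.
Proof.
rewrite /root char_poly_jacobiE => /det0P[u u0 uJ].
exists (fun i => u 0 i).
  move=> i; move/eqP: uJ; rewrite mulmxBr subr_eq0 mul_mx_scalar => /eqP.
  move/(congr1 (fun A : 'rV__ => A 0 i)); rewrite !mxE => ->.
  have -> : t * v 0 i * u 0 i = \sum_(j < p) (t * v 0 i * u 0 j) *+ (j == i).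
    rewrite (bigD1 i)//= eqxx big1 ?addr0// => j /negbTE ->; exact: mulr0n.
  rewrite !ecoordE mulr_sumr -!big_split/=; apply: eq_bigr => j _.
  rewrite jacobiE sigmaC tauC eq_sym.
  rewrite !mulrDr !mulrnAr mulr1 (mulrC a) (mulrC _ (u 0 j)).
  by case: eqP => [->|_]; rewrite ?mulr0n ?mulr1n.
apply/existsP; apply: contra_neqT u0 => /existsPn u0; apply/rowP => i.
by rewrite mxE; apply/eqP; have := u0 i; rewrite negbK.
Qed.
End Jacobi.
Arguments ecoord : simpl never.

(** * Localization of the eigenvalues and eigenvectors at large coupling *)

Section LargeCoupling.
Variables (R : realType) (N : nat).
Notation p := (N.*2.+1).
Variables (v : 'rV[R]_p) (t L : R).
Hypothesis v_gap : forall i j : 'I_p, (i < j)%N -> t * v 0 i + (L + 4) <= t * v 0 j.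
Hypothesis L_ge5 : 5 <= L.

Lemma scaled_gap (i k : 'I_p) : i != k -> L + 4 <= `|t * v 0 k - t * v 0 i|.
Proof.
move=> ik; have [|] := ltnP i k => [/v_gap vik|].
  by rewrite ler_normr; apply/orP; left; lra.
rewrite leq_eqVlt => /orP[/eqP /val_inj ki|/v_gap vki]; first by rewrite ki eqxx in ik.
by rewrite ler_normr; apply/orP; right; lra.
Qed.

Lemma far_gap (i k : 'I_p) x : i != k -> `|x - t * v 0 k| <= 4 ->
  L <= `|x - t * v 0 i|.
Proof.
move=> /scaled_gap ik xk; have := ler_distD x (t * v 0 k) (t * v 0 i).
rewrite (distrC (t * v 0 k) x); lra.
Qed.

(** Each row has at most one entry [a] and one entry 1 off the diagonal. *)
Lemma offdiag_jacobi a i : 0 <= a <= 2 ->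
  \sum_(j | j != i) `|jacobi v a t i j| <= 3.
Proof.
move=> /andP[a0 a2].
rewrite (@le_trans _ _ (\sum_(j < p) (a *+ (j.+1 == sigma i.+1) + 1 *+ (j.+1 == tau i.+1))))//.
  rewrite [leRHS](bigID (fun j => j == i))/= ler_wpDl//.
    by apply: sumr_ge0 => j _; rewrite addr_ge0 ?mulrn_wge0.
  apply: ler_sum => j /negbTE ji; rewrite jacobiE ji mulr0n add0r ger0_norm//.
  by rewrite addr_ge0 ?mulrn_wge0.
rewrite big_split/= -(ecoordE (fun=> a)) -(ecoordE (fun=> 1)).
have := @le_norm_ecoord R N (fun=> a) (sigma i.+1) a a0.
have := @le_norm_ecoord R N (fun=> 1) (tau i.+1) 1 ler01.
rewrite normr1 (ger0_norm a0) => /(_ (fun _ _ => lexx _)) h1 /(_ (fun _ _ => lexx _)) h2.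
move/ler_normlP: h1 => [_ h1]; move/ler_normlP: h2 => [_ h2]; lra.
Qed.

Lemma jacobi_diag a i : jacobi v a t i i = t * v 0 i.
Proof. by rewrite mxE eqxx. Qed.

Lemma shift_diag_dominant a x : 0 <= a <= 2 ->
  (forall i, 4 <= `|x - t * v 0 i|) -> diag_dominant (x%:M - jacobi v a t).
Proof.
move=> a02 xv i; rewrite (_ : _ i i = x - t * v 0 i); last first.
  by rewrite mxE [X in X + _]mxE mxE jacobi_diag eqxx.
apply: lt_le_trans (xv i); apply: (@le_lt_trans _ _ 3); last by lra.
apply: le_trans (offdiag_jacobi i a02); apply: ler_sum => j /negbTE ji.
by rewrite mxE [X in X + _]mxE eq_sym ji mulr0n add0r mxE normrN.
Qed.

(** At t v_k - 4 and t v_k + 4 the shifted matrix is diagonally dominant, so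
    the characteristic polynomial has the sign of the product of the
    x - t v_i. Between the two points only the factor i = k changes sign. *)
Lemma root_near a (k : 'I_p) : 0 <= a <= 2 ->
  exists2 x, `|x - t * v 0 k| <= 4 & root (char_poly (jacobi v a t)) x.
Proof.
move=> a02; set q := char_poly _.
have far s i : `|s| = 4 -> 4 <= `|t * v 0 k + s - t * v 0 i|.
  move=> s4; have [->|/scaled_gap ik] := eqVneq i k; first by rewrite addrAC subrr add0r s4.
  have := L_ge5.
  have := ler_normD (t * v 0 k + s - t * v 0 i) (- s).
  rewrite (_ : _ + - s = t * v 0 k - t * v 0 i); last by ring.
  rewrite normrN s4. lra.
have n4 : `|4 : R| = 4 by rewrite ger0_norm.
have nN4 : `|- 4 : R| = 4 by rewrite normrN.
have sgn s : `|s| = 4 -> 0 < q.[t * v 0 k + s] * \prod_i (t * v 0 k + s - t * v 0 i).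
  move=> s4; rewrite char_poly_jacobiE.
  rewrite (eq_bigr (fun i => ((t * v 0 k + s)%:M - jacobi v a t) i i)); last first.
    by move=> i _; rewrite mxE [X in _ = X + _]mxE mxE jacobi_diag eqxx.
  by apply/diag_dominant_det_sign/shift_diag_dominant => // i; exact: far.
have qq : q.[t * v 0 k + -4] * q.[t * v 0 k + 4] < 0.
  have := mulr_gt0 (sgn _ nN4) (sgn _ n4); rewrite mulrACA -big_split/=.
  suff h : \prod_(i < p) ((t * v 0 k + -4 - t * v 0 i) * (t * v 0 k + 4 - t * v 0 i)) < 0.
    by rewrite (nmulr_lgt0 _ h).
  rewrite (bigD1 k)//= pmulr_llt0; first nra.
  apply: prodr_gt0 => i /scaled_gap ik.
  have {ik} : 9 <= `|t * v 0 k - t * v 0 i| by move: L_ge5 ik; lra.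
  by rewrite ler_normr => /orP[] h; nra.
have [|x] := polyrcf.poly_ivtoo _ qq; first by lra.
rewrite in_itv/= => /andP[x1 x2] xr; exists x => //.
by rewrite ler_norml; lra.
Qed.

Definition eigval a (k : nat) : R := (eigenvalues (jacobi v a t))`_k.

(** The roots near the p numbers t v_k are distinct and increase with k, so
    they are all the roots, in order. *)
Lemma eigval_near a (k : 'I_p) : 0 <= a <= 2 ->
  `|eigval a k - t * v 0 k| <= 4 /\ root (char_poly (jacobi v a t)) (eigval a k).
Proof.
move=> a02.
have /fin_all_exists[r rP] : forall k, exists x,
    `|x - t * v 0 k| <= 4 /\ root (char_poly (jacobi v a t)) x.
  by move=> i; have [x] := root_near i a02; exists x.
have r_lt (i j : 'I_p) : (i < j)%N -> r i < r j.
  move=> /v_gap; have [/ler_normlP[_ +] _] := rP i; have [/ler_normlP[+ _] _] := rP j.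
  have := L_ge5; lra.
have r_inj : injective r.
  move=> i j rij; apply/val_inj; have [/r_lt|/r_lt|//] := ltngtP i j;
  by rewrite rij ltxx.
have [sE cE] := eigenvaluesP (jacobi_sym v a t).
set s := eigenvalues _ in sE cE *.
have ss : size s = p.
  by have := size_char_poly (jacobi v a t); rewrite cE size_prod_XsubC => -[].
pose s' := [seq r i | i <- enum 'I_p].
have us' : uniq s' by rewrite map_inj_uniq ?enum_uniq.
have ss' : {subset s' <= s}.
  by move=> x /mapP[i _ ->]; rewrite -root_prod_XsubC -cE; case: (rP i).
have ss'p : size s' = p by rewrite size_map size_enum_ord.
have [] := uniq_min_size us' ss'; rewrite ss ss'p// => es us.
have s's : sorted <=%R s'.
  have : sorted ltn (map val (enum 'I_p)) by rewrite val_enum_ord iota_ltn_sorted.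
  rewrite sorted_map; apply: homo_sorted => i j /r_lt; exact: ltW.
have sE' : s = s'.
  apply: (sorted_eq le_trans le_anti) => //.
  apply: uniq_perm => [|//|x]; last by rewrite us.
  by apply: (leq_size_uniq us' ss'); rewrite ss ss'p.
suff -> : eigval a k = r k by [].
rewrite /eigval -/s sE' (nth_map ord0) ?size_enum_ord//.
by rewrite nth_ord_enum.
Qed.

(** With this normalization an eigenvector for an energy near t v_k is a small
    perturbation of the k-th unit vector. *)
Definition eigvec (k : 'I_p) (a x : R) (u : 'I_p -> R) :=
  [/\ `|x - t * v 0 k| <= 4, eigeneq v t a x u, u k = 1 & forall i, `|u i| <= 1].

(** Row [i], in which the coefficient x - t v_i of [u i] is at least [L]. *)
Lemma eigeneq_bound a x u (i k : 'I_p) A B : 0 <= a ->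
  `|x - t * v 0 k| <= 4 -> eigeneq v t a x u -> i != k -> 0 <= A -> 0 <= B ->
  (forall j : 'I_p, j.+1 = sigma i.+1 -> `|u j| <= A) ->
  (forall j : 'I_p, j.+1 = tau i.+1 -> `|u j| <= B) ->
  L * `|u i| <= a * A + B.
Proof.
move=> a0 xk eu ik A0 B0 uA uB.
apply: (@le_trans _ _ (`|x - t * v 0 i| * `|u i|)).
  by rewrite ler_wpM2r// (far_gap ik).
rewrite -normrM mulrBl eu addrAC [_ + _ - _]addrAC subrr add0r.
rewrite (le_trans (ler_normD _ _))// lerD ?le_norm_ecoord// normrM (ger0_norm a0).
by rewrite ler_wpM2l// le_norm_ecoord.
Qed.

(** The largest entry of an eigenvector sits at [k]: at another site the bound
    L m <= (a + 1) m <= 3 m would fail. *)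
Lemma eigvec_exists a x (k : 'I_p) : 0 <= a <= 2 -> `|x - t * v 0 k| <= 4 ->
  root (char_poly (jacobi v a t)) x -> exists u, eigvec k a x u.
Proof.
move=> /andP[a0 a2] xk /root_eigeneq[u eu [i0 ui0]].
have [i imax] := finite_argmax (fun i => `|u i|).
have ui_gt0 : 0 < `|u i| by apply: lt_le_trans (imax i0); rewrite normr_gt0.
have ik : i = k.
  apply/eqP/negPn/negP => ik.
  have /(_ (fun j _ => imax j) (fun j _ => imax j)) :=
    eigeneq_bound a0 xk eu ik (ltW ui_gt0) (ltW ui_gt0).
  have := L_ge5; nra.
have uk0 : u k != 0 by rewrite -ik -normr_gt0.
exists (fun j => (u k)^-1 * u j); split => //; last 2 first.
- by rewrite mulVf.
- move=> j; rewrite normrM normfV -ik ler_pdivrMl// mulr1; exact: imax.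
move=> j; rewrite !ecoordZ mulrCA eu; ring.
Qed.

Section Estimates.
Variables (k : 'I_p) (a x : R) (u : 'I_p -> R).
Hypotheses (a02 : 0 <= a <= 2) (eu : eigvec k a x u).

Lemma eigvec_small i : i != k -> L * `|u i| <= 3.
Proof.
have /andP[a0 a2] := a02; have [xk e uk u1] := eu => ik.
apply: le_trans (_ : a * 1 + 1 <= _); last by lra.
by apply: (eigeneq_bound a0 xk e ik).
Qed.

(** The pair {k, tau k} is linked to the other sites only by bonds of weight
    [a], so outside of this pair the entries vanish with [a]. The largest entry
    m there satisfies L m <= a + m, because [tau] preserves the
    complement of the pair. *)
Lemma eigvec_smaller i : i != k -> i.+1 != tau k.+1 -> (L - 1) * `|u i| <= a.
Proof.
have /andP[a0 a2] := a02; have [xk e uk u1] := eu.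
pose S (i : 'I_p) := (i != k) && (i.+1 != tau k.+1).
have [j jmax] := finite_argmax (fun i => if S i then `|u i| else 0).
suff jE : S j -> (L - 1) * `|u j| <= a.
  move=> ik it; have := jmax i; rewrite /S ik it /=; case: ifPn => [/jE h|_] h2.
    by apply: le_trans h; rewrite ler_wpM2l// subr_ge0; have := L_ge5; lra.
  by have := normr_ge0 (u i); have := L_ge5; nra.
move=> Sj; have /andP[jk jt] := Sj.
suff : L * `|u j| <= a * 1 + `|u j| by lra.
apply: (eigeneq_bound a0 xk e jk) => // l lt.
have := jmax l; rewrite Sj ifT//; apply/andP; split.
  by apply: contra_neq jt => lk; apply/eqP; rewrite tauC -lk -lt.
by apply: contra_neq jk => lk; apply/val_inj/eqP; rewrite -eqSS;
  move/eqP: lk; rewrite tauC => /eqP ->; rewrite tauC lt.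
Qed.

End Estimates.
End LargeCoupling.

(** * Second order expansion of the eigenvalues *)

Section EigenvectorExpansion.
Variables (R : realType) (N : nat).
Notation p := (N.*2.+1).
Variables (v : 'rV[R]_p) (t L : R).
Hypothesis v_gap : forall i j : 'I_p, (i < j)%N -> t * v 0 i + (L + 4) <= t * v 0 j.
Hypothesis L_ge5 : 5 <= L.
Notation eigvec := (eigvec v t).

Lemma sum_ecoord_sigma (u w : 'I_p -> R) :
  \sum_(i < p) u i * ecoord w (sigma i.+1) = \sum_(i < p) ecoord u (sigma i.+1) * w i.
Proof.
under eq_bigr do rewrite ecoordE mulr_sumr.
under [RHS]eq_bigr do rewrite ecoordE mulr_suml.
rewrite exchange_big/=; apply: eq_bigr => i _; apply: eq_bigr => j _.
by rewrite sigmaC mulrnAr mulrnAl.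
Qed.

Lemma sum_ecoord_tau (u w : 'I_p -> R) :
  \sum_(i < p) u i * ecoord w (tau i.+1) = \sum_(i < p) ecoord u (tau i.+1) * w i.
Proof.
under eq_bigr do rewrite ecoordE mulr_sumr.
under [RHS]eq_bigr do rewrite ecoordE mulr_suml.
rewrite exchange_big/=; apply: eq_bigr => i _; apply: eq_bigr => j _.
by rewrite tauC mulrnAr mulrnAl.
Qed.

(** The matrices of weights [a] and [a'] differ only on the [sigma] bonds; pair
    the first equation with [u'] and the second one with [u]. *)
Lemma eigeneq_diff a a' x x' (u u' : 'I_p -> R) :
  eigeneq v t a x u -> eigeneq v t a' x' u' ->
  (x' - x) * (\sum_(i < p) u i * u' i) =
  (a' - a) * \sum_(i < p) u i * ecoord u' (sigma i.+1).
Proof.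
move=> eu eu'.
have E1 : x' * (\sum_(i < p) u i * u' i) = \sum_(i < p) t * v 0 i * u i * u' i +
    a' * (\sum_(i < p) u i * ecoord u' (sigma i.+1)) + \sum_(i < p) u i * ecoord u' (tau i.+1).
  rewrite !mulr_sumr -!big_split; apply: eq_bigr => i _ /=.
  rewrite mulrCA eu'; ring.
have E2 : x * (\sum_(i < p) u i * u' i) = \sum_(i < p) t * v 0 i * u i * u' i +
    a * (\sum_(i < p) u i * ecoord u' (sigma i.+1)) + \sum_(i < p) u i * ecoord u' (tau i.+1).
  rewrite sum_ecoord_sigma sum_ecoord_tau !mulr_sumr -!big_split; apply: eq_bigr => i _ /=.
  rewrite mulrA eu; ring.
rewrite mulrBl E1 E2; ring.
Qed.

Lemma eigeneq_orth a x x' (u u' : 'I_p -> R) :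
  eigeneq v t a x u -> eigeneq v t a x' u' -> x != x' ->
  \sum_(i < p) u i * u' i = 0.
Proof.
move=> eu eu' xx'; have /eqP := eigeneq_diff eu eu'.
by rewrite subrr mul0r mulf_eq0 subr_eq0 eq_sym (negbTE xx') => /eqP.
Qed.

(** Row [k] expresses the energy by the entries of [u] at the two neighbours of
    [k]. The row of a neighbour [q] determines [u q]: its other neighbour has
    an entry of order 1/L, and replacing [x] by t v_k costs as little. *)
Lemma eigvec_expansion (k : 'I_p) a x u : 0 <= a <= 2 -> eigvec k a x u ->
  `|x - t * v 0 k
    - (a ^+ 2 * ecoord (fun q => (t * v 0 k - t * v 0 q)^-1) (sigma k.+1)
       + ecoord (fun q => (t * v 0 k - t * v 0 q)^-1) (tau k.+1))| <= 48 / L ^+ 2.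
Proof.
move=> a02 evu; have /andP[a0 a2] := a02; have [xk eu uk u1] := evu.
have L0 : 0 < L by move: L_ge5; lra.
have small (q : 'I_p) : q != k -> `|u q| <= 3 / L.
  by move=> qk; rewrite ler_pdivlMr// mulrC (eigvec_small v_gap a02 evu).
(* 12 / L bounds |x - t v_k| |u q|, as |x - t v_k| <= 4 and |u q| <= 3 / L *)
have quot (q : 'I_p) c r : q != k ->
    (x - t * v 0 q) * u q = c + r ->
    `|u q - c * (t * v 0 k - t * v 0 q)^-1| <= (`|r| + 12 / L) / L.
  move=> qk E; have := scaled_gap v_gap qk.
  set d := t * v 0 k - t * v 0 q => dL.
  have d0 : d != 0 by rewrite -normr_gt0; move: dL L0; lra.
  have -> : u q - c / d = (r - (x - t * v 0 k) * u q) / d.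
    have -> : u q = (d * u q) / d by rewrite mulrAC divff// mul1r.
    rewrite -mulrBl; congr (_ / _).
    rewrite mulrAC divff// mul1r.
    have -> : d * u q = (x - t * v 0 q) * u q - (x - t * v 0 k) * u q by rewrite /d; ring.
    rewrite E; ring.
  rewrite normrM normfV ler_pM//.
  - rewrite (le_trans (ler_normB _ _))// lerD2l normrM.
    have -> : 12 / L = 4 * (3 / L) by field; rewrite gt_eqF.
    by rewrite ler_pM// small.
  - by rewrite lef_pV2 ?posrE// ?normr_gt0//; move: dL; lra.
have tau_near : `|ecoord u (tau k.+1)
    - ecoord (fun q => (t * v 0 k - t * v 0 q)^-1) (tau k.+1)| <= 18 / L ^+ 2.
  rewrite -ecoordB; apply: le_norm_ecoord => [|q qt].
    by rewrite divr_ge0// exprn_ge0// ltW.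
  have qk : q != k by apply: contra_neq (tau_neq k) => qk; rewrite -qt qk.
  have := @quot q 1 (a * ecoord u (sigma q.+1)) qk; rewrite mul1r => /(_ _)/le_trans; apply.
    have /eqP : k.+1 == tau q.+1 by rewrite tauC qt.
    rewrite mulrBl eu => <-; rewrite ecoord_ord uk; ring.
  rewrite expr2 invfM mulrA ler_pM2r ?invr_gt0//.
  have -> : 18 / L = 6 / L + 12 / L by field; rewrite gt_eqF.
  rewrite lerD2r normrM ger0_norm//.
  have -> : 6 / L = 2 * (3 / L) by field; rewrite gt_eqF.
  apply: ler_pM => //; apply: le_norm_ecoord => [|j js]; first by rewrite divr_ge0// ltW.
  apply: small; apply: contra_eq_neq js => ->; exact: sigma_tau_neq.
have sigma_near : `|ecoord u (sigma k.+1)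
    - a * ecoord (fun q => (t * v 0 k - t * v 0 q)^-1) (sigma k.+1)| <= 15 / L ^+ 2.
  rewrite -ecoordZ -ecoordB; apply: le_norm_ecoord => [|q qt].
    by rewrite divr_ge0// exprn_ge0// ltW.
  have qk : q != k by apply: contra_neq (sigma_neq k) => qk; rewrite -qt qk.
  have := @quot q a (ecoord u (tau q.+1)) qk; move=> /(_ _)/le_trans; apply.
    have /eqP : k.+1 == sigma q.+1 by rewrite sigmaC qt.
    rewrite mulrBl eu => <-; rewrite ecoord_ord uk; ring.
  rewrite expr2 invfM mulrA ler_pM2r ?invr_gt0//.
  have -> : 15 / L = 3 / L + 12 / L by field; rewrite gt_eqF.
  rewrite lerD2r.
  apply: le_norm_ecoord => [|j js]; first by rewrite divr_ge0// ltW.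
  apply: small; apply: contra_eq_neq js => ->; exact: tau_sigma_neq.
have -> : x = t * v 0 k + a * ecoord u (sigma k.+1) + ecoord u (tau k.+1).
  by have := eu k; rewrite uk !mulr1.
(* the error of the [sigma] neighbour enters multiplied by a <= 2 *)
have -> : 48 / L ^+ 2 = 2 * (15 / L ^+ 2) + 18 / L ^+ 2.
  by field; rewrite gt_eqF.
set A := ecoord u _ in sigma_near *; set B := ecoord u _ in tau_near *.
set A' := ecoord _ (sigma _) in sigma_near *; set B' := ecoord _ (tau _) in tau_near *.
have -> : t * v 0 k + a * A + B - t * v 0 k - (a ^+ 2 * A' + B') =
  a * (A - a * A') + (B - B') by ring.
rewrite (le_trans (ler_normD _ _))// lerD// normrM ger0_norm//.
by rewrite ler_pM.
Qed.
End EigenvectorExpansion.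

(** * Dependence of the eigenpairs on the bond weight *)

Section EigenvectorComparison.
Variables (R : realType) (N : nat).
Notation p := (N.*2.+1).
Variables (v : 'rV[R]_p) (t L : R).
Hypothesis v_gap : forall i j : 'I_p, (i < j)%N -> t * v 0 i + (L + 4) <= t * v 0 j.
Hypothesis L_ge5 : 5 <= L.
Hypothesis L_gep : 18 * p%:R <= L.
Notation eigvec := (eigvec v t).

Section Compare.
Variables (k : 'I_p) (a a' x x' : R) (u u' : 'I_p -> R).
Hypotheses (a02 : 0 <= a <= 2) (a'02 : 0 <= a' <= 2).
Hypotheses (evu : eigvec k a x u) (evu' : eigvec k a' x' u').

Let L0 : 0 < L. Proof. by move: L_ge5; lra. Qed.

(** The product of the entries at [k] is 1; each of the others is at most
    9 / L^2, and there are fewer than p <= L / 18 of them. *)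
Lemma eigvec_overlap : 2^-1 <= \sum_(i < p) u i * u' i.
Proof.
have [_ _ uk _] := evu; have [_ _ uk' _] := evu'.
rewrite (bigD1 k)//= uk uk' mul1r.
set S := \sum_(_ | _) _.
have : `|S| <= 2^-1.
  apply: (@le_trans _ _ (\sum_(i < p) (2 * p%:R)^-1)).
    rewrite [leRHS](bigID (fun i => i != k))/= ler_wpDr//.
      by apply: sumr_ge0 => i _; rewrite invr_ge0 mulr_ge0.
    rewrite (le_trans (ler_norm_sum _ _ _))//; apply: ler_sum => i ik.
    rewrite -[leRHS]mul1r ler_pdivlMr ?mulr_gt0// normrM.
    have h1 := eigvec_small v_gap a02 evu ik.
    have h2 := eigvec_small v_gap a'02 evu' ik.
    have h3 : L ^+ 2 * (`|u i| * `|u' i|) <= 9.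
      rewrite expr2 mulrACA -[9](_ : 3 * 3 = _); last by ring.
      by apply: ler_pM => //; rewrite mulr_ge0// ltW.
    have h4 : 0 <= `|u i| * `|u' i| by rewrite mulr_ge0.
    rewrite -(@ler_pM2l _ 9)// mulr1; apply: le_trans h3.
    have h5 : 18 * p%:R <= L ^+ 2 by move: L_gep L_ge5; set P := p%:R; nra.
    have := ler_wpM2r h4 h5; set w := `|_| * _; set P := p%:R; lra.
  rewrite sumr_const card_ord -[leLHS]mulr_natl invfM mulrCA mulfV ?mulr1 ?pnatr_eq0//.
move=> /ler_normlP[]; lra.
Qed.

Lemma norm_ecoord_eigvec (w : 'I_p -> R) k' : (forall i, `|w i| <= 1) ->
  `|ecoord w k'| <= 1.
Proof. by move=> w1; apply: le_norm_ecoord. Qed.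

(** A consequence of [eigeneq_diff], as the overlap is at least 1/2. *)
Lemma eigval_lipschitz : `|x' - x| <= 2 * p%:R * `|a' - a|.
Proof.
have [_ eu uk u1] := evu; have [_ eu' uk' u1'] := evu'.
have := eigeneq_diff eu eu'; have := eigvec_overlap.
set S := \sum_(_ < _) _; set T := \sum_(_ < _) _ => S2 E.
have T1 : `|T| <= p%:R.
  rewrite (le_trans (ler_norm_sum _ _ _))//.
  rewrite -[p in leRHS]card_ord -sumr_const; apply: ler_sum => i _.
  by rewrite normrM mulr_ile1// norm_ecoord_eigvec.
have : `|x' - x| * 2^-1 <= `|x' - x| * S by rewrite ler_wpM2l.
have : `|x' - x| * S = `|a' - a| * `|T|.
  by rewrite -normrM -E normrM [`|S|]gtr0_norm//; move: S2; lra.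
have : `|a' - a| * `|T| <= `|a' - a| * p%:R by rewrite ler_wpM2l.
lra.
Qed.

(** Both vectors have entry 1 at [k]. At the site [j] of the largest difference
    m, subtracting the two equations bounds L m by 3 m plus the changes of the
    weight and of the energy. *)
Lemma eigvec_lipschitz i : `|u' i - u i| <= (2 * p%:R + 1) * `|a' - a|.
Proof.
have [xk eu uk u1] := evu; have [_ eu' uk' u1'] := evu'.
have /andP[a0 a2] := a02.
have [j jmax] := finite_argmax (fun i => `|u' i - u i|).
apply: le_trans (jmax i) _.
have C0 : 0 <= (2 * p%:R + 1) * `|a' - a| by rewrite mulr_ge0// addr_ge0// mulr_ge0.
have [->|jk] := eqVneq j k; first by rewrite uk uk' subrr normr0.
set m := `|_ - _|.
suff : L * m <= 3 * m + (2 * p%:R + 1) * `|a' - a|.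
  by have := normr_ge0 (u' j - u j); rewrite -/m; move: L_ge5; nra.
apply: (@le_trans _ _ (`|x - t * v 0 j| * m)).
  by apply: ler_wpM2r; [exact: normr_ge0|exact: (far_gap v_gap jk xk)].
rewrite -normrM.
have -> : (x - t * v 0 j) * (u' j - u j) =
    a * ecoord (fun i => u' i - u i) (sigma j.+1) +
    ecoord (fun i => u' i - u i) (tau j.+1) + (a' - a) * ecoord u' (sigma j.+1) -
    (x' - x) * u' j.
  rewrite !ecoordB.
  have -> : (x - t * v 0 j) * (u' j - u j) = x' * u' j - (x' - x) * u' j -
    t * v 0 j * u' j - (x * u j - t * v 0 j * u j) by ring.
  rewrite eu eu'; ring.
have le_m k' : `|ecoord (fun i => u' i - u i) k'| <= m.
  by apply: le_norm_ecoord => [|l _]; [exact: normr_ge0|exact: jmax].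
have xx : `|(x' - x) * u' j| <= 2 * p%:R * `|a' - a|.
  rewrite normrM; apply: le_trans eigval_lipschitz; exact: ler_piMr.
have aa : `|(a' - a) * ecoord u' (sigma j.+1)| <= `|a' - a|.
  by rewrite normrM; apply: ler_piMr => //; apply: norm_ecoord_eigvec.
have am : `|a * ecoord (fun i => u' i - u i) (sigma j.+1)| <= 2 * m.
  by rewrite normrM (ger0_norm a0); apply: ler_pM.
rewrite (le_trans (ler_normB _ _))//.
rewrite (le_trans (lerD (ler_normD _ _) (lexx _)))//.
rewrite (le_trans (lerD (lerD (ler_normD _ _) (lexx _)) (lexx _)))//.
have := le_m (tau j.+1); lra.
Qed.

Variable U : R.
Hypothesis v_bound : forall i j, `|t * v 0 i - t * v 0 j| + 4 <= U.
Hypothesis L_dominates : 4 * p%:R * U < L * (L - 1).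

(** The entry at the [sigma] neighbour of [k] carries the first order variation
    of the energy with the weight. It has the sign of t v_k - t v_q, and it is
    bounded below by a multiple of the weight, with the largest gap [U] in the
    denominator. *)
Lemma partner_size (b y : R) (w : 'I_p -> R) (q : 'I_p) : 0 <= b <= 2 ->
  eigvec k b y w -> sigma k.+1 = q.+1 ->
  3 / 4 * b <= U * ((-1) ^+ (~~ odd k) * w q).
Proof.
move=> b02 ew kq; have /andP[b0 b2] := b02; have [yk e wk w1] := ew.
have qk : sigma q.+1 = k.+1 by apply/eqP; rewrite eq_sym sigmaC kq.
have q_neq : q != k.
  by apply: contra_eq_neq kq => ->; exact: sigma_neq.
set g := (-1) ^+ _; set d := y - t * v 0 q.
have gg : g * g = 1 by rewrite -expr2 sqrr_sign.
have gd0 : 0 < g * d.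
  have [yl yr] := ler_normlP _ _ yk.
  rewrite /g /d; have [ok|ok] := boolP (odd k).
    by have /v_gap := sigma_odd kq ok; rewrite expr0 mul1r; move: L_ge5; lra.
  by have /v_gap := sigma_even kq ok; rewrite expr1; move: L_ge5; lra.
have dU : g * d <= U.
  rewrite -(gtr0_norm gd0) normrM normr_sign mul1r.
  have := ler_distD (t * v 0 k) y (t * v 0 q); have := v_bound k q; rewrite -/d; lra.
have dw : d * w q = b + ecoord w (tau q.+1).
  by rewrite /d mulrBl e qk ecoord_ord wk; ring.
have wt : `|ecoord w (tau q.+1)| <= b / 4.
  apply: le_norm_ecoord => [|j jq]; first by rewrite divr_ge0.
  have : (L - 1) * `|w j| <= b.
    apply: (eigvec_smaller v_gap L_ge5 b02 ew).
      by apply: contra_eq_neq jq => ->; apply: tau_sigma_neq.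
    apply: contra_neq q_neq => jk; apply/val_inj/eqP.
    rewrite -eqSS; move/eqP: jk; rewrite tauC => /eqP ->.
    by move/eqP: jq; rewrite tauC => /eqP ->.
  have := normr_ge0 (w j); move: L_ge5; nra.
have gw : 3 / 4 * b <= (g * d) * (g * w q).
  rewrite mulrACA gg mul1r dw; have [] := ler_normlP _ _ wt; lra.
have gw0 : 0 <= g * w q.
  rewrite -(pmulr_rge0 _ gd0); apply: le_trans gw; nra.
by apply: le_trans gw _; rewrite ler_wpM2r.
Qed.

(** In [eigeneq_diff] the sites [k] and [q = sigma k] contribute the entries of
    the two vectors at [q], of one sign and of order (a + a') / U. Every other
    term has one factor bounded by 3 / L and another one by a / (L - 1) or
    a' / (L - 1), so the hypothesis on L (L - 1) makes their sum smaller, even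
    for [a] and [a'] near 0. *)
Lemma eigval_strict_mono : (k.+1 < p)%N -> a < a' ->
  0 < (-1) ^+ (~~ odd k) * (x' - x).
Proof.
move=> kp aa'; have /andP[a0 a2] := a02; have /andP[a'0 a'2] := a'02.
have [q kq] := sigma_in kp.
have [_ eu uk u1] := evu; have [_ eu' uk' u1'] := evu'.
have q_neq : q != k.
  by apply: contra_eq_neq kq => ->; exact: sigma_neq.
have qk : sigma q.+1 = k.+1 by apply/eqP; rewrite eq_sym sigmaC kq.
have h1 := partner_size a02 evu kq; have h2 := partner_size a'02 evu' kq.
set g := (-1) ^+ _ in h1 h2 *.
have := eigeneq_diff eu eu'; have := eigvec_overlap.
set S := \sum_(_ < _) _ => S2 E.
have S0 : 0 < S by move: S2; lra.
rewrite -(pmulr_lgt0 _ S0) -mulrA E mulrCA pmulr_rgt0 ?subr_gt0//.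
rewrite (bigD1 k)//= (bigD1 q)//= uk mul1r kq qk !ecoord_ord uk' mulr1 addrA.
set T := \sum_(_ | _) _.
have U0 : 0 < U by have := v_bound k k; rewrite subrr normr0; lra.
have LL : 0 < L * (L - 1) by rewrite mulr_gt0// subr_gt0; move: L_ge5; lra.
have term i : i != k -> i != q ->
    L * (L - 1) * `|u i * ecoord u' (sigma i.+1)| <= 3 * (a + a').
  move=> ik iq; rewrite normrM.
  case: (ecoordP N (sigma i.+1)) => [j ij|_ ->]; last first.
    by rewrite normr0 !mulr0 mulr_ge0// addr_ge0.
  have ji : sigma j.+1 = i.+1 by apply/eqP; rewrite eq_sym sigmaC ij.
  have jk : j != k.
    by apply: contra_neq iq => jk; apply/val_inj/eqP; rewrite -eqSS -ji jk kq.
  have ij' : i != j.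
    by apply: contra_eq_neq ij => ->; exact: sigma_neq.
  rewrite ij ecoord_ord.
  have [it|it] := eqVneq i.+1 (tau k.+1).
    have jt : j.+1 != tau k.+1 by rewrite -it eqSS eq_sym.
    have := eigvec_smaller v_gap L_ge5 a'02 evu' jk jt.
    have := eigvec_small v_gap a02 evu ik.
    have := normr_ge0 (u i); have := normr_ge0 (u' j); move: L_ge5 a0 a'0.
    rewrite mulrACA => *; apply: (@le_trans _ _ (3 * a')); last by lra.
    by apply: ler_pM => //; apply: mulr_ge0 => //; lra.
  have := eigvec_smaller v_gap L_ge5 a02 evu ik it.
  have := eigvec_small v_gap a'02 evu' jk.
  have := normr_ge0 (u i); have := normr_ge0 (u' j); move: L_ge5 a0 a'0.
  rewrite [L * (L - 1)]mulrC mulrACA => *; apply: (@le_trans _ _ (a * 3)); last by lra.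
  by apply: ler_pM => //; apply: mulr_ge0 => //; lra.
have T1 : L * (L - 1) * `|T| <= 3 * p%:R * (a + a').
  apply: (@le_trans _ _ (\sum_(i < p) 3 * (a + a'))); last first.
    by rewrite sumr_const card_ord -[leLHS]mulr_natl; lra.
  rewrite [leRHS](bigID (fun i => (i != k) && (i != q)))/= ler_wpDr//.
    by apply: sumr_ge0 => i _; rewrite mulr_ge0// addr_ge0.
  apply: (@le_trans _ _ (L * (L - 1) *
      \sum_(i < p | (i != k) && (i != q)) `|u i * ecoord u' (sigma i.+1)|)).
    by apply: ler_wpM2l; [exact: ltW|exact: ler_norm_sum].
  by rewrite mulr_sumr; apply: ler_sum => i /andP[ik iq]; exact: term.
have : U * `|T| < 3 / 4 * (a + a').
  rewrite -(ltr_pM2l LL) mulrCA.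
  apply: (@le_lt_trans _ _ (U * (3 * p%:R * (a + a')))); first by rewrite ler_wpM2l// ltW.
  have : 0 < (a + a') by move: a0 aa'; lra.
  move: L_dominates; set P := p%:R; set w := a + a'; set LL' := L * _ => LL1 w0.
  have : (LL' - 4 * P * U) * w > 0 by rewrite mulr_gt0// subr_gt0.
  lra.
rewrite -(pmulr_rgt0 _ U0) !mulrDr.
have : - (U * `|T|) <= U * (g * T).
  rewrite -mulrN ler_pM2l// lerNl -mulrN.
  by rewrite (le_trans (ler_norm _))// normrM normrN normr_sign mul1r.
lra.
Qed.
End Compare.
End EigenvectorComparison.

(** * Expansion of the band ends *)

Section Regime.
Variables (R : realType) (N : nat).
Notation p := (N.*2.+1).
Variable v : 'rV[R]_p.

(** All gaps of the diagonal are at least L + 4 and at most U - 4. As [t] grows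
    both [L] and [U] can be taken proportional to [t], so that L^2 dominates
    U. *)
Definition regime (t L : R) :=
  [/\ forall i j : 'I_p, (i < j)%N -> t * v 0 i + (L + 4) <= t * v 0 j,
      5 <= L, 18 * p%:R <= L &
      exists2 U, forall i j, `|t * v 0 i - t * v 0 j| + 4 <= U &
                 4 * p%:R * U < L * (L - 1)].

Hypothesis v_incr :
  forall k : nat, (1 <= k < p)%N -> vcoord v k < vcoord v k.+1.

Lemma vcoord_ord (i : 'I_p) : vcoord v i.+1 = v 0 i.
Proof. exact: (ecoord_ord (v 0)). Qed.

Lemma v_lt (i j : 'I_p) : (i < j)%N -> v 0 i < v 0 j.
Proof.
rewrite -!vcoord_ord => ij.
have jp := ltn_ord j; move: (nat_of_ord j) ij jp => {j}.
elim=> // j IH; rewrite ltnS leq_eqVlt => /orP[/eqP <- jp|ij jp].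
  by apply: v_incr; rewrite ltnS.
apply: (@lt_trans _ _ (vcoord v j.+1)); first by apply: IH => //; exact: ltnW.
by apply: v_incr; rewrite ltnS.
Qed.

(** The minimum of the gaps is replaced by the reciprocal of the sum of their
    reciprocals, plus 1 to have a nonzero denominator. *)
Lemma v_gap_exists : exists2 delta, 0 < delta &
  forall i j : 'I_p, (i < j)%N -> v 0 i + delta <= v 0 j.
Proof.
pose d (ij : 'I_p * 'I_p) : R := v 0 ij.2 - v 0 ij.1.
pose S := \sum_(ij : 'I_p * 'I_p | (ij.1 < ij.2)%N) (d ij)^-1.
have d0 (ij : 'I_p * 'I_p) : (ij.1 < ij.2)%N -> 0 < d ij by move=> /v_lt; rewrite subr_gt0.
have S0 : 0 <= S by apply: sumr_ge0 => ij /d0; rewrite invr_ge0; exact: ltW.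
exists (S + 1)^-1; first by rewrite invr_gt0 ltr_wpDl.
move=> i j ij; rewrite addrC -lerBrDr -[leRHS]/(d (i, j)).
have dij : 0 < d (i, j) by apply: d0.
rewrite -[leRHS]invrK lef_pV2 ?posrE ?invr_gt0// ?ltr_wpDl//.
rewrite /S (bigD1 (i, j))//= -addrA ler_wpDr// addr_ge0//.
by apply: sumr_ge0 => kl /andP[/d0 + _]; rewrite invr_ge0; exact: ltW.
Qed.

Lemma regime_eventually : exists delta T0, [/\ 0 < delta, 0 < T0 &
  forall t, T0 <= t -> 9 <= t * delta /\ regime t (t * delta - 4)].
Proof.
have [delta d0 gap] := v_gap_exists.
pose D := \sum_(i < p) `|v 0 i|.
have D0 : 0 <= D by apply: sumr_ge0.
have vD (i : 'I_p) : `|v 0 i| <= D.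
  by rewrite /D (bigD1 i)//= ler_wpDr// sumr_ge0.
pose P : R := p%:R.
have P0 : 0 <= P by [].
(* With L = t delta - 4 and U = 2 t D + 4, the quotient U / L stays below
   4 D / delta + 1; K is large enough to absorb this and the lower bounds on L *)
pose K := 18 * P + 4 * P * (4 * (D / delta) + 1) + 11.
have Dd0 : 0 <= D / delta by rewrite divr_ge0// ltW.
have K11 : 11 <= K.
  by rewrite lerDr addr_ge0 ?mulr_ge0// addr_ge0// mulr_ge0.
have K0 : 0 < K by apply: lt_le_trans K11.
exists delta, (K / delta); split => // [|t tK]; first by rewrite divr_gt0.
have tdK : K <= t * delta by rewrite -ler_pdivrMr.
have t0 : 0 < t by apply: lt_le_trans tK; rewrite divr_gt0.
split; first by move: K11; lra.
set L := t * delta - 4.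
have L5 : 5 <= L by rewrite /L; move: K11; lra.
have Dd : 0 <= 4 * P * (4 * (D / delta) + 1) by rewrite mulr_ge0// ?mulr_ge0// addr_ge0// mulr_ge0.
split => //.
- move=> i j /gap ij; rewrite subrK -mulrDr; apply: ler_wpM2l => //; exact: ltW.
- by rewrite /L -/P; move: tdK; rewrite /K; lra.
exists (t * (2 * D) + 4).
  move=> i j; rewrite lerD2r -mulrBr normrM (gtr0_norm t0) ler_pM2l//.
  by rewrite (le_trans (ler_normB _ _))// mulr_natl mulr2n lerD.
have -> : t * (2 * D) + 4 = (L + 4) * (2 * (D / delta)) + 4.
  rewrite /L; field; rewrite gt_eqF//.
rewrite -/P.
have LK : 4 * P * (4 * (D / delta) + 1) + 2 <= L - 1.
  by rewrite /L; move: tdK; rewrite /K; move: P0; lra.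
apply: (@lt_le_trans _ _ (L * (4 * P * (4 * (D / delta) + 1) + 2))); last first.
  by rewrite ler_wpM2l//; move: L5; lra.
move: L5 P0 Dd0; set x := D / delta => L5 P0 Dd0.
have : 4 * P * ((L + 4) * (2 * x) + 4) <= L * (4 * P * (4 * x + 1)).
  rewrite [leRHS]mulrCA ler_wpM2l// ?mulr_ge0//.
  nra.
lra.
Qed.
End Regime.

Lemma sup_near (R : realType) (f : R -> R) B c a0 : 0 <= a0 <= 2 ->
  (forall a, 0 <= a <= 2 -> f a <= B + c) -> B - c <= f a0 ->
  `|sup [set f a | a in `[0, 2]%classic] - B| <= c.
Proof.
move=> a02 fB Bf.
have inI a : 0 <= a <= 2 -> [set f a | a in `[0, 2]%classic] (f a).
  by move=> h; exists a => //=; rewrite in_itv.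
have ub : ubound [set f a | a in `[0, 2]%classic] (B + c).
  by move=> _ [a /= + <-]; rewrite in_itv; exact: fB.
have h1 := ge_sup (ex_intro _ _ (inI _ a02)) ub.
have h2 := ub_le_sup (ex_intro _ _ ub) (inI _ a02).
rewrite ler_norml; lra.
Qed.

Lemma inf_near (R : realType) (f : R -> R) B c a0 : 0 <= a0 <= 2 ->
  (forall a, 0 <= a <= 2 -> B - c <= f a) -> f a0 <= B + c ->
  `|inf [set f a | a in `[0, 2]%classic] - B| <= c.
Proof.
move=> a02 fB Bf.
have inI a : 0 <= a <= 2 -> [set f a | a in `[0, 2]%classic] (f a).
  by move=> h; exists a => //=; rewrite in_itv.
have lb : lbound [set f a | a in `[0, 2]%classic] (B - c).
  by move=> _ [a /= + <-]; rewrite in_itv; exact: fB.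
have h1 := lb_le_inf (ex_intro _ _ (inI _ a02)) lb.
have h2 := ge_inf (ex_intro _ _ lb) (inI _ a02).
rewrite ler_norml; lra.
Qed.

Section BandEnds.
Variables (R : realType) (N : nat).
Notation p := (N.*2.+1).
Variable v : 'rV[R]_p.
Hypothesis v_incr :
  forall k : nat, (1 <= k < p)%N -> vcoord v k < vcoord v k.+1.

Let w (k q : 'I_p) := (v 0 k - v 0 q)^-1.

(** The two fractions of xi come from the left and the right neighbour of the
    site; here they are sorted by the weight of the bond. The numerators that
    vanish by convention belong to neighbours outside of the chain. *)
Lemma xiE (k : 'I_p) sgn : xi v sgn k.+1 =
  - ((if sgn then 2 else 0) ^+ 2 * ecoord (w k) (sigma k.+1)
     + ecoord (w k) (tau k.+1)).
Proof.
have quot c k' : ((k' = 0 \/ p < k')%N -> c = 0) ->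
    c / (vcoord v k' - vcoord v k.+1) = - (c * ecoord (w k) k').
  case: (ecoordP N k') => [q -> _|ko E /(_ ko) ->]; last by rewrite !mul0r oppr0.
  by rewrite !(vcoord_ord v) ecoord_ord /w -mulrN -invrN opprB.
have kp := ltn_ord k.
have p1 : (k.+1 == p.+1) = false by apply/eqP; lia.
have op : odd p by rewrite /= odd_double.
have c1 : (k = 0 :> nat \/ p < k)%N -> rcoef R N sgn k.+1 = 0.
  by case=> [->|]; [rewrite /rcoef eqxx|lia].
have c2 : (k.+2 = 0 \/ p < k.+2)%N -> rcoef R N sgn k.+2 = 0.
  by case=> // kp'; rewrite /rcoef (_ : k.+2 == p.+1) ?orbT//; apply/eqP; lia.
rewrite /xi (quot _ k.+1.-1 c1) (quot _ _ c2) -opprD; congr (- _).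
have [ok|ek] := boolP (odd k); rewrite /sigma /tau /= ?ok ?(negbTE ek) /=.
  have -> : rcoef R N sgn k.+1 = (if sgn then 2 else 0) ^+ 2.
    rewrite /rcoef p1 eqSS /= ok orbF; case: eqP => [k0|_ /=]; first by rewrite k0 in ok.
    by case: (sgn); rewrite ?expr0n//; ring.
  congr (_ + _); rewrite /rcoef (_ : k.+2 == p.+1 = false); last first.
    by apply/eqP => kE; have := congr1 odd kE; rewrite /= ok odd_double.
  by rewrite /= ok /= mul1r.
rewrite addrC; congr (_ + _).
  rewrite /rcoef; case: (eqVneq k.+2 p.+1) => [kE|_] /=.
    suff -> : ecoord (w k) k.+2 = 0 by rewrite !mulr0.
    by rewrite /ecoord insubF//; move: kE => [->]; rewrite ltnn.
  rewrite negbK (negbTE ek); congr (_ * _).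
  by case: (sgn); rewrite ?expr0n//; ring.
rewrite /rcoef p1 eqSS orbF /= ek; case: eqP => [->|_]; last by rewrite mul1r.
by rewrite mul0r.
Qed.

Lemma band_funE t a (k : 'I_p) :
  band_fun v t (k.+1%:Z - N%:Z - 1) a = eigval v t a k.
Proof.
by rewrite /band_fun /eigval (_ : absz _ = k)//; lia.
Qed.

(** The second order term is affine in a^2, with a slope of constant sign, so
    it is extremal at a = 0 and at a = 2. These give [xi] for the signs - and +;
    the sign of the slope, that is the parity of [k], tells which of them is
    the supremum. *)
Lemma band_end_expansion : exists C T0, [/\ 0 < C, 0 < T0 &
  forall t, T0 <= t -> forall (k : 'I_p) (sgn : bool),
  `|band_end v (sgn (+) odd k.+1) (k.+1%:Z - N%:Z - 1) t -
    (t * v 0 k - xi v sgn k.+1 / t)| <= C / t ^+ 2].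
Proof.
have [delta [T0 [d0 T00 reg]]] := regime_eventually v_incr.
(* 192 = 4 * 48, as L = t delta - 4 is at least t delta / 2 *)
exists (192 / delta ^+ 2), T0; split=> // [|t tT k sgn].
  by rewrite divr_gt0// exprn_gt0.
have [td9 [gap L5 _ _]] := reg t tT; set L := t * delta - 4 in gap L5.
have t0 : 0 < t by apply: lt_le_trans tT.
pose F a := a ^+ 2 * ecoord (w k) (sigma k.+1) + ecoord (w k) (tau k.+1).
have expand a : 0 <= a <= 2 ->
    `|eigval v t a k - (t * v 0 k + F a / t)| <= 192 / delta ^+ 2 / t ^+ 2.
  move=> a02; have [near rt] := eigval_near gap L5 k a02.
  have [u eu] := eigvec_exists gap L5 a02 near rt.
  have := eigvec_expansion gap L5 a02 eu.
  have wE k' : ecoord (fun q => (t * v 0 k - t * v 0 q)^-1) k' = t^-1 * ecoord (w k) k'.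
    by rewrite -ecoordZ; apply: ecoord_eq => q; rewrite -mulrBr invfM.
  rewrite !wE => h.
  have -> : eigval v t a k - (t * v 0 k + F a / t) = eigval v t a k - t * v 0 k -
     (a ^+ 2 * (t^-1 * ecoord (w k) (sigma k.+1)) + t^-1 * ecoord (w k) (tau k.+1)).
    by rewrite /F; ring.
  apply: le_trans h _.
  have L2 : t * delta / 2 <= L by rewrite /L; move: td9; lra.
  have td2 : 0 < t * delta / 2 by rewrite divr_gt0// mulr_gt0.
  have -> : 192 / delta ^+ 2 / t ^+ 2 = 48 / (t * delta / 2) ^+ 2.
    by field; rewrite ?gt_eqF.
  rewrite ler_pM2l// lef_pV2 ?posrE ?exprn_gt0//.
    by rewrite lerXn2r// nnegrE; [exact: ltW|move: L5; lra].
  by move: L5; lra.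
have FE : F (if sgn then 2 else 0) = - xi v sgn k.+1 by rewrite xiE opprK.
have sE : t * v 0 k - xi v sgn k.+1 / t = t * v 0 k + F (if sgn then 2 else 0) / t.
  by rewrite FE mulNr.
have s02 : 0 <= (if sgn then 2 else 0 : R) <= 2 by case: sgn {FE sE} => /=; lra.
have sig_sign : if odd k then 0 <= ecoord (w k) (sigma k.+1)
    else ecoord (w k) (sigma k.+1) <= 0.
  case: (ecoordP N (sigma k.+1)) => [q kq|_ ->]; last by case: ifP.
  rewrite kq ecoord_ord /w; case: ifPn => ok; rewrite ?invr_ge0 ?invr_le0.
    by rewrite subr_ge0 ltW// (v_lt v_incr)// (sigma_odd kq).
  by rewrite subr_le0 ltW// (v_lt v_incr)// (sigma_even kq).
rewrite sE /band_end /band.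
have -> : [set band_fun v t (k.+1%:Z - N%:Z - 1) a | a in `[0, 2]%classic] =
          [set eigval v t a k | a in `[0, 2]%classic].
  by apply: eq_imagel => a _; exact: band_funE.
have ex0 := expand _ s02.
have F_ext a : 0 <= a <= 2 -> if sgn (+) odd k.+1 then F a <= F (if sgn then 2 else 0)
    else F (if sgn then 2 else 0) <= F a.
  move=> a02; rewrite /F /=.
  have a4 : 0 <= a ^+ 2 <= 4 by rewrite sqr_ge0 /=; move: a02; nra.
  move: sig_sign a4; set W := ecoord _ (sigma _); move: (a ^+ 2) => b.
  case: (odd k); case: (sgn) => /= ws a4; rewrite lerD2r; nra.
case: ifPn => sg; [apply: (sup_near s02)|apply: (inf_near s02)].
- move=> a a02; have := F_ext _ a02; rewrite sg => Fa.
  have := expand _ a02; rewrite ler_distl => /andP[_ h]; apply: le_trans h _.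
  by rewrite lerD2r lerD2l ler_pM2r// invr_gt0.
- by move: ex0; rewrite ler_distl => /andP[].
- move=> a a02; have := F_ext _ a02; rewrite (negbTE sg) => Fa.
  have := expand _ a02; rewrite ler_distl => /andP[h _]; apply: le_trans h.
  by rewrite lerD2r lerD2l ler_pM2r// invr_gt0.
- by move: ex0; rewrite ler_distl => /andP[].
Qed.
End BandEnds.

(** * Asymptotics of the bands *)

Section BandAsymptotics.
Variables (R : realType) (N : nat).
Notation p := (N.*2.+1).
Variable v : 'rV[R]_p.
Hypothesis v_incr :
  forall k : nat, (1 <= k < p)%N -> vcoord v k < vcoord v k.+1.

Lemma bigO_invE (f : R -> R) m C T0 : 0 < C ->
  (forall t, T0 <= t -> `|f t| <= C / t ^+ m) -> 0 < T0 ->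
  f =O_ (pinfty_filter R) (fun t : R => t ^- m).
Proof.
move=> C0 fC T00; apply/eqO_exP; exists C => //.
near=> t; have tT : T0 <= t by near: t; apply: nbhs_pinfty_ge; rewrite num_real.
have t0 : 0 <= t by rewrite (le_trans _ tT)// ltW.
by rewrite (le_trans (fC _ tT))// ger0_norm// invr_ge0 exprn_ge0.
Unshelve. all: by end_near. Qed.

Lemma band_end_asymp (k : nat) (sgn : bool) : (1 <= k <= p)%N ->
  exists2 e : R -> R, e =O_ (pinfty_filter R) (fun t : R => t^-1) &
    \forall t \near +oo_R,
      band_end v (sgn (+) odd k) (k%:Z - N%:Z - 1) t =
        t * vcoord v k - (xi v sgn k + e t) / t.
Proof.
case: k => // k kp; have [C [T0 [C0 T00 E]]] := band_end_expansion v_incr.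
pose K : 'I_p := Ordinal kp.
exists (fun t => t * (t * vcoord v k.+1 -
    band_end v (sgn (+) odd k.+1) (k.+1%:Z - N%:Z - 1) t) - xi v sgn k.+1).
  rewrite (_ : (fun t : R => t^-1) = (fun t : R => t ^- 1)); last first.
    by apply/funext => t; rewrite expr1.
  apply: (bigO_invE C0 _ T00) => t tT.
  have t0 : 0 < t by apply: lt_le_trans tT.
  have := E t tT K sgn; rewrite (vcoord_ord v K).
  set B := band_end _ _ _ _ => h.
  have -> : t * (t * v 0 K - B) - xi v sgn k.+1 =
     - (t * (B - (t * v 0 K - xi v sgn k.+1 / t))).
    by field; rewrite gt_eqF.
  rewrite normrN normrM gtr0_norm//.
  have -> : C / t ^+ 1 = t * (C / t ^+ 2) by field; rewrite gt_eqF.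
  by rewrite ler_pM2l.
near=> t; have t0 : 0 < t by near: t; apply: nbhs_pinfty_gt; rewrite num_real.
by field; rewrite gt_eqF.
Unshelve. all: by end_near. Qed.

(** At order 1/t the two ends differ by the contribution of the [sigma]
    neighbour at a = 2; that of the [tau] neighbour is common to both. *)
Lemma band_length_asymp (k : nat) : (1 <= k < p)%N ->
  exists2 e : R -> R, e =O_ (pinfty_filter R) (fun t : R => t^-1) &
    \forall t \near +oo_R,
      band_length v (k%:Z - N%:Z - 1) t =
        (4 + e t) / (t * `|vcoord v (if odd k then k.+1 else k.-1) - vcoord v k|).
Proof.
case: k => // k kp; have [C [T0 [C0 T00 E]]] := band_end_expansion v_incr.
pose K : 'I_p := Ordinal (ltnW kp).
have [q kq] := @sigma_in N K kp.
rewrite (_ : (if odd k.+1 then k.+2 else k.+1.-1) = q.+1); last by rewrite -kq.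
rewrite (vcoord_ord v K) (vcoord_ord v q); set d := `|_|.
have qk : q != K by apply: contra_eq_neq kq => ->; exact: sigma_neq.
have d0 : 0 < d.
  rewrite normr_gt0 subr_eq0; apply: contra_neq qk => vqk; apply/val_inj => /=.
  by have [/(v_lt v_incr)|/(v_lt v_incr)|] := ltngtP q K; rewrite ?vqk ?ltxx.
exists (fun t => band_length v (k.+1%:Z - N%:Z - 1) t * (t * d) - 4); last first.
  near=> t; have t0 : 0 < t by near: t; apply: nbhs_pinfty_gt; rewrite num_real.
  by field; rewrite !gt_eqF.
rewrite (_ : (fun t : R => t^-1) = (fun t : R => t ^- 1)); last first.
  by apply/funext => t; rewrite expr1.
have C0' : 0 < 2 * C * d by rewrite !mulr_gt0.
apply: (bigO_invE C0' _ T00) => t tT.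
have t0 : 0 < t by apply: lt_le_trans tT.
have := E t tT K (~~ odd k.+1); have := E t tT K (odd k.+1).
rewrite addbb [(~~ _) (+) _]addNb addbb.
have : xi v (odd k.+1) k.+1 - xi v (~~ odd k.+1) k.+1 = 4 / d.
  rewrite -[k.+1]/(K.+1) !xiE //.
  rewrite kq ecoord_ord.
  have -> : d = if odd k then v 0 K - v 0 q else v 0 q - v 0 K.
    rewrite /d; case: ifPn => ok; last first.
      by rewrite gtr0_norm// subr_gt0 (v_lt v_incr)// (sigma_even kq).
    by rewrite distrC gtr0_norm// subr_gt0 (v_lt v_incr)// (sigma_odd kq).
  have : v 0 K - v 0 q != 0.
    by rewrite subr_eq0; apply: contraTneq d0 => e; rewrite /d e subrr normr0 ltxx.
  have : v 0 q - v 0 K != 0.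
    by rewrite subr_eq0; apply: contraTneq d0 => e; rewrite /d e subrr normr0 ltxx.
  by rewrite /=; case: (odd k) => /= h1 h2; field; rewrite ?h1 ?h2.
rewrite /band_length; set B1 := band_end _ _ _ _; set B2 := band_end _ _ _ _.
set X1 := xi v _ _; set X2 := xi v _ _ => XE h1 h2.
have -> : (B2 - B1) * (t * d) - 4 = (t * d) *
    ((B2 - (t * v 0 K - X2 / t)) - (B1 - (t * v 0 K - X1 / t))).
  have -> : t * d * (B2 - (t * v 0 K - X2 / t) - (B1 - (t * v 0 K - X1 / t))) =
    (B2 - B1) * (t * d) - d * (X1 - X2) by field; rewrite gt_eqF.
  by rewrite XE; congr (_ - _); field; rewrite gt_eqF.
rewrite normrM gtr0_norm ?mulr_gt0//.
have -> : 2 * C * d / t ^+ 1 = t * d * (C / t ^+ 2 + C / t ^+ 2).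
  by field; rewrite gt_eqF.
rewrite ler_pM2l ?mulr_gt0//.
by rewrite (le_trans (ler_normB _ _))// lerD.
Unshelve. all: by end_near. Qed.

(** The last site has no bond of weight [a]: both ends have the same
    expansion. *)
Lemma top_band_length_asymp :
  (band_length v N%:Z : R -> R) =O_ (pinfty_filter R) (fun t : R => t ^- 2).
Proof.
have [C [T0 [C0 T00 E]]] := band_end_expansion v_incr.
have C0' : 0 < 2 * C by rewrite mulr_gt0.
apply: (bigO_invE C0' _ T00) => t tT.
pose K : 'I_p := ord_max.
have := E t tT K true; have := E t tT K false.
have -> : K.+1%:Z - N%:Z - 1 = N%:Z by rewrite /=; lia.
have so : sigma K.+1 = p.+1 by rewrite /sigma /= odd_double.
have e0 (w : 'I_p -> R) : ecoord w p.+1 = 0.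
  by rewrite /ecoord insubF//= ltnn.
rewrite !xiE// so e0 !mulr0 !add0r.
rewrite /= odd_double /=.
rewrite /band_length; set B1 := band_end _ _ _ _; set B2 := band_end _ _ _ _.
set X := _ - _ / _ => h1 h2.
have -> : B1 - B2 = (B1 - X) - (B2 - X) by ring.
rewrite (le_trans (ler_normB _ _))// mulr_natl mulr2n mulrDl lerD//.
Qed.
End BandAsymptotics.

(** * The fibers of the Hamiltonian over the momentum *)

Lemma lipschitz_comp_continuous (R : realType) (f g : R -> R) C : 0 <= C ->
  (forall a a', 0 <= a <= 2 -> 0 <= a' <= 2 -> `|f a' - f a| <= C * `|a' - a|) ->
  (forall x, 0 <= g x <= 2) -> continuous g -> continuous (f \o g).
Proof.
move=> C0 fC g02 cg x; apply/cvgrPdist_lt => e e0.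
have e' : 0 < e / (C + 1) by rewrite divr_gt0// ltr_wpDl.
have /cvgrPdist_lt/(_ _ e') := cg x; apply: filterS => y /= gy.
apply: (@le_lt_trans _ _ (C * `|g x - g y|)); first exact: fC.
apply: (@le_lt_trans _ _ (C * (e / (C + 1)))); first by rewrite ler_wpM2l// ltW.
by rewrite mulrA ltr_pdivrMr ?ltr_wpDl// mulrC ltr_pM2l// ltrDl.
Qed.

Section Fibers.
Variables (R : realType) (N : nat).
Notation p := (N.*2.+1).
Variables (v : 'rV[R]_p) (t L : R).
Hypothesis reg : regime v t L.

(** The modulus of 1 + e^(i th): in the Fourier fiber at momentum th, the two
    edges from a vertex to its [sigma] neighbours add up to one bond of this
    weight, after its phase has been absorbed into the basis vectors. *)
Definition weight (th : R) : R := `|2 * cos (th / 2)|.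

Lemma weight02 th : 0 <= weight th <= 2.
Proof.
rewrite /weight normr_ge0 normrM ger0_norm//= ler_piMr// ler_norml.
by rewrite cos_geN1 cos_le1.
Qed.

Lemma weight_continuous : continuous weight.
Proof.
move=> x; apply: cvg_norm; apply: cvgM; first exact: cvg_cst.
apply: continuous_comp; last exact: continuous_cos.
by apply: cvgM; [exact: cvg_id|exact: cvg_cst].
Qed.

Lemma weightE th : 0 <= th <= pi -> weight th = 2 * cos (th / 2).
Proof.
move=> /andP[t0 tp]; rewrite /weight ger0_norm// mulr_ge0// cos_ge0_pihalf//.
by have := pi_gt0 R; lra.
Qed.

Lemma weight_decr th th' : 0 <= th -> th < th' -> th' <= pi -> weight th' < weight th.
Proof.
move=> t0 tt tp; have p0 := pi_gt0 R; rewrite !weightE//; try lra.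
by rewrite ltr_pM2l// ltr_cos ?in_itv/= ?ltr_pM2r//; lra.
Qed.

Lemma weight_onto a : 0 <= a <= 2 -> exists2 th, 0 <= th <= pi & weight th = a.
Proof.
move=> /andP[a0 a2]; have a1 : -1 <= a / 2 <= 1 by lra.
have h : 0 <= acos (a / 2) <= pi / 2.
  rewrite acos_ge0//=; rewrite leNgt; apply/negP => h.
  have : cos (acos (a / 2)) < cos (pi / 2).
    rewrite ltr_cos// in_itv/= ?acos_ge0 ?acos_lepi//.
    by have := pi_gt0 R; lra.
  rewrite acosK ?in_itv// cos_pihalf; lra.
exists (2 * acos (a / 2)); first by move: h; lra.
rewrite weightE; last by move: h; lra.
have -> : 2 * acos (a / 2) / 2 = acos (a / 2) by field.
by rewrite acosK ?in_itv//; field.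
Qed.

Definition energy (k : 'I_p) (th : R) : R := eigval v t (weight th) k.

Lemma energy_near k th : `|energy k th - t * v 0 k| <= 4.
Proof. by have [gap L5 _ _] := reg; case: (eigval_near gap L5 k (weight02 th)). Qed.

Lemma energy_sep k k' th th' : k != k' -> 1 <= `|energy k th - energy k' th'|.
Proof.
move=> kk'; have [gap L5 _ _] := reg.
have := far_gap gap kk' (energy_near k' th').
have := energy_near k th; rewrite -normrN opprB.
have := ler_distD (energy k th) (energy k' th') (t * v 0 k).
rewrite (distrC (t * v 0 k)) (distrC (energy k' th') (energy k th)); lra.
Qed.

Lemma eigvec_choice : exists u : 'I_p -> R -> 'I_p -> R,
  forall k a, 0 <= a <= 2 -> eigvec v t k a (eigval v t a k) (u k a).
Proof.
have [gap L5 _ _] := reg.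
have /choice[u uP] : forall ka : 'I_p * R, exists u, 0 <= ka.2 <= 2 ->
    eigvec v t ka.1 ka.2 (eigval v t ka.2 ka.1) u.
  move=> [k a] /=; have [a02|a02] := boolP (0 <= a <= 2); last by exists (fun=> 0).
  have [h1 h2] := eigval_near gap L5 k a02.
  by have [u] := eigvec_exists gap L5 a02 h1 h2; exists u.
by exists (fun k a => u (k, a)) => k a; exact: (uP (k, a)).
Qed.

Lemma energy_continuous k : continuous (energy k).
Proof.
have [gap L5 Lp _] := reg; have [u uP] := eigvec_choice.
apply: (@lipschitz_comp_continuous _ (fun a => eigval v t a k) weight (2 * p%:R)).
- by rewrite mulr_ge0.
- move=> a a' a02 a'02.
  exact: (eigval_lipschitz gap L5 Lp a02 a'02 (uP k _ a02) (uP k _ a'02)).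
- exact: weight02.
- exact: weight_continuous.
Qed.

Lemma energy_strict (k : 'I_p) th th' : (k.+1 < p)%N -> 0 <= th -> th < th' ->
  th' <= pi -> 0 < (-1) ^+ (~~ odd k) * (energy k th - energy k th').
Proof.
move=> kp t0 tt tp; have [gap L5 Lp [U vU LU]] := reg; have [u uP] := eigvec_choice.
have w02 := weight02 th; have w02' := weight02 th'.
apply: (eigval_strict_mono gap L5 Lp w02' w02 (uP k _ w02') (uP k _ w02) vU LU kp).
exact: weight_decr.
Qed.

(** With entry 1 at the site of the band, the eigenvector is a Lipschitz
    function of the weight, hence continuous in the momentum. Dividing it by its
    norm preserves this, and distinct energies give orthogonality. *)
Lemma fiber_basis : exists psi : 'I_p -> 'I_p -> R -> R,
  [/\ forall k i, continuous (psi k i),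
      forall k th, eigeneq v t (weight th) (energy k th) (fun i => psi k i th) &
      forall k k' th, \sum_i psi k i th * psi k' i th = (k == k')%:R].
Proof.
have [gap L5 Lp _] := reg; have [u uP] := eigvec_choice.
pose w k i th := u k (weight th) i.
have cw k i : continuous (w k i).
  apply: (@lipschitz_comp_continuous _ (fun a => u k a i) weight (2 * p%:R + 1)).
  - by rewrite addr_ge0// mulr_ge0.
  - move=> a a' a02 a'02.
    exact: (eigvec_lipschitz gap L5 Lp a02 a'02 (uP k _ a02) (uP k _ a'02)).
  - exact: weight02.
  - exact: weight_continuous.
pose n2 k th := \sum_i w k i th ^+ 2.
have n2_gt0 k th : 0 < n2 k th.
  have [_ _ wk _] := uP k _ (weight02 th).
  by rewrite /n2 (bigD1 k)//= /w wk expr1n ltr_pwDl// sumr_ge0// => i _; rewrite sqr_ge0.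
have cn2 k : continuous (n2 k).
  move=> x; rewrite /n2; elim: (index_enum _) => [|i s IH].
    by under eq_fun do rewrite big_nil; exact: cst_continuous.
  under eq_fun do rewrite big_cons; apply: cvgD => //.
  by apply: (cvg_comp (w k i) (fun y => y ^+ 2)); [exact: cw|exact: exprn_continuous].
have sn2 k th : Num.sqrt (n2 k th) * Num.sqrt (n2 k th) = n2 k th.
  by rewrite -expr2 sqr_sqrtr// ltW.
have sn0 k th : Num.sqrt (n2 k th) != 0 by rewrite gt_eqF// sqrtr_gt0.
exists (fun k i th => (Num.sqrt (n2 k th))^-1 * w k i th); split.
- move=> k i x; apply: cvgM; last exact: cw.
  apply: cvgV => //; apply: (cvg_comp (n2 k) Num.sqrt); first exact: cn2.
  exact: sqrt_continuous.
- move=> k th i; have [_ e _ _] := uP k _ (weight02 th).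
  have {}e : energy k th * w k i th = t * v 0 i * w k i th +
      weight th * ecoord (fun j => w k j th) (sigma i.+1) +
      ecoord (fun j => w k j th) (tau i.+1) by exact: e.
  by rewrite !ecoordZ mulrCA e; ring.
- move=> k k' th.
  transitivity ((Num.sqrt (n2 k th))^-1 * (Num.sqrt (n2 k' th))^-1 * \sum_i w k i th * w k' i th).
    by rewrite mulr_sumr; apply: eq_bigr => i _; ring.
  have [->|kk'] := eqVneq k k'.
    under eq_bigr do rewrite -expr2.
    by rewrite -/(n2 k' th) -invfM sn2 mulVf// gt_eqF.
  have [_ e _ _] := uP k _ (weight02 th); have [_ e' _ _] := uP k' _ (weight02 th).
  rewrite (eigeneq_orth e e') ?mulr0//.
  have := energy_sep th th kk'; apply: contraTneq; rewrite -/(energy k th) -/(energy k' th) => ->.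
  by rewrite subrr normr0 ler10.
Qed.
End Fibers.

(** * Square integrable functions *)

Section SquareIntegrable.
Context d (T : measurableType d) (R : realType) (P : probability T R).
Local Open Scope ereal_scope.
Implicit Types f g h : T -> R.

Definition sqint f :=
  measurable_fun [set: T] f /\ \int[P]_x ((f x) ^+ 2)%:E < +oo.

Lemma measurable_sqr f : measurable_fun [set: T] f ->
  measurable_fun [set: T] (fun x => ((f x) ^+ 2)%:E).
Proof. by move=> mf; apply/measurable_EFinP; exact: measurable_funX. Qed.

Lemma sqint_integrable_sqr f : sqint f ->
  P.-integrable setT (EFin \o (fun x => f x ^+ 2)%R).
Proof.
move=> [mf fi]; apply/integrableP; split; first exact: measurable_sqr.
by under eq_integral do rewrite /= ger0_norm ?sqr_ge0//.
Qed.

Lemma sqint_le f g c : measurable_fun [set: T] f -> sqint g ->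
  (forall x, f x ^+ 2 <= c * g x ^+ 2)%R -> sqint f.
Proof.
move=> mf [mg gi] fg; split => //.
apply: (@le_lt_trans _ _ (\int[P]_x (`|c|%:E * (g x ^+ 2)%:E))).
  apply: ge0_le_integral => //.
  - by move=> x _; rewrite lee_fin sqr_ge0.
  - exact: measurable_sqr.
  - by apply: measurable_funeM; exact: measurable_sqr.
  - move=> x _; rewrite -EFinM lee_fin (le_trans (fg x))// ler_wpM2r ?sqr_ge0//.
    exact: ler_norm.
rewrite ge0_integralZl//; first by rewrite lte_mul_pinfty.
- exact: measurable_sqr.
- by move=> x _; rewrite lee_fin sqr_ge0.
Qed.

Lemma sqint_integrableD f g : sqint f -> sqint g ->
  P.-integrable setT (EFin \o (fun x => f x ^+ 2 + g x ^+ 2)%R).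
Proof.
move=> sf sg.
exact: (integrableD measurableT (sqint_integrable_sqr sf) (sqint_integrable_sqr sg)).
Qed.

Lemma sqintM f g : sqint f -> sqint g ->
  P.-integrable setT (EFin \o (fun x => f x * g x)%R).
Proof.
move=> sf sg; have [mf _] := sf; have [mg _] := sg.
apply: le_integrable (sqint_integrableD sf sg) => //.
- by apply/measurable_EFinP; exact: measurable_funM.
- move=> x _ /=; rewrite lee_fin [leRHS]ger0_norm ?addr_ge0 ?sqr_ge0//.
  by rewrite ler_norml; apply/andP; split; nra.
Qed.

Lemma sqintD f g : sqint f -> sqint g -> sqint (fun x => f x + g x)%R.
Proof.
move=> sf sg; have [mf _] := sf; have [mg _] := sg.
have mfg := measurable_funD mf mg.
split => //; have := integrableZl measurableT 2 (sqint_integrableD sf sg).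
move=> /integrableP[_]; apply: le_lt_trans; apply: ge0_le_integral => //.
- by move=> x _; rewrite lee_fin sqr_ge0.
- exact: measurable_sqr.
- apply: measurableT_comp => //; apply: measurable_funeM; apply/measurable_EFinP.
  by apply: measurable_funD; exact: measurable_funX.
- move=> x _ /=; rewrite lee_fin.
  have := sqr_ge0 (f x - g x); have := sqr_ge0 (f x); have := sqr_ge0 (g x).
  by rewrite ger0_norm; nra.
Qed.

Lemma sqintZ c f : sqint f -> sqint (fun x => c * f x)%R.
Proof.
move=> sf; have [mf _] := sf; apply: (@sqint_le _ f (c ^+ 2)%R) => //.
  exact: measurable_funM.
by move=> x; rewrite exprMn.
Qed.

Lemma sqint_cst c : sqint (cst c).
Proof.
split => //; under eq_integral do rewrite /=.
by rewrite integral_cst//= [X in _ * X]probability_setT mule1 ltry.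
Qed.

Lemma sqint_bounded (b f : T -> R) (C : R) : measurable_fun [set: T] b -> sqint f ->
  (forall x, `|b x| <= C)%R -> sqint (fun x => b x * f x)%R.
Proof.
move=> mb sf bC; have [mf _] := sf; apply: (@sqint_le _ f (C ^+ 2)%R) => //.
  exact: measurable_funM.
move=> x; rewrite exprMn ler_wpM2r ?sqr_ge0// -real_normK ?num_real//.
by rewrite lerXn2r// nnegrE// (le_trans _ (bC x)).
Qed.

Lemma sqint_sum (I : Type) (r : seq I) (F : I -> T -> R) :
  (forall i, sqint (F i)) -> sqint (fun x => \sum_(i <- r) F i x)%R.
Proof.
move=> sF; elim: r => [|i r IH].
  by under eq_fun do rewrite big_nil; exact: sqint_cst.
by under eq_fun do rewrite big_cons; exact: sqintD.
Qed.

(** The completeness of L^2: a subsequence with summable increments converges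
    almost everywhere, and by Fatou's lemma its limit is as close to [u m] as
    the later terms of the sequence are. *)
Lemma sqint_complete (u : nat -> T -> R) (eps : nat -> R) :
  (forall n, sqint (u n)) ->
  (forall m n, (m <= n)%N -> \int[P]_x ((u n x - u m x) ^+ 2)%:E <= (eps m)%:E) ->
  eps n @[n --> \oo] --> (0 : R)%R ->
  exists2 w, sqint w & forall m, \int[P]_x ((w x - u m x) ^+ 2)%:E <= (eps m)%:E.
Proof.
move=> su uC eps0.
have mu n : measurable_fun [set: T] (u n) by case: (su n).
have /choice[M MP] : forall k, exists M, forall n, (M <= n)%N -> (eps n <= 4 ^- k)%R.
  move=> k; have k0 : (0 < 4 ^- k :> R)%R by rewrite invr_gt0 exprn_gt0.
  have /cvgrPdist_le/(_ _ k0)[m _ mP] := eps0.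
  by exists m => n /mP /=; rewrite sub0r normrN; exact/le_trans/ler_norm.
(* a nondecreasing choice of indices along which the squared distances are at
   most 4^-k; the summand (M j).+1 also makes phi k at least k *)
pose phi k := (\sum_(j < k.+1) (M j).+1)%N.
have phi_inc k : (phi k <= phi k.+1)%N by rewrite /phi [leqRHS]big_ord_recr leq_addr.
have phi_M k : (M k <= phi k)%N.
  by rewrite /phi big_ord_recr/= addnC ltnW// ltn_addr.
have phi_k k : (k <= phi k)%N.
  elim: k => // k IH; rewrite /phi big_ord_recr/= -/(phi k) addnS ltnS.
  exact: leq_trans (leq_addr _ _).
pose w_ k := u (phi k); pose dd k x := (w_ k.+1 x - w_ k x)%R.
have md k : measurable_fun [set: T] (dd k) by apply: measurable_funB; exact: mu.
have mabsd k : measurable_fun [set: T] (fun x => `|dd k x|%:E).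
  by apply/measurable_EFinP; exact: measurableT_comp.
(* |c| <= b / 2 + a c^2 / 2 for b = 2^-k and a = 2^k, by a b = 1 *)
have d1 k : \int[P]_x `|dd k x|%:E <= (2 ^- k)%:E.
  apply: (@le_trans _ _ (\int[P]_x ((2 ^- k / 2)%:E + (2 ^+ k / 2)%:E * (dd k x ^+ 2)%:E))).
    apply: ge0_le_integral => //.
    - by apply: emeasurable_funD => //; apply: measurable_funeM; exact: measurable_sqr.
    - move=> x _; rewrite -EFinM -EFinD lee_fin -[in leRHS](real_normK (num_real _)).
      have h0 : (0 < 2 ^+ k :> R)%R by rewrite exprn_gt0.
      have h1 : (2 ^+ k * 2 ^- k = 1 :> R)%R by rewrite divff// gt_eqF.
      move: h0 h1; set a := (2 ^+ k)%R; set b := (2 ^- k)%R; set c := `|_|%R => a0 ab.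
      have -> : (b / 2 + a / 2 * c ^+ 2 = c + a / 2 * (c - b) ^+ 2)%R.
        have -> : (a / 2 * (c - b) ^+ 2 =
            a / 2 * c ^+ 2 - (a * b) * c + (a * b) * b / 2)%R by field.
        by rewrite ab; field.
      by rewrite lerDl mulr_ge0 ?sqr_ge0// divr_ge0// ltW.
  rewrite ge0_integralD//; last 2 first.
  - by move=> x _; rewrite -EFinM lee_fin mulr_ge0 ?sqr_ge0// divr_ge0// exprn_ge0.
  - by apply: measurable_funeM; exact: measurable_sqr.
  rewrite integral_cst//= [X in _ * X]probability_setT mule1.
  rewrite ge0_integralZl//; last 2 first.
  - exact: measurable_sqr.
  - by move=> x _; rewrite lee_fin sqr_ge0.
  have := uC _ _ (phi_inc k); have := MP k _ (phi_M k).
  rewrite -lee_fin => h1 h2; have := le_trans h2 h1; rewrite -/(w_ k) -/(w_ k.+1) => h3.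
  apply: (@le_trans _ _ ((2 ^- k / 2)%:E + (2 ^+ k / 2)%:E * (4 ^- k)%:E)).
    by rewrite leeD2l// lee_wpmul2l// lee_fin divr_ge0// exprn_ge0.
  rewrite -EFinM -EFinD lee_fin.
  have -> : (4 ^- k = 2 ^- k * 2 ^- k :> R)%R.
    by rewrite -invfM -exprMn; congr ((_ ^+ _)^-1)%R; ring.
  have h0 : (2 ^+ k * 2 ^- k = 1 :> R)%R by rewrite divff// gt_eqF// exprn_gt0.
  move: h0; set a := (2 ^+ k)%R; set b := (2 ^- k)%R => ab.
  by rewrite mulrAC mulrA ab; lra.
(* the increments are summable in L^1, so w_ converges almost everywhere *)
have Sfin : \int[P]_x (\sum_(k <oo) `|dd k x|%:E) < +oo.
  rewrite integral_nneseries//.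
  apply: (@le_lt_trans _ _ 2%:E); last exact: ltry.
  apply: lime_le.
    by apply: is_cvg_nneseries => k _ _; apply: integral_ge0 => x _; rewrite lee_fin.
  apply: nearW => n; apply: (@le_trans _ _ (\sum_(0 <= k < n) (2 ^- k)%:E)).
    by apply: lee_sum => k _; exact: d1.
  rewrite sumEFin lee_fin.
  suff -> : (\sum_(0 <= k < n) 2 ^- k = 2 - 2 * 2 ^- n :> R)%R.
    by rewrite gerBl mulr_ge0// invr_ge0 exprn_ge0.
  elim: n => [|n IH]; first by rewrite big_nil expr0 invr1; ring.
  by rewrite big_nat_recr//= IH exprS invfM; field; rewrite expf_neq0.
have mS : measurable_fun [set: T] (fun x => \sum_(k <oo) `|dd k x|%:E).
  exact: ge0_emeasurable_sum.
have Sint : P.-integrable setT (fun x => \sum_(k <oo) `|dd k x|%:E).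
  apply/integrableP; split => //.
  under eq_integral do rewrite gee0_abs ?nneseries_ge0//.
  exact: Sfin.
pose w x := fine (limn_esup (fun k => (w_ k x)%:E)).
have mw : measurable_fun [set: T] w.
  apply: measurableT_comp => //; apply: measurable_fun_limn_esup => k.
  by apply/measurable_EFinP; exact: mu.
have w_cvg : {ae P, forall x, w_ k x @[k --> \oo] --> w x}.
  have [N [mN N0 subN]] := integrable_ae measurableT Sint.
  exists N; split => // x /= wx; apply: subN => /= Sx; apply: wx.
  have {}Sx := Sx I.
  have cw : cvgn (fun k => w_ k x).
    have cs : cvgn (series (fun k => dd k x)).
      apply: normed_cvg; apply: nondecreasing_is_cvgn.
        apply/nondecreasing_seqP => n /=.
        by rewrite -[leRHS]/(series (fun k => `|dd k x|%R) n.+1) seriesSr lerDl.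
      exists (fine (\sum_(k <oo) `|dd k x|%:E)) => _ [n _ <-].
      rewrite /= -lee_fin fineK//= /series/= -sumEFin.
      exact: nneseries_lim_ge.
    rewrite (_ : (fun k => w_ k x) = (fun k => w_ 0%N x + series (fun k => dd k x) k))%R.
      by apply: is_cvgD => //; exact: is_cvg_cst.
    apply/funext => k; rewrite (eq_sum_telescope (fun k => w_ k x) k); congr (_ + _)%R.
  have cwE : (w_ k x)%:E @[k --> \oo] --> (limn (fun k => w_ k x))%:E.
    by apply: cvg_EFin; [exact: nearW|exact: cw].
  have -> : w x = limn (fun k => w_ k x).
    rewrite /w is_cvg_limn_esupE; first by move/cvg_lim : cwE => ->.
    by apply/cvg_ex; exists (limn (fun k => w_ k x))%:E.
  exact: cw.
(* Fatou's lemma along the subsequence *)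
have key m : \int[P]_x ((w x - u m x) ^+ 2)%:E <= (eps m)%:E.
  pose g k x := ((w_ k x - u m x) ^+ 2)%:E.
  have mg k : measurable_fun setT (g k).
    by apply: measurable_sqr; apply: measurable_funB; exact: mu.
  have mlim : measurable_fun setT (fun x => limn_einf (g ^~ x)).
    rewrite (_ : (fun x => _) = (fun x => - limn_esup (fun k => - g k x))).
      apply: measurableT_comp => //; apply: measurable_fun_limn_esup => k.
      exact: measurableT_comp.
    by apply/funext => x; rewrite -[LHS]oppeK -limn_esupN.
  apply: (@le_trans _ _ (\int[P]_x limn_einf (g ^~ x))).
    apply: ae_ge0_le_integral => //.
    - by move=> x _; rewrite lee_fin sqr_ge0.
    - by apply: measurable_sqr; apply: measurable_funB => //; exact: mu.
    - move=> x _; rewrite limn_einf_lim; apply: lime_ge; first exact: is_cvg_einfs.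
      apply: nearW => n; apply: le_ereal_inf_tmp => _ [k _ <-].
      by rewrite lee_fin sqr_ge0.
    - case: w_cvg => N [mN N0 subN]; exists N; split => // x /= nx; apply: subN => /= wx.
      apply: nx => _.
      have gx : g k x @[k --> \oo] --> ((w x - u m x) ^+ 2)%:E.
        apply: cvg_EFin; first exact: nearW.
        rewrite /comp/= /g /=.
        under eq_fun do rewrite expr2.
        rewrite expr2; apply: cvgM; apply: cvgB => //; exact: cvg_cst.
      rewrite is_cvg_limn_einfE; last by apply/cvg_ex; eexists; exact: gx.
      by move/cvg_lim : gx => ->.
  apply: le_trans (fatou _ _ _ _) _ => //.
    by move=> n x _; rewrite lee_fin sqr_ge0.
  rewrite limn_einf_lim; apply: lime_le; first exact: is_cvg_einfs.
  apply: nearW => n; apply: ereal_inf_le.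
  exists (\int[P]_x g (maxn n m) x).
    by exists (maxn n m) => //=; rewrite leq_maxl.
  apply: uC; exact: leq_trans (leq_maxr _ _) (phi_k _).
exists w => //.
have sw : sqint (fun x => w x - u 0%N x)%R.
  split; first by apply: measurable_funB => //; exact: mu.
  by apply: le_lt_trans (key 0%N) _; rewrite ltry.
rewrite (_ : w = (fun x => (w x - u 0%N x) + u 0%N x)%R); first exact: sqintD.
by apply/funext => x; rewrite subrK.
Qed.
End SquareIntegrable.

(** * Orthonormal sequences of vector valued functions *)

Section VectorL2.
Context d (T : measurableType d) (R : realType) (P : probability T R).
Variable I : finType.
Implicit Types F G H : I -> T -> R.

Definition vsqint F := forall i, sqint P (F i).

Definition ip F G : R := \int[P]_x (\sum_i F i x * G i x).

Definition vlin (c : R) F G : I -> T -> R := fun i x => c * F i x + G i x.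

Lemma vsqint_lin c F G : vsqint F -> vsqint G -> vsqint (vlin c F G).
Proof. by move=> sF sG i; apply: sqintD => //; exact: sqintZ. Qed.

Lemma vsqint0 : vsqint (fun _ _ => 0).
Proof. by move=> i; exact: sqint_cst. Qed.

Lemma ip_integrable F G : vsqint F -> vsqint G ->
  P.-integrable setT (EFin \o (fun x => \sum_i F i x * G i x)).
Proof.
move=> sF sG.
rewrite (_ : EFin \o _ = (fun x => \sum_(i <- enum I) (F i x * G i x)%:E)%E).
  by apply: integrable_sum => // i _; exact: sqintM.
by apply/funext => x /=; rewrite sumEFin big_enum.
Qed.

Lemma ipC F G : ip F G = ip G F.
Proof. by apply: eq_Rintegral => x _; apply: eq_bigr => i _; rewrite mulrC. Qed.

Lemma ip_linl c F F' G : vsqint F -> vsqint F' -> vsqint G ->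
  ip (vlin c F F') G = c * ip F G + ip F' G.
Proof.
move=> sF sF' sG; have iF := ip_integrable sF sG; have iF' := ip_integrable sF' sG.
rewrite /ip -RintegralZl// -RintegralD//; last exact: (integrableZl measurableT c iF).
apply: eq_Rintegral => x _; rewrite mulr_sumr -big_split; apply: eq_bigr => i _ /=.
by rewrite mulrDl mulrA.
Qed.

Lemma ip_linr c F F' G : vsqint F -> vsqint F' -> vsqint G ->
  ip G (vlin c F F') = c * ip G F + ip G F'.
Proof. by move=> *; rewrite ipC ip_linl// ipC (ipC F'). Qed.

Lemma ip0l G : ip (fun _ _ => 0) G = 0.
Proof.
rewrite /ip (_ : (fun x => _) = cst 0) ?Rintegral_cst ?mul0r//.
by apply/funext => x; rewrite big1// => i _; rewrite mul0r.
Qed.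

Lemma ip_ge0 F : 0 <= ip F F.
Proof.
by apply: Rintegral_ge0 => x _; apply: sumr_ge0 => i _; rewrite -expr2 sqr_ge0.
Qed.

Lemma ip_normE F : vsqint F ->
  ((ip F F)%:E = \sum_i \int[P]_x ((F i x) ^+ 2)%:E)%E.
Proof.
move=> sF; have iF := ip_integrable sF sF.
rewrite /ip /Rintegral fineK; last exact: integrable_fin_num.
transitivity (\int[P]_x (\sum_(i <- enum I) (F i x ^+ 2)%:E))%E.
  apply: eq_integral => x _; rewrite sumEFin big_enum/=; congr _%:E.
rewrite ge0_integral_sum//.
- by rewrite big_enum.
- by move=> i; apply: measurable_sqr; case: (sF i).
- by move=> i x _; rewrite lee_fin sqr_ge0.
Qed.

Lemma ip_comp_le F i : vsqint F -> (\int[P]_x ((F i x) ^+ 2)%:E <= (ip F F)%:E)%E.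
Proof.
move=> sF; rewrite ip_normE// (bigD1 i)//= leeDl// sume_ge0// => j _.
by apply: integral_ge0 => x _; rewrite lee_fin sqr_ge0.
Qed.

(** The squared norm of [c F + G] is a nonnegative quadratic polynomial in
    [c]. *)
Lemma ip_CauchySchwarz F G : vsqint F -> vsqint G ->
  (ip F G) ^+ 2 <= ip F F * ip G G.
Proof.
move=> sF sG.
have q c : 0 <= c ^+ 2 * ip F F + 2 * c * ip F G + ip G G.
  have := ip_ge0 (vlin c F G).
  rewrite ip_linl ?ip_linr//; try exact: vsqint_lin.
  by rewrite (ipC G F) expr2; lra.
have F0 := ip_ge0 F; have [F00|Fn0] := eqVneq (ip F F) 0.
  rewrite F00 mul0r; have [->|fg0] := eqVneq (ip F G) 0; first by rewrite expr0n.
  (* at this point the polynomial, affine in c, takes the value -1 *)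
  have := q (- (ip G G + 1) / (2 * ip F G)).
  rewrite F00 mulr0 add0r.
  have -> : 2 * (- (ip G G + 1) / (2 * ip F G)) * ip F G = - (ip G G + 1) by field.
  lra.
have {}F0 : 0 < ip F F by rewrite lt_neqAle eq_sym Fn0.
have := q (- ip F G / ip F F).
have -> : (- ip F G / ip F F) ^+ 2 * ip F F + 2 * (- ip F G / ip F F) * ip F G + ip G G
  = ip G G - (ip F G) ^+ 2 / ip F F by field.
by rewrite subr_ge0 ler_pdivrMr// mulrC.
Qed.

Section OrthonormalSequence.
Variable e : nat -> I -> T -> R.
Hypothesis se : forall n, vsqint (e n).
Hypothesis e_orth : forall m n, ip (e m) (e n) = (m == n)%:R.

Fixpoint psum (f : nat -> R) n : I -> T -> R :=
  if n is m.+1 then vlin (f m) (e m) (psum f m) else fun _ _ => 0.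

Lemma vsqint_psum f n : vsqint (psum f n).
Proof. by elim: n => [|n IH] /=; [exact: vsqint0|exact: vsqint_lin]. Qed.

Lemma ip_psum f n G : vsqint G ->
  ip (psum f n) G = \sum_(k < n) f k * ip (e k) G.
Proof.
move=> sG; elim: n => [|n IH] /=; first by rewrite big_ord0 ip0l.
by rewrite ip_linl//; [rewrite IH big_ord_recr/= addrC|exact: vsqint_psum].
Qed.

Lemma ip_e_psum f n k : ip (e k) (psum f n) = if (k < n)%N then f k else 0.
Proof.
rewrite ipC ip_psum//; case: ifPn => kn.
  rewrite (bigD1 (Ordinal kn))//= e_orth eqxx mulr1 big1 ?addr0// => j jk.
  by rewrite e_orth (negbTE (jk : (j : nat) != k)) mulr0.
rewrite big1// => j _; rewrite e_orth; case: eqP => [jk|]; last by rewrite mulr0.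
by rewrite -jk ltn_ord in kn.
Qed.

Lemma ip_psum_psum f m n : (m <= n)%N ->
  ip (psum f m) (psum f n) = \sum_(k < m) f k ^+ 2.
Proof.
move=> mn; rewrite ip_psum; last exact: vsqint_psum.
by apply: eq_bigr => k _; rewrite ip_e_psum (leq_trans _ mn)// expr2.
Qed.

Let sub F G := vlin (-1) G F.

Lemma ip_subr F G H : vsqint F -> vsqint G -> vsqint H ->
  ip H (sub F G) = ip H F - ip H G.
Proof. by move=> *; rewrite ip_linr// mulN1r addrC. Qed.

Lemma ip_sub_norm F G : vsqint F -> vsqint G ->
  ip (sub F G) (sub F G) = ip F F - 2 * ip F G + ip G G.
Proof.
move=> sF sG; rewrite ip_subr//; last exact: vsqint_lin.
rewrite ipC ip_subr// (ipC (sub F G) G) ip_subr// (ipC G F); ring.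
Qed.

(** The partial sums are Cauchy in each component, with the tail of the series
    as modulus. *)
Lemma Riesz_Fischer (f : nat -> R) : cvgn (series (fun n => f n ^+ 2)) ->
  exists2 G, vsqint G &
    [/\ forall n, ip (e n) G = f n &
        (fun n => ip (sub G (psum f n)) (sub G (psum f n))) @ \oo --> (0 : R)].
Proof.
move=> cf; set l := limn (series (fun n => f n ^+ 2)).
pose eps n := l - series (fun n => f n ^+ 2) n.
have eps0 : eps n @[n --> \oo] --> (0 : R).
  rewrite -(subrr l); apply: cvgB; first exact: cvg_cst.
  exact: cf.
have nd : nondecreasing_seq (series (fun n => f n ^+ 2)).
  by apply/nondecreasing_seqP => n; rewrite seriesSr lerDl sqr_ge0.
have psum_diff i m n : (m <= n)%N ->
    (\int[P]_x ((psum f n i x - psum f m i x) ^+ 2)%:E <= (eps m)%:E)%E.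
  move=> mn; pose D := sub (psum f n) (psum f m).
  have sD : vsqint D by apply: vsqint_lin; exact: vsqint_psum.
  have := ip_comp_le i sD; rewrite {1}/D /sub /vlin.
  under eq_integral do rewrite mulN1r addrC.
  move/le_trans; apply; rewrite lee_fin ip_sub_norm; try exact: vsqint_psum.
  rewrite (ipC (psum f n) (psum f m)) !ip_psum_psum//.
  have sE k : \sum_(j < k) f j ^+ 2 = series (fun n => f n ^+ 2) k.
    by rewrite seriesEord.
  rewrite !sE.
  move: (nondecreasing_cvgn_le nd cf n); rewrite -/l /eps; lra.
have /fin_all_exists2[G sG GP] : forall i, exists2 w, sqint P w &
    forall m, (\int[P]_x ((w x - psum f m i x) ^+ 2)%:E <= (eps m)%:E)%E.
  move=> i; apply: (@sqint_complete _ _ _ _ (fun n => psum f n i)) => //.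
  - by move=> n; exact: vsqint_psum.
  - by move=> m n; exact: psum_diff.
have snorm n : ip (sub G (psum f n)) (sub G (psum f n)) <= #|I|%:R * eps n.
  rewrite -lee_fin ip_normE; last by apply: vsqint_lin => //; exact: vsqint_psum.
  apply: (@le_trans _ _ (\sum_(i : I) (eps n)%:E)%E).
    apply: lee_sum => i _; apply: le_trans (GP i n).
    rewrite /sub /vlin; under eq_integral do rewrite mulN1r addrC.
    exact: lexx.
  by rewrite sumEFin sumr_const mulr_natl.
have cvg0 : (fun n => ip (sub G (psum f n)) (sub G (psum f n))) @ \oo --> (0 : R).
  apply: (@squeeze_cvgr _ _ _ _ (cst 0) (fun n => #|I|%:R * eps n)).
  - by apply: nearW => n; rewrite ip_ge0 snorm.
  - exact: cvg_cst.
  - by rewrite -[X in _ --> X](mulr0 #|I|%:R); apply: cvgM => //; exact: cvg_cst.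
exists G => //; split => // k.
have sq0 : (ip (e k) G - f k) ^+ 2 <= 0.
  apply: (cvgr_to_ge cvg0); near=> n.
  have kn : (k < n)%N by near: n; exact: nbhs_infty_gt.
  have sS : vsqint (sub G (psum f n)) by apply: vsqint_lin => //; exact: vsqint_psum.
  have := ip_CauchySchwarz (se k) sS; rewrite e_orth eqxx mul1r.
  by rewrite ip_subr//; [rewrite ip_e_psum kn|exact: vsqint_psum].
by apply/eqP; rewrite -subr_eq0 -sqrf_eq0 eq_le sq0 sqr_ge0.
Unshelve. all: by end_near. Qed.

Lemma Bessel G n : vsqint G -> \sum_(k < n) ip (e k) G ^+ 2 <= ip G G.
Proof.
move=> sG; pose f k := ip (e k) G.
have := ip_ge0 (sub G (psum f n)); rewrite ip_sub_norm//; last exact: vsqint_psum.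
rewrite ip_psum_psum// (ipC G) ip_psum//.
under [X in 2 * X]eq_bigr do rewrite -/(f _) -expr2.
rewrite /f; lra.
Qed.

(** The coefficients of [G] are square summable by Bessel, so they are also the
    coefficients of a sum [w] of the series; by totality [G - w] has norm 0. *)
Lemma Parseval G : vsqint G ->
  (forall H, vsqint H -> (forall n, ip (e n) H = 0) -> ip H H = 0) ->
  series (fun n => ip (e n) G ^+ 2) @ \oo --> ip G G.
Proof.
move=> sG total; pose f k := ip (e k) G.
have sE n : series (fun n => f n ^+ 2) n = \sum_(k < n) f k ^+ 2 by rewrite seriesEord.
have cf : cvgn (series (fun n => f n ^+ 2)).
  apply: nondecreasing_is_cvgn.
    by apply/nondecreasing_seqP => n; rewrite seriesSr lerDl sqr_ge0.
  by exists (ip G G) => _ [n _ <-]; rewrite sE; exact: Bessel.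
have [w sw [ew cw]] := Riesz_Fischer cf.
have sS n : vsqint (sub w (psum f n)) by apply: vsqint_lin => //; exact: vsqint_psum.
have sGw : vsqint (sub G w) by exact: vsqint_lin.
have Gw0 : ip (sub G w) (sub G w) = 0.
  by apply: total => // n; rewrite ip_subr// ew subrr.
have orth0 H : vsqint H -> ip (sub G w) H = 0.
  move=> sH; apply/eqP; rewrite -sqrf_eq0 eq_le sqr_ge0 andbT.
  by have := ip_CauchySchwarz sGw sH; rewrite Gw0 mul0r.
have GGE n : ip (sub w (psum f n)) (sub w (psum f n)) = ip G G - series (fun n => f n ^+ 2) n.
  have GE H : vsqint H -> ip w H = ip G H.
    by move=> sH; have := orth0 _ sH; rewrite ipC ip_subr// (ipC H) (ipC H); lra.
  rewrite ip_sub_norm//; last exact: vsqint_psum.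
  rewrite (GE w)// (ipC G w) (GE G)// (GE (psum f n)); last exact: vsqint_psum.
  rewrite ip_psum_psum// (ipC G) ip_psum// sE.
  under [X in 2 * X]eq_bigr do rewrite -/(f _) -expr2.
  ring.
have -> : series (fun n => ip (e n) G ^+ 2) =
    (fun n => ip G G - ip (sub w (psum f n)) (sub w (psum f n))).
  by apply/funext => n; rewrite GGE; ring.
rewrite -[X in _ --> X]subr0; apply: cvgB => //; exact: cvg_cst.
Qed.

End OrthonormalSequence.
End VectorL2.

(** * Polynomial approximation of step functions *)

Section StepPolynomials.
Variable R : realType.
Implicit Types y z : R.

Lemma Bernoulli_ineq z m : 0 <= z <= 1 -> 1 - m%:R * z <= (1 - z) ^+ m.
Proof.
move=> /andP[z0 z1]; elim: m => [|m IH]; first by rewrite mul0r subr0 expr0.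
rewrite exprS -natr1; have : 0 <= 1 - z <= 1 by lra.
have : 0 <= m%:R :> R by []. set M := m%:R in IH *; nra.
Qed.

Lemma Bernoulli_ineq_inv z m : 0 <= z <= 1 -> (1 - z) ^+ m * (1 + m%:R * z) <= 1.
Proof.
move=> /andP[z0 z1]; elim: m => [|m IH]; first by rewrite mul0r addr0 expr0 mulr1.
rewrite exprS -natr1; have : 0 <= (1 - z) ^+ m by rewrite exprn_ge0// subr_ge0.
have : 0 <= m%:R :> R by [].
set M := m%:R in IH *; set E := _ ^+ m in IH * => M0 E0.
have -> : (1 - z) * E * (1 + (M + 1) * z) =
  E * (1 + M * z) - E * z * (M * z + z) by ring.
have : 0 <= E * z * (M * z + z) by rewrite !mulr_ge0// addr_ge0// mulr_ge0.
lra.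
Qed.

(** These polynomials in [y] converge to 1 on [0, 1/2[ and to 0 on ]1/2, 1]: by
    Bernoulli's inequality they behave like a decreasing function of
    2^n y^n = (2 y)^n. *)
Let Q n y := (1 - y ^+ n) ^+ (2 ^ n).

Lemma step_poly_bound n y : 0 <= y <= 1 -> 0 <= Q n y <= 1.
Proof.
move=> /andP[y0 y1]; rewrite /Q; have yn0 : 0 <= y ^+ n by rewrite exprn_ge0.
have yn1 : y ^+ n <= 1 by rewrite exprn_ile1.
by rewrite exprn_ge0 ?subr_ge0//= exprn_ile1 ?subr_ge0// gerBl.
Qed.

Lemma step_poly_left y : 0 <= y < 2^-1 -> Q n y @[n --> \oo] --> (1 : R).
Proof.
move=> /andP[y0 y2].
have y1 : y <= 1 by lra.
have y01 : 0 <= y <= 1 by rewrite y0.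
apply: (@squeeze_cvgr _ _ _ _ (fun n => 1 - (2 * y) ^+ n) (cst 1)).
- apply: nearW => n; have /andP[_ ->] := step_poly_bound n y01.
  rewrite andbT; apply: le_trans (Bernoulli_ineq _ _).
    by rewrite exprMn natrX.
  by rewrite exprn_ge0//= exprn_ile1.
- rewrite -[X in _ --> X]subr0; apply: cvgB; first exact: cvg_cst.
  by apply: cvg_expr; rewrite ger0_norm; lra.
- exact: cvg_cst.
Qed.

Lemma step_poly_right y : 2^-1 < y <= 1 -> Q n y @[n --> \oo] --> (0 : R).
Proof.
move=> /andP[y2 y1].
have y0 : 0 < y by lra.
have y01 : 0 <= y <= 1 by rewrite y1 ltW.
apply: (@squeeze_cvgr _ _ _ _ (cst 0) (fun n => ((2 * y)^-1) ^+ n)).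
- apply: nearW => n; have /andP[-> _] := step_poly_bound n y01.
  have yn : 0 <= y ^+ n <= 1 by rewrite (exprn_ge0 n (ltW y0))/= exprn_ile1// ltW.
  have := Bernoulli_ineq_inv (2 ^ n) yn; rewrite -/(Q n y) => h.
  have y2n : 0 < (2 * y) ^+ n by rewrite exprn_gt0// mulr_gt0.
  rewrite exprVn -[leRHS]mul1r ler_pdivlMr//=; apply: le_trans h.
  rewrite exprMn natrX ler_wpM2l ?lerDr//.
  by have /andP[] := step_poly_bound n y01.
- exact: cvg_cst.
- apply: cvg_expr; rewrite ger0_norm ?invr_ge0 ?mulr_ge0 ?ltW//.
  by rewrite invf_lt1 ?mulr_gt0//; lra.
Qed.
End StepPolynomials.

(** * The uniform distribution on [0, pi] *)

Section UniformOnHalfPeriod.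
Variable R : realType.

Definition half_period : probability (measurableTypeR R) R :=
  uniform_prob (@pi_gt0 R).
Notation P := half_period.
Notation mu := (@lebesgue_measure R).

Lemma half_period_dominated A : measurable A -> mu A = 0%E -> P A = 0%E.
Proof.
move=> mA A0; have := dominates_uniform_prob (@pi_gt0 R).
by move/null_content_dominatesP => /(_ A mA A0).
Qed.

Lemma half_periodE A : measurable A ->
  (P A = pi^-1%:E * mu (A `&` `[0%R, pi]%classic))%E.
Proof.
move=> mA; rewrite -[A in P A]setIT -integral_indic// integral_uniform//.
  by rewrite subr0 integral_indic.
by apply/measurable_EFinP; exact: measurable_indic.
Qed.

Lemma half_period_set1 x : P [set x] = 0%E.
Proof.
apply: half_period_dominated => //; exact: lebesgue_measure_set1.
Qed.

Lemma half_period_ae : {ae P, forall x, 0 < x < pi}.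
Proof.
exists (~` `]0, pi[%classic); split; first exact: measurableC.
  rewrite half_periodE; last exact: measurableC.
  rewrite (_ : _ `&` _ = [set 0; pi]); last first.
    apply/seteqP; split => x /=; rewrite !in_itv/=.
      move=> [/negP + /andP[x0 xp]]; rewrite negb_and -!leNgt => /orP[h|h].
        by left; apply/eqP; rewrite eq_le x0 h.
      by right; apply/eqP; rewrite eq_le xp h.
    by move=> [->|->]; rewrite ?ltxx ?lexx ?pi_ge0 ?andbF.
  rewrite null_set_setU ?mule0//; exact: lebesgue_measure_set1.
by move=> x /=; rewrite in_itv.
Qed.

Lemma integrable_half_period (h : R -> R) :
  P.-integrable setT (EFin \o h) -> mu.-integrable `[0, pi]%classic (EFin \o h).
Proof.
move=> /integrableP[mh ih]; apply/integrableP; split; first exact: measurable_funS mh.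
move: ih; rewrite integral_uniform//; last exact: measurableT_comp.
set I := (X in (_ * X)%E); rewrite subr0 => ih.
have I0 : (0 <= I)%E by exact: integral_ge0.
suff : (I < +oo)%E by [].
rewrite -[I]mul1e -[1%E]/(1%:E) -(@divff _ pi) ?gt_eqF ?pi_gt0//.
by rewrite EFinM -muleA lte_mul_pinfty// lee_fin pi_ge0.
Qed.

Lemma Rintegral_half_period (h : R -> R) : P.-integrable setT (EFin \o h) ->
  \int[P]_x h x = pi^-1 * \int[mu]_(x in `[0, pi]) h x.
Proof.
move=> ih; have ih' := integrable_half_period ih.
have mh := measurable_int _ ih.
rewrite /Rintegral integralE !integral_uniform//; last 2 first.
- exact: measurable_funeneg.
- exact: measurable_funepos.
rewrite subr0 [in RHS]integralE -muleBr//; last first.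
  exact: integrable_add_def.
rewrite fineM// fin_numB; apply/andP; split.
  exact: integrable_pos_fin_num.
exact: integrable_neg_fin_num.
Qed.
End UniformOnHalfPeriod.

(** * Totality of the cosines on [0, pi] *)

Lemma aeS2 d (T : measurableType d) (R : realType) (m : {measure set T -> \bar R})
    (A B C : T -> Prop) : (forall x, A x -> B x -> C x) ->
  {ae m, forall x, A x} -> {ae m, forall x, B x} -> {ae m, forall x, C x}.
Proof. by apply: filterS2; exact: (ae_filter_ringOfSetsType m). Qed.

Section CosineTotal.
Variable R : realType.
Notation P := (half_period R).
Notation mu := (@lebesgue_measure R).

(** By Lebesgue's differentiation theorem [h], cut off to [0, pi], is almost
    everywhere the derivative of its primitive, which vanishes. *)
Lemma half_period_primitive_eq0 (h : R -> R) : P.-integrable setT (EFin \o h) ->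
  (forall s, 0 <= s <= pi -> \int[P]_x ((h \_ `]-oo, s]) x) = 0) ->
  {ae P, forall x, h x = 0}.
Proof.
move=> ih h0; have ih' := integrable_half_period ih.
pose f := h \_ `[0, pi]%classic.
have If : mu.-integrable setT (EFin \o f).
  by move: ih'; rewrite integrable_mkcond//= (restrict_EFin h).
have F0 x : \int[mu]_(t in [set` `]-oo, x]]) f t = 0.
  rewrite /f -Rintegral_mkcondr setIC.
  have [x0|x0] := ltP x 0.
    rewrite (_ : _ `&` _ = set0) ?Rintegral_set0//; apply/seteqP; split => y//=.
    by rewrite !in_itv/=; lra.
  pose s := Num.min x pi.
  have s0 : 0 <= s <= pi by rewrite /s le_min ge_min x0 pi_ge0 lexx orbT.
  rewrite (_ : _ `&` _ = `[0, pi]%classic `&` `]-oo, s]%classic); last first.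
    apply/seteqP; split => y /=; rewrite !in_itv/= /s le_min => -[/andP[y0 yp]].
      by move=> ->; rewrite y0 yp.
    by move=> /andP[-> _]; rewrite y0 yp.
  rewrite Rintegral_mkcondr.
  have := h0 s s0; rewrite Rintegral_half_period.
    by move=> /eqP; rewrite mulf_eq0 invr_eq0 gt_eqF ?pi_gt0//= => /eqP.
  have : P.-integrable `]-oo, s]%classic (EFin \o h) by exact: integrableS ih.
  by rewrite integrable_mkcond//= (restrict_EFin h).
have f_ae : {ae mu, forall x, f x = 0}.
  have loc : locally_integrable [set: R] f.
    by apply: open_integrable_locally => //; exact: openT.
  have intf y : mu.-integrable `]-oo, y] (EFin \o f) by exact: integrableS If.
  have := FTC1Ny intf loc; apply: filterS; first exact: (ae_filter_ringOfSetsType mu).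
  move=> x [_ <-]; under eq_fun do rewrite F0.
  exact: derive1_cst.
have Pf_ae : {ae P, forall x, f x = 0}.
  by move: f_ae => [A [mA A0 subA]]; exists A; split => //; exact: half_period_dominated.
apply: aeS2 Pf_ae (half_period_ae R) => x.
move=> + /andP[x0 xp]; rewrite /f patchE mem_set//=.
by rewrite in_itv/= (ltW x0) (ltW xp).
Qed.

Lemma integrable_bounded_mul (b h : R -> R) C : measurable_fun setT b ->
  (forall x, `|b x| <= C) -> P.-integrable setT (EFin \o h) ->
  P.-integrable setT (EFin \o (fun x => b x * h x)).
Proof.
move=> mb bC ih; have := integrableZl measurableT C ih; apply: le_integrable => //.
  apply/measurable_EFinP; apply: measurable_funM => //.
  by apply/measurable_EFinP; exact: measurable_int ih.
move=> x _ /=; rewrite lee_fin !normrM ler_wpM2r// (le_trans (bC x))//.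
exact: ler_norm.
Qed.

Section AgainstCosines.
Variable h : R -> R.
Hypothesis ih : P.-integrable setT (EFin \o h).
Hypothesis h_cos : forall n : nat, \int[P]_x (cos (n%:R * x) * h x) = 0.

Lemma cos_le1_norm (x : R) : `|cos x| <= 1.
Proof. by rewrite ler_norml cos_geN1 cos_le1. Qed.

Lemma cos_scaled_continuous c : continuous (fun x : R => cos (c * x)).
Proof.
move=> x; apply: continuous_comp; last exact: continuous_cos.
by apply: continuousM; [exact: cst_continuous|exact: id].
Qed.

Lemma measurable_cos_scaled c : measurable_fun [set: measurableTypeR R] (fun x : R => cos (c * x)).
Proof. by apply: continuous_measurable_fun; exact: cos_scaled_continuous. Qed.

Lemma measurable_cos_pow n m :
  measurable_fun [set: measurableTypeR R] (fun x : R => cos x ^+ n * cos (m%:R * x)).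
Proof.
apply: measurable_funM; last exact: measurable_cos_scaled.
apply: measurable_funX; apply: continuous_measurable_fun; exact: continuous_cos.
Qed.

Lemma integrable_cos_pow n m :
  P.-integrable setT (EFin \o (fun x => cos x ^+ n * cos (m%:R * x) * h x)).
Proof.
apply: (@integrable_bounded_mul _ _ 1) => // [|x]; first exact: measurable_cos_pow.
by rewrite normrM normrX mulr_ile1// ?cos_le1_norm// exprn_ile1// cos_le1_norm.
Qed.

(** The product of cos x and cos (m x) is the average of cos ((m + 1) x) and
    cos ((m - 1) x). *)
Lemma cos_pow_orth n m : \int[P]_x (cos x ^+ n * cos (m%:R * x) * h x) = 0.
Proof.
elim: n m => [|n IH] m.
  by rewrite -[RHS](h_cos m); apply: eq_Rintegral => x _; rewrite expr0 mul1r.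
case: m => [|m].
  rewrite -[RHS](IH 1); apply: eq_Rintegral => x _.
  by rewrite mul0r cos0 mulr1 mul1r -exprSr.
have -> : (fun x => cos x ^+ n.+1 * cos (m.+1%:R * x) * h x) =
   (fun x => 2^-1 * (cos x ^+ n * cos (m.+2%:R * x) * h x) +
             2^-1 * (cos x ^+ n * cos (m%:R * x) * h x)).
  apply/funext => x; rewrite exprSr.
  have -> : m.+2%:R * x = m.+1%:R * x + x by rewrite -[m.+2]addn1 natrD; ring.
  have -> : m%:R * x = m.+1%:R * x - x by rewrite -[m.+1]addn1 natrD; ring.
  by rewrite cosD cosB; field.
rewrite RintegralD//; last 2 first.
- by have := integrableZl measurableT 2^-1 (integrable_cos_pow n m.+2).
- by have := integrableZl measurableT 2^-1 (integrable_cos_pow n m).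
by rewrite !RintegralZl ?IH ?mulr0 ?addr0//; exact: integrable_cos_pow.
Qed.

Lemma poly_cos_orth (q : {poly R}) :
  P.-integrable setT (EFin \o (fun x => q.[cos x] * h x)) /\
  \int[P]_x (q.[cos x] * h x) = 0.
Proof.
suff H n : P.-integrable setT (EFin \o (fun x => cos x ^+ n * q.[cos x] * h x)) /\
    \int[P]_x (cos x ^+ n * q.[cos x] * h x) = 0.
  by have := H 0%N; under [X in EFin \o X]eq_fun do rewrite expr0 mul1r;
     under eq_Rintegral do rewrite expr0 mul1r.
elim/poly_ind: q n => [|q c IH] n.
  under [X in EFin \o X]eq_fun do rewrite horner0 mulr0 mul0r.
  under eq_Rintegral do rewrite horner0 mulr0 mul0r.
  split; first exact: integrable0.
  by rewrite Rintegral_cst// mul0r.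
have E : (fun x => cos x ^+ n * (q * 'X + c%:P).[cos x] * h x) =
   (fun x => cos x ^+ n.+1 * q.[cos x] * h x + c * (cos x ^+ n * cos (0%:R * x) * h x)).
  by apply/funext => x; rewrite hornerMXaddC mul0r cos0 exprS; ring.
have [i1 e1] := IH n.+1; have i2 := integrableZl measurableT c (integrable_cos_pow n 0).
rewrite E; split; first exact: (integrableD measurableT i1 i2).
rewrite RintegralD// e1 add0r RintegralZl ?cos_pow_orth ?mulr0//.
exact: integrable_cos_pow.
Qed.

(** Polynomials in cos x are orthogonal to [h], and the indicator function of
    [0, s] is a bounded limit of such polynomials almost everywhere, so all
    primitives of [h] vanish. *)
Lemma cos_total : {ae P, forall x, h x = 0}.
Proof.
apply: half_period_primitive_eq0 => // s /andP[s0 sp].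
(* y has values in [0, 1] and, on [0, pi], y x < 1/2 exactly when x < s *)
pose y x := 2^-1 + (cos s - cos x) / 4.
have y01 x : 0 <= y x <= 1.
  have := cos_geN1 x; have := cos_le1 x; have := cos_geN1 s; have := cos_le1 s.
  rewrite /y; lra.
pose q n : {poly R} := (1 - ((2^-1 + cos s / 4)%:P - 4^-1 *: 'X) ^+ n) ^+ (2 ^ n).
have qE n x : (q n).[cos x] = (1 - y x ^+ n) ^+ (2 ^ n).
  rewrite /q horner_exp hornerD hornerN horner_exp !hornerE.
  congr ((1 - _ ^+ _) ^+ _); rewrite /y; by field.
have [] := @dominated_convergence _ _ _ P setT measurableT
   (fun n x => ((q n).[cos x] * h x)%:E) (EFin \o (h \_ `]-oo, s])) (abse \o (EFin \o h)).
- by move=> m; have [/measurable_int] := poly_cos_orth (q m).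
- have : P.-integrable `]-oo, s]%classic (EFin \o h) by exact: integrableS ih.
  by rewrite integrable_mkcond//= (restrict_EFin h) => /measurable_int.
- have s_ae : {ae P, forall x, x <> s}.
    by exists [set s]; split => //; [exact: half_period_set1|move=> x /= /contrapT].
  apply: aeS2 s_ae (half_period_ae R) => x xs /andP[x0 xp] _.
  have hq : (q n).[cos x] @[n --> \oo] --> (if x <= s then 1 else 0 : R).
    under eq_fun do rewrite qE.
    have [sx|sx] := leP x s.
      have {}sx : x < s by rewrite lt_neqAle sx andbT; apply/eqP.
      apply: step_poly_left; have /andP[-> _] := y01 x; rewrite /y.
      have : cos s < cos x by rewrite ltr_cos// in_itv/= ?s0 ?sp// (ltW x0) ltW.
      by lra.
    apply: step_poly_right; have /andP[_ ->] := y01 x; rewrite /y.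
    have : cos x < cos s by rewrite ltr_cos// in_itv/= ?s0 ?sp// (ltW x0) ltW.
    by lra.
  have -> : (EFin \o h \_ `]-oo, s]) x = ((if x <= s then 1 else 0) * h x)%:E.
    rewrite /= patchE mem_setE in_itv/=.
    by case: ifP; rewrite ?mul1r ?mul0r.
  apply: cvg_EFin; first exact: nearW.
  exact: cvgM hq (cvg_cst _).
- exact: integrable_abse.
- apply: aeW => x n _ /=; rewrite lee_fin normrM qE ler_piMl//.
  by have /andP[h0 h1] := step_poly_bound n (y01 x); rewrite ger0_norm.
move=> _ _; set u := (X in X @ _ --> _).
have -> : u = fun=> 0%E.
  apply/funext => n; rewrite /u/=; have [iq eq0] := poly_cos_orth (q n).
  rewrite -[LHS]fineK; last exact: (integrable_fin_num measurableT iq).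
  by congr _%:E.
move=> c0; have := cvg_unique _ c0 (cvg_cst _).
by rewrite /Rintegral => ->.
Qed.
End AgainstCosines.

End CosineTotal.

(** * Totality of the cosines and sines on [0, pi] *)

Section TrigonometricIntegrals.
Variable R : realType.
Notation P := (half_period R).

Lemma sin_natpi (n : nat) : sin (n%:R * pi) = 0 :> R.
Proof.
elim: n => [|n IH]; first by rewrite mul0r sin0.
by rewrite -natr1 mulrDl mul1r sinDpi IH oppr0.
Qed.

Lemma sin_scaled_continuous c : continuous (fun x : R => sin (c * x)).
Proof.
move=> x; apply: continuous_comp; last exact: continuous_sin.
by apply: continuousM; [exact: cst_continuous|exact: id].
Qed.

Lemma Rintegral_cos_nat (n : nat) : \int[P]_x cos (n%:R * x) = (n == 0)%:R.
Proof.
case: n => [|n].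
  under eq_Rintegral do rewrite mul0r cos0.
  rewrite Rintegral_cst//= mul1r.
  by rewrite [X in fine X]probability_setT.
rewrite Rintegral_half_period; last first.
  apply: measurable_bounded_integrable => //.
    by rewrite [X in (X < _)%E]probability_setT ltry.
    exact: measurable_cos_scaled.
  exists 1; split => // M M1 x _ /=; apply: le_trans (ltW M1); exact: cos_le1_norm.
have n0 : n.+1%:R != 0 :> R by rewrite pnatr_eq0.
pose F (x : R) := n.+1%:R^-1 * sin (n.+1%:R * x).
have dF (x : R) : is_derive x 1 F (cos (n.+1%:R * x)).
  apply: is_derive_eq.
  by rewrite /GRing.scale/= mulr1 mulrCA mulVf ?mulr1.
have cF : continuous F.
  move=> x; apply: cvgM; [exact: cvg_cst|exact: sin_scaled_continuous].
rewrite /Rintegral (@continuous_FTC2 _ _ F)//; last 4 first.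
- exact: pi_gt0.
- apply: continuous_subspaceT => x; exact: cos_scaled_continuous.
- split => [x _||]; first by case: (dF x).
    exact/cvg_at_right_filter/cF.
  exact/cvg_at_left_filter/cF.
- by move=> x _; rewrite derive1E; case: (dF x).
by rewrite /F sin_natpi !mulr0 sin0 !mulr0 -EFinB subrr mulr0.
Qed.

Lemma Rintegral_cos_int (z : int) : \int[P]_x cos (z%:~R * x) = (z == 0)%:R.
Proof.
case: z => n; first exact: Rintegral_cos_nat.
rewrite NegzE mulrNz; under eq_Rintegral do rewrite mulNr cosN.
by rewrite Rintegral_cos_nat.
Qed.

Lemma measurable_sinM c : measurable_fun [set: measurableTypeR R] (fun x : R => sin (c * x)).
Proof. by apply: continuous_measurable_fun; exact: sin_scaled_continuous. Qed.

Lemma sin_le1_norm (x : R) : `|sin x| <= 1.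
Proof. by rewrite ler_norml sin_geN1 sin_le1. Qed.

Lemma integrable_cosM c (g : R -> R) : P.-integrable setT (EFin \o g) ->
  P.-integrable setT (EFin \o (fun x => cos (c * x) * g x)).
Proof.
apply: (@integrable_bounded_mul _ _ _ 1); first exact: measurable_cos_scaled.
by move=> x; exact: cos_le1_norm.
Qed.

Lemma integrable_sinM c (g : R -> R) : P.-integrable setT (EFin \o g) ->
  P.-integrable setT (EFin \o (fun x => sin (c * x) * g x)).
Proof.
apply: (@integrable_bounded_mul _ _ _ 1); first exact: measurable_sinM.
by move=> x; exact: sin_le1_norm.
Qed.

(** Exchanging z and - z separates the two integrals. The one with sines says
    that sin x g2 x is orthogonal to all cosines, by the product formula for
    sin x cos (n x), and sin does not vanish inside [0, pi]. *)
Lemma cos_sin_total (g1 g2 : R -> R) :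
  P.-integrable setT (EFin \o g1) -> P.-integrable setT (EFin \o g2) ->
  (forall z : int, \int[P]_x (cos (z%:~R * x) * g1 x + sin (z%:~R * x) * g2 x) = 0) ->
  {ae P, forall x, g1 x = 0 /\ g2 x = 0}.
Proof.
move=> i1 i2 orth.
have sumE z : \int[P]_x (cos (z%:~R * x) * g1 x) + \int[P]_x (sin (z%:~R * x) * g2 x) = 0.
  by rewrite -RintegralD//; [exact: integrable_cosM|exact: integrable_sinM].
have difE z : \int[P]_x (cos (z%:~R * x) * g1 x) - \int[P]_x (sin (z%:~R * x) * g2 x) = 0.
  rewrite -[RHS](sumE (- z)) mulrNz; congr (_ + _).
    by apply: eq_Rintegral => x _; rewrite mulNr cosN.
  rewrite -mulN1r -RintegralZl//; last exact: integrable_sinM.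
  by apply: eq_Rintegral => x _; rewrite !mulNr sinN mulNr mul1r.
have cosE z : \int[P]_x (cos (z%:~R * x) * g1 x) = 0 by have := sumE z; have := difE z; lra.
have sinE z : \int[P]_x (sin (z%:~R * x) * g2 x) = 0 by have := sumE z; have := difE z; lra.
have g1_0 : {ae P, forall x, g1 x = 0} by apply: cos_total => // n; exact: cosE n.
have is2 : P.-integrable setT (EFin \o (fun x => sin x * g2 x)).
  by have := integrable_sinM 1 i2; under [X in EFin \o X]eq_fun do rewrite mul1r.
have g2_0 : {ae P, forall x, sin x * g2 x = 0}.
  apply: cos_total => // n.
  have -> : (fun x => cos (n%:R * x) * (sin x * g2 x)) =
     (fun x => 2^-1 * (sin ((n%:Z + 1)%:~R * x) * g2 x) +
               - 2^-1 * (sin ((n%:Z - 1)%:~R * x) * g2 x)).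
    apply/funext => x.
    have -> : (n%:Z + 1)%:~R * x = n%:R * x + x by rewrite intrD mulrDl mul1r.
    have -> : (n%:Z - 1)%:~R * x = n%:R * x - x by rewrite intrB mulrBl mul1r.
    by rewrite sinD sinB; field.
  rewrite RintegralD//; last 2 first.
  - exact: (integrableZl measurableT 2^-1 (integrable_sinM _ i2)).
  - exact: (integrableZl measurableT (- 2^-1) (integrable_sinM _ i2)).
  by rewrite !RintegralZl ?sinE ?mulr0 ?addr0//; exact: integrable_sinM.
have g2_0' : {ae P, forall x, g2 x = 0}.
  apply: aeS2 g2_0 (half_period_ae R) => x /eqP + x0p.
  by rewrite mulf_eq0 gt_eqF ?sin_gt0_pi//= => /eqP.
by apply: aeS2 g1_0 g2_0' => x.
Qed.
End TrigonometricIntegrals.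

(** * The Bloch functions *)

Section FiberKernel.
Variables (R : realType) (N : nat).
Notation p := (N.*2.+1).
Notation P := (half_period R).
Notation I := ('I_p * bool)%type.
Variable psi : 'I_p -> 'I_p -> R -> R.
Hypothesis psi_cont : forall k i, continuous (psi k i).
Hypothesis psi_orth : forall k k' th, \sum_i psi k i th * psi k' i th = (k == k')%:R.

Lemma psi_le1 k i th : `|psi k i th| <= 1.
Proof.
have := psi_orth k k th; rewrite eqxx (bigD1 i)//= => E.
have : psi k i th * psi k i th <= 1.
  by rewrite -[leRHS]/(true%:R) -E lerDl sumr_ge0// => j _; rewrite -expr2 sqr_ge0.
by rewrite -expr2 -[leLHS](real_normK (num_real _)) -[leRHS](expr1n _ 2) ler_sqr// nnegrE.
Qed.

(** A square matrix with orthonormal rows has orthonormal columns. *)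
Lemma psi_col_orth i j th : \sum_k psi k i th * psi k j th = (i == j)%:R.
Proof.
pose Q : 'M[R]_p := \matrix_(k, i) psi k i th.
have : Q *m Q^T = 1%:M.
  apply/matrixP => k k'; rewrite !mxE -(psi_orth _ _ th); apply: eq_bigr => l _.
  by rewrite !mxE.
move/mulmx1C => /matrixP /(_ i j); rewrite !mxE => <-.
by apply: eq_bigr => l _; rewrite !mxE.
Qed.

(** The position of the vertex (n, k) in the direction of periodicity is taken
    to be n + floor(k / 2) / 2. With this gauge the two edges of a [sigma] bond
    lead to the relative positions 1/2 and - 1/2, and a [tau] bond to 0, so the
    fibers have real entries. *)
Definition phase (y : vertex N) : R := y.1%:~R + (y.2.+1./2)%:R / 2.

Definition osc (b : bool) (x : R) : R := if b then cos x else sin x.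

(** As a function of the vertex [y] this is the real generalized eigenfunction
    at momentum [th], in the band [kb.1], of cosine or sine type according to
    [kb.2]. *)
Definition bloch (y : vertex N) (kb : I) (th : R) : R :=
  osc kb.2 (phase y * th) * psi kb.1 y.2 th.

Lemma osc_le1 b x : `|osc b x| <= 1.
Proof. by case: b; [exact: cos_le1_norm|exact: sin_le1_norm]. Qed.

Lemma bloch_le1 y kb th : `|bloch y kb th| <= 1.
Proof. by rewrite normrM mulr_ile1// ?osc_le1// psi_le1. Qed.

Lemma measurable_osc b c : measurable_fun [set: measurableTypeR R] (fun x => osc b (c * x)).
Proof. by case: b; [exact: measurable_cos_scaled|exact: measurable_sinM]. Qed.

Lemma measurable_psi k i : measurable_fun [set: measurableTypeR R] (psi k i).
Proof. by apply: continuous_measurable_fun; exact: psi_cont. Qed.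

Lemma measurable_bloch y kb : measurable_fun [set: measurableTypeR R] (bloch y kb).
Proof. by apply: measurable_funM; [exact: measurable_osc|exact: measurable_psi]. Qed.

Lemma sqint_mul_bounded (b f : R -> R) C :
  measurable_fun [set: measurableTypeR R] b -> (forall x, `|b x| <= C) ->
  sqint P f -> sqint P (fun x => b x * f x).
Proof. by move=> mb bC sf; exact: (@sqint_bounded _ _ _ P b f C). Qed.

Lemma vsqint_bloch y : vsqint P (bloch y).
Proof.
move=> kb; have := sqint_mul_bounded (measurable_bloch y kb) (bloch_le1 y kb) (sqint_cst P 1).
by under eq_fun do rewrite mulr1.
Qed.

Lemma sum_pairE (F : I -> R) : \sum_kb F kb = \sum_k \sum_b F (k, b).
Proof. by rewrite pair_bigA; apply: eq_bigr => -[k b] _. Qed.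

(** Summing over the bands leaves the cosine of the difference of the phases
    for two vertices of the same row, and 0 for distinct rows. *)
Lemma bloch_orth y y' : ip P (bloch y) (bloch y') = (y == y')%:R.
Proof.
have E x : \sum_(kb : I) bloch y kb x * bloch y' kb x =
    (y.2 == y'.2)%:R * cos ((phase y - phase y') * x).
  rewrite sum_pairE.
  rewrite -(psi_col_orth _ _ x) mulr_suml; apply: eq_bigr => k _.
  rewrite big_bool /bloch /osc /= mulrBl cosB; ring.
rewrite /ip; under eq_Rintegral do rewrite E.
case: y y' E => [n i] [n' i'] _ /=; rewrite xpair_eqE.
have [->|ii'] := eqVneq i i'; last first.
  under eq_Rintegral do rewrite mul0r.
  by rewrite andbF Rintegral_cst// mul0r.
rewrite andbT -subr_eq0 -(Rintegral_cos_int R); apply: eq_Rintegral => x _.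
by rewrite mul1r; congr (cos (_ * _)); rewrite /phase /= intrB; ring.
Qed.

Lemma vsqint_comp (G : I -> R -> R) b i : vsqint P G ->
  sqint P (fun x => \sum_k psi k i x * G (k, b) x).
Proof.
move=> sG; apply: sqint_sum => k; apply: sqint_mul_bounded (sG _).
  exact: measurable_psi.
by move=> x; exact: psi_le1.
Qed.

Lemma sqint_integrable (f : R -> R) : sqint P f -> P.-integrable setT (EFin \o f).
Proof.
move=> sf; have := sqintM sf (sqint_cst P 1).
by under [X in EFin \o X]eq_fun do rewrite mulr1.
Qed.

(** Orthogonality of [psi] allows to pass from the bands to the rows. In each
    row a rotation by the angle [c x] removes the fractional part of the phase,
    and [cos_sin_total] applies to the rotated pair. *)
Lemma bloch_total_ae (G : I -> R -> R) : vsqint P G ->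
  (forall y, ip P (bloch y) G = 0) -> {ae P, forall x, forall kb, G kb x = 0}.
Proof.
move=> sG orth.
pose h b i x := \sum_k psi k i x * G (k, b) x.
have h0 i : {ae P, forall x, h true i x = 0 /\ h false i x = 0}.
  pose c : R := (i.+1./2)%:R / 2.
  pose g1 x := cos (c * x) * h true i x + sin (c * x) * h false i x.
  pose g2 x := cos (c * x) * h false i x + - 1 * (sin (c * x) * h true i x).
  have sh b : P.-integrable setT (EFin \o h b i).
    by apply: sqint_integrable; exact: vsqint_comp.
  have g0 : {ae P, forall x, g1 x = 0 /\ g2 x = 0}.
    apply: cos_sin_total.
    - exact: (integrableD measurableT (integrable_cosM c (sh true)) (integrable_sinM c (sh false))).
    - exact: (integrableD measurableT (integrable_cosM c (sh false))
        (integrableZl measurableT (-1) (integrable_sinM c (sh true)))).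
    - move=> z; rewrite -[RHS](orth (z, i)); apply: eq_Rintegral => x _.
      rewrite sum_pairE.
      have -> : \sum_k \sum_b bloch (z, i) (k, b) x * G (k, b) x =
         cos (phase (z, i) * x) * h true i x + sin (phase (z, i) * x) * h false i x.
        rewrite /h !mulr_sumr -big_split; apply: eq_bigr => k _ /=.
        by rewrite big_bool /bloch /osc /=; ring.
      rewrite /phase /= -/c mulrDl cosD sinD /g1 /g2; ring.
  apply: filterS g0; first exact: (ae_filter_ringOfSetsType P).
  move=> x [e1 e2].
  have cs := cos2Dsin2 (c * x).
  have -> : h true i x = (cos (c * x) ^+ 2 + sin (c * x) ^+ 2) * h true i x by rewrite cs mul1r.
  have -> : h false i x = (cos (c * x) ^+ 2 + sin (c * x) ^+ 2) * h false i x by rewrite cs mul1r.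
  split.
    transitivity (cos (c * x) * g1 x - sin (c * x) * g2 x); first by rewrite /g1 /g2; ring.
    by rewrite e1 e2 !mulr0 subrr.
  transitivity (sin (c * x) * g1 x + cos (c * x) * g2 x); first by rewrite /g1 /g2; ring.
  by rewrite e1 e2 !mulr0 addr0.
have all0 : {ae P, forall x, forall i, h true i x = 0 /\ h false i x = 0}.
  have FF := ae_filter_ringOfSetsType P.
  by apply: (@filter_forall _ _ (fun i x => h true i x = 0 /\ h false i x = 0)); exact: h0.
apply: filterS all0; first exact: (ae_filter_ringOfSetsType P).
move=> x hx [k b].
have {}hx i : h b i x = 0 by case: (hx i); case: (b).
have : \sum_i psi k i x * h b i x = 0 by rewrite big1// => i _; rewrite hx mulr0.
move=> <-; under eq_bigr do rewrite mulr_sumr.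
rewrite exchange_big/= (bigD1 k)//= [X in _ + X]big1 ?addr0.
  under eq_bigr do rewrite mulrA.
  by rewrite -mulr_suml psi_orth eqxx mul1r.
move=> k' k'k; under eq_bigr do rewrite mulrA.
by rewrite -mulr_suml psi_orth eq_sym (negbTE k'k) mul0r.
Qed.

Lemma ip_ae (F F' G : I -> R -> R) : vsqint P F -> vsqint P F' -> vsqint P G ->
  {ae P, forall x, forall kb, F kb x = F' kb x} -> ip P F G = ip P F' G.
Proof.
move=> sF sF' sG FF'; rewrite /ip /Rintegral; congr fine.
apply: ae_eq_integral => //.
- exact: measurable_int (ip_integrable sF sG).
- exact: measurable_int (ip_integrable sF' sG).
apply: filterS FF'; first exact: (ae_filter_ringOfSetsType P).
by move=> x FF' _; congr _%:E; apply: eq_bigr => kb _; rewrite FF'.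
Qed.

Lemma bloch_total (G : I -> R -> R) : vsqint P G ->
  (forall y, ip P (bloch y) G = 0) -> ip P G G = 0.
Proof.
move=> sG orth; have G0 := bloch_total_ae sG orth.
have s0 : vsqint P (fun (_ : I) (_ : R) => 0) by exact: vsqint0.
by rewrite (ip_ae sG s0 sG G0) ip0l.
Qed.

End FiberKernel.

(** * The Bloch transform *)

Lemma vertex_enum (N : nat) : exists (g : nat -> vertex N) (e : vertex N -> nat),
  cancel g e /\ cancel e g.
Proof.
have inf : infinite_set [set: vertex N].
  move=> /(finite_image (fun y : vertex N => absz y.1)).
  apply: contra_not infinite_nat; apply: sub_finite_set => n _.
  by exists (n%:Z, ord0).
have := eq_card_nat (countableP _) inf.
move=> /card_set_bijP[e [_ inj surj]].
have /choice[g gP] : forall n, exists y, e y = n.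
  by move=> n; have [y _ <-] := surj n I; exists y.
exists g, e; split => // y; apply: inj; rewrite ?in_setT//; exact: gP.
Qed.

Section BlochTransform.
Variables (R : realType) (N : nat).
Notation p := (N.*2.+1).
Notation P := (half_period R).
Notation I := ('I_p * bool)%type.
Variable psi : 'I_p -> 'I_p -> R -> R.
Hypothesis psi_cont : forall k i, continuous (psi k i).
Hypothesis psi_orth : forall k k' th, \sum_i psi k i th * psi k' i th = (k == k')%:R.
Notation bloch := (bloch psi).

Lemma bloch_isometry (G : I -> R -> R) : vsqint P G ->
  (\esum_(y in [set: vertex N]) ((ip P (bloch y) G) ^+ 2)%:E = (ip P G G)%:E)%E.
Proof.
move=> sG; have [g [e [ge eg]]] := vertex_enum N.
have se n : vsqint P (bloch (g n)) by exact: vsqint_bloch.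
have e_orth m n : ip P (bloch (g m)) (bloch (g n)) = (m == n)%:R.
  by rewrite (bloch_orth psi_orth) (can_eq ge).
rewrite (reindex_esum [set: nat] _ g); last first.
  split => //; first by move=> m n _ _; exact: (can_inj ge).
  by move=> y _; exists (e y).
rewrite -nneseries_esumT; last by move=> n; rewrite lee_fin sqr_ge0.
apply/cvg_lim => //.
rewrite (_ : (fun _ => _) = EFin \o series (fun n => ip P (bloch (g n)) G ^+ 2)); last first.
  by apply/funext => n; rewrite /= /series/= -sumEFin.
apply: cvg_EFin; first exact: nearW.
apply: (Parseval se e_orth sG) => H sH H0.
apply: (bloch_total psi_cont psi_orth sH) => y.
by rewrite -(eg y).
Qed.

Lemma bloch_onto (f : vertex N -> R) :
  (\esum_(y in [set: vertex N]) ((f y) ^+ 2)%:E < +oo)%E ->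
  exists2 G : I -> R -> R, vsqint P G & forall y, ip P (bloch y) G = f y.
Proof.
have [g [e [ge eg]]] := vertex_enum N.
have se n : vsqint P (bloch (g n)) by exact: vsqint_bloch.
have e_orth m n : ip P (bloch (g m)) (bloch (g n)) = (m == n)%:R.
  by rewrite (bloch_orth psi_orth) (can_eq ge).
rewrite (reindex_esum [set: nat] _ g); last first.
  split => //; first by move=> m n _ _; exact: (can_inj ge).
  by move=> y _; exists (e y).
rewrite -nneseries_esumT; last by move=> n; rewrite lee_fin sqr_ge0.
move=> ffin; have cf : cvgn (series (fun n => f (g n) ^+ 2)).
  apply: nondecreasing_is_cvgn.
    by apply/nondecreasing_seqP => n; rewrite seriesSr lerDl sqr_ge0.
  exists (fine (\sum_(k <oo) (f (g k) ^+ 2)%:E)%E) => _ [n _ <-].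
  rewrite -lee_fin fineK; last first.
    by rewrite ge0_fin_numE// nneseries_ge0// => k _; rewrite lee_fin sqr_ge0.
  rewrite /series/= -sumEFin; apply: nneseries_lim_ge => k _ _.
  by rewrite lee_fin sqr_ge0.
have [G sG [GE _]] := Riesz_Fischer se e_orth cf.
by exists G => // y; rewrite -(eg y).
Qed.

End BlochTransform.

(** * The action of the Hamiltonian on the Bloch functions *)

Section Hamiltonian.
Variables (R : realType) (N : nat).
Notation p := (N.*2.+1).

Definition rlaplacian (f : vertex N -> R) (y : vertex N) : R :=
  let n := y.1 in let k := (y.2 : nat).+1 in
  let fc n k := ecoord (fun i => f (n, i)) k in
  if odd k then fc n k.-1 + fc (n - 1) k.+1 + fc n k.+1
  else fc n k.-1 + fc (n + 1) k.-1 + fc n k.+1.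

Definition rhamiltonian (v : 'rV[R]_p) (t : R) (f : vertex N -> R) y : R :=
  rlaplacian f y + t * v 0 y.2 * f y.

Local Open Scope complex_scope.

Lemma fcoord_Re (f g : vertex N -> R) n k :
  fcoord (fun y => f y +i* g y) n k =
  ecoord (fun i => f (n, i)) k +i* ecoord (fun i => g (n, i)) k.
Proof.
have -> : fcoord (fun y => f y +i* g y) n k = ecoord (fun i => f (n, i) +i* g (n, i)) k by [].
by case: (ecoordP N k) => [i ->|_ E]; [rewrite !ecoord_ord|rewrite !E].
Qed.

Lemma hamiltonian_Re (v : 'rV[R]_p) t (f g : vertex N -> R) y :
  hamiltonian v t (fun y => f y +i* g y) y =
  rhamiltonian v t f y +i* rhamiltonian v t g y.
Proof.
rewrite /hamiltonian /laplacian /rhamiltonian /rlaplacian !fcoord_Re.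
apply/eqP; rewrite eq_complex.
by case: ifP => _ /=; rewrite !mul0r ?subr0 ?addr0; apply/andP; split; apply/eqP; ring.
Qed.

Variables (v : 'rV[R]_p) (t : R).
Variable psi : 'I_p -> 'I_p -> R -> R.
Hypothesis psi_eig : forall k th,
  eigeneq v t (weight th) (energy v t k th) (fun i => psi k i th).

Lemma osc_avg b x h : osc b (x - h) + osc b (x + h) = 2 * cos h * osc b x :> R.
Proof.
by case: b; rewrite /osc; [rewrite cosB cosD|rewrite sinB sinD]; ring.
Qed.

Lemma ecoord_bloch kb th n k : ecoord (fun i => bloch psi (n, i) kb th) k =
  osc kb.2 ((n%:~R + (k./2)%:R / 2) * th) * ecoord (fun i => psi kb.1 i th) k.
Proof.
by case: (ecoordP N k) => [i ->|_ E]; [rewrite !ecoord_ord|rewrite !E mulr0].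
Qed.

(** The two edges of a [sigma] bond shift the phase by th / 2 and - th / 2, and
    by [osc_avg] they act together as multiplication by 2 cos (th / 2), which is
    the weight of the fiber. *)
Lemma rhamiltonian_bloch kb th y : 0 <= th <= pi ->
  rhamiltonian v t (fun y => bloch psi y kb th) y = energy v t kb.1 th * bloch psi y kb th.
Proof.
move=> th0; case: y => n i; rewrite /rhamiltonian /rlaplacian /=.
have E : energy v t kb.1 th * psi kb.1 i th = t * v 0 i * psi kb.1 i th +
    2 * cos (th / 2) * ecoord (fun i => psi kb.1 i th) (sigma i.+1) +
    ecoord (fun i => psi kb.1 i th) (tau i.+1).
  by rewrite -(weightE th0); exact: psi_eig.
have -> : energy v t kb.1 th * bloch psi (n, i) kb th =
    osc kb.2 ((n%:~R + (i.+1./2)%:R / 2) * th) * (energy v t kb.1 th * psi kb.1 i th).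
  by rewrite /bloch /phase /=; ring.
rewrite E !ecoord_bloch /bloch /phase /=.
set Psi := ecoord (fun i => psi kb.1 i th).
have avg x : osc kb.2 (x - th / 2) + osc kb.2 (x + th / 2) = 2 * cos (th / 2) * osc kb.2 x.
  exact: osc_avg.
rewrite /sigma /tau /= uphalf_half; case: (boolP (odd i)) => oi /=; set m := i./2.
  have := avg ((n%:~R + (1 + m)%:R / 2) * th).
  have -> : (n%:~R + (1 + m)%:R / 2) * th - th / 2 = (n%:~R + m%:R / 2) * th.
    by rewrite natrD; field.
  have -> : (n%:~R + (1 + m)%:R / 2) * th + th / 2 = ((n + 1)%:~R + m%:R / 2) * th.
    by rewrite intrD natrD; field.
  by move=> /(canRL (addrK _)) ->; rewrite add1n; ring.
rewrite add0n; have := avg ((n%:~R + m%:R / 2) * th).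
have -> : (n%:~R + m%:R / 2) * th - th / 2 = ((n - 1)%:~R + m.+1%:R / 2) * th.
  by rewrite intrB -natr1; field.
have -> : (n%:~R + m%:R / 2) * th + th / 2 = (n%:~R + m.+1%:R / 2) * th.
  by rewrite -natr1; field.
by move=> /(canRL (addrK _)) ->; ring.
Qed.

End Hamiltonian.

(** * The functional calculus in the Bloch representation *)

Section InnerProductSums.
Context d (T : measurableType d) (R : realType) (P : probability T R).
Variable I : finType.
Implicit Types F G H : I -> T -> R.

Lemma vsqintD F G : vsqint P F -> vsqint P G -> vsqint P (fun i x => F i x + G i x).
Proof. by move=> sF sG i; exact: sqintD. Qed.

Lemma vsqintZ c F : vsqint P F -> vsqint P (fun i x => c * F i x).
Proof. by move=> sF i; exact: sqintZ. Qed.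

Lemma ip_addl F F' G : vsqint P F -> vsqint P F' -> vsqint P G ->
  ip P (fun i x => F i x + F' i x) G = ip P F G + ip P F' G.
Proof.
move=> sF sF' sG; rewrite -[ip P F G]mul1r -ip_linl//; congr ip.
by apply/funext => i; apply/funext => x; rewrite /vlin mul1r.
Qed.

Lemma ip_scalel c F G : vsqint P F -> vsqint P G ->
  ip P (fun i x => c * F i x) G = c * ip P F G.
Proof.
move=> sF sG; rewrite -[RHS]addr0 -(ip0l P G) -ip_linl//; last exact: vsqint0.
by congr ip; apply/funext => i; apply/funext => x; rewrite /vlin addr0.
Qed.

(** The value of the Hamiltonian at a vertex has this shape: three neighbours
    and the potential. *)
Lemma ip_add4 F1 F2 F3 F4 c G : vsqint P F1 -> vsqint P F2 -> vsqint P F3 ->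
  vsqint P F4 -> vsqint P G ->
  let F := fun i x => F1 i x + F2 i x + F3 i x + c * F4 i x in
  vsqint P F /\ ip P F G = ip P F1 G + ip P F2 G + ip P F3 G + c * ip P F4 G.
Proof.
move=> s1 s2 s3 s4 sG F; have s12 := vsqintD s1 s2; have s123 := vsqintD s12 s3.
have s4' := vsqintZ c s4; split; first exact: vsqintD.
by rewrite (ip_addl s123 s4' sG) (ip_addl s12 s3 sG) (ip_addl s1 s2 sG) ip_scalel.
Qed.

Lemma ip_sumr F (c : nat -> R) (G : nat -> I -> T -> R) n :
  vsqint P F -> (forall k, vsqint P (G k)) ->
  vsqint P (fun i x => \sum_(k < n) c k * G k i x) /\
  ip P F (fun i x => \sum_(k < n) c k * G k i x) = \sum_(k < n) c k * ip P F (G k).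
Proof.
move=> sF sG; elim: n => [|n [IHs IH]].
  have -> : (fun i x => \sum_(k < 0) c k * G k i x) = (fun (_ : I) (_ : T) => 0).
    by apply/funext => i; apply/funext => x; rewrite big_ord0.
  by split; [exact: vsqint0|rewrite ipC ip0l big_ord0].
have -> : (fun i x => \sum_(k < n.+1) c k * G k i x) =
    vlin (c n) (G n) (fun i x => \sum_(k < n) c k * G k i x).
  by apply/funext => i; apply/funext => x; rewrite big_ord_recr/= addrC.
split; first exact: vsqint_lin.
by rewrite ip_linr// IH big_ord_recr/= addrC.
Qed.
End InnerProductSums.

Section SpectralTransform.
Variables (R : realType) (N : nat).
Notation p := (N.*2.+1).
Notation P := (half_period R).
Notation I := ('I_p * bool)%type.
Variables (v : 'rV[R]_p) (t L : R).
Hypothesis reg : regime v t L.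
Variable psi : 'I_p -> 'I_p -> R -> R.
Hypothesis psi_cont : forall k i, continuous (psi k i).
Hypothesis psi_orth : forall k k' th, \sum_i psi k i th * psi k' i th = (k == k')%:R.
Hypothesis psi_eig : forall k th,
  eigeneq v t (weight th) (energy v t k th) (fun i => psi k i th).
Notation bloch := (bloch psi).
Notation energy := (energy v t).
Implicit Types G : I -> R -> R.

(** The inverse Bloch transform, from functions of the band, the type and the
    momentum to functions on the vertices. *)
Definition invbloch G (y : vertex N) : R := ip P (bloch y) G.

Definition apply_energy (q : {poly R}) G : I -> R -> R :=
  fun kb th => q.[energy kb.1 th] * G kb th.

Lemma measurable_energy k : measurable_fun [set: measurableTypeR R] (energy k).
Proof. by apply: continuous_measurable_fun; exact: (energy_continuous reg). Qed.

Lemma energy_bounded k th : `|energy k th| <= `|t * v 0 k| + 4.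
Proof.
have := energy_near reg k th; have := ler_normD (energy k th - t * v 0 k) (t * v 0 k).
rewrite subrK; lra.
Qed.

Lemma vsqint_energy G : vsqint P G -> vsqint P (fun kb th => energy kb.1 th * G kb th).
Proof.
move=> sG kb; apply: sqint_mul_bounded (sG kb); first exact: measurable_energy.
by move=> x; exact: energy_bounded.
Qed.

Lemma vsqint_apply_energy q G : vsqint P G -> vsqint P (apply_energy q G).
Proof.
move=> sG; elim/poly_ind: q => [|q c IH].
  rewrite (_ : apply_energy _ _ = fun _ _ => 0); first exact: vsqint0.
  by apply/funext => kb; apply/funext => th; rewrite /apply_energy horner0 mul0r.
rewrite (_ : apply_energy _ _ = vlin c G (fun kb th => energy kb.1 th * apply_energy q G kb th)).
  by apply: vsqint_lin => //; exact: vsqint_energy.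
apply/funext => kb; apply/funext => th.
by rewrite /apply_energy /vlin hornerMXaddC; ring.
Qed.

Let ext_bloch n k : I -> R -> R := fun kb th => ecoord (fun i => bloch (n, i) kb th) k.

Let vsqint_ext n k : vsqint P (ext_bloch n k).
Proof.
rewrite /ext_bloch; case: (ecoordP N k) => [i ->|_ E] kb.
  under eq_fun do rewrite ecoord_ord.
  exact: vsqint_bloch.
by under eq_fun do rewrite E; exact: sqint_cst.
Qed.

Let ecoord_ip G n k : ecoord (fun i => invbloch G (n, i)) k = ip P (ext_bloch n k) G.
Proof.
rewrite /ext_bloch; case: (ecoordP N k) => [i ->|_ E].
  rewrite ecoord_ord /invbloch; congr ip.
  by apply/funext => kb; apply/funext => th; rewrite ecoord_ord.
rewrite E (_ : (fun _ => _) = fun _ _ => 0) ?ip0l//.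
by apply/funext => kb; apply/funext => th; rewrite E.
Qed.

(** The Hamiltonian acts on the vertex argument of the kernel [bloch], where it
    has the energy as eigenvalue for almost every momentum. *)
Lemma rhamiltonian_invbloch G : vsqint P G ->
  rhamiltonian v t (invbloch G) = invbloch (fun kb th => energy kb.1 th * G kb th).
Proof.
move=> sG; apply/funext => -[n i].
pose F kb th := rhamiltonian v t (fun y => bloch y kb th) (n, i).
have sF : vsqint P F /\ rhamiltonian v t (invbloch G) (n, i) = ip P F G.
  rewrite /F /rhamiltonian /rlaplacian /= !ecoord_ip.
  have sB := vsqint_bloch psi_cont psi_orth (n, i).
  case: ifP => _.
    have [h1 h2] := ip_add4 (t * v 0 i) (vsqint_ext n i.+1.-1) (vsqint_ext (n - 1) i.+2)
      (vsqint_ext n i.+2) sB sG.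
    by split; [exact: h1|exact: (esym h2)].
  have [h1 h2] := ip_add4 (t * v 0 i) (vsqint_ext n i.+1.-1) (vsqint_ext (n + 1) i.+1.-1)
    (vsqint_ext n i.+2) sB sG.
  by split; [exact: h1|exact: (esym h2)].
have [{}sF ->] := sF.
have sB := vsqint_bloch psi_cont psi_orth (n, i).
transitivity (ip P (fun kb th => energy kb.1 th * bloch (n, i) kb th) G).
  apply: ip_ae => //; first exact: vsqint_energy.
  apply: filterS (half_period_ae R); first exact: (ae_filter_ringOfSetsType P).
  move=> x /andP[x0 xp] kb; rewrite /F (rhamiltonian_bloch psi_eig)//.
  by rewrite !ltW.
apply: eq_Rintegral => x _; apply: eq_bigr => kb _; ring.
Qed.

Local Open Scope complex_scope.

Definition cinvbloch Ga Gb (y : vertex N) : R[i] := invbloch Ga y +i* invbloch Gb y.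

Lemma hamiltonian_cinvbloch Ga Gb : vsqint P Ga -> vsqint P Gb ->
  hamiltonian v t (cinvbloch Ga Gb) =
  cinvbloch (fun kb th => energy kb.1 th * Ga kb th) (fun kb th => energy kb.1 th * Gb kb th).
Proof.
move=> sa sb; apply/funext => y; rewrite /cinvbloch hamiltonian_Re.
by rewrite !rhamiltonian_invbloch.
Qed.

Lemma iter_hamiltonian_cinvbloch Ga Gb m : vsqint P Ga -> vsqint P Gb ->
  iter m (hamiltonian v t) (cinvbloch Ga Gb) =
  cinvbloch (apply_energy 'X^m Ga) (apply_energy 'X^m Gb).
Proof.
move=> sa sb; elim: m => [|m IH] /=.
  by congr cinvbloch; apply/funext => kb; apply/funext => th;
    rewrite /apply_energy expr0 hornerC mul1r.
rewrite IH hamiltonian_cinvbloch; [|exact: vsqint_apply_energy..].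
by congr cinvbloch; apply/funext => kb; apply/funext => th;
  rewrite /apply_energy exprS hornerM hornerX mulrA.
Qed.

Lemma invbloch_apply_energy q G y : vsqint P G ->
  invbloch (apply_energy q G) y =
  \sum_(i < size q) q`_i * invbloch (apply_energy 'X^i G) y.
Proof.
move=> sG; rewrite /invbloch.
have [_ <-] := @ip_sumr _ _ _ P _ (bloch y) (fun k => q`_k) (fun k => apply_energy 'X^k G)
  (size q) (vsqint_bloch psi_cont psi_orth y) (fun k => vsqint_apply_energy 'X^k sG).
congr ip; apply/funext => kb; apply/funext => th.
rewrite /apply_energy horner_coef mulr_suml; apply: eq_bigr => i _.
by rewrite hornerXn mulrA.
Qed.

Lemma poly_op_cinvbloch q Ga Gb : vsqint P Ga -> vsqint P Gb ->
  poly_op (hamiltonian v t) q (cinvbloch Ga Gb) =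
  cinvbloch (apply_energy q Ga) (apply_energy q Gb).
Proof.
move=> sa sb; apply/funext => y; rewrite /poly_op /cinvbloch.
rewrite !invbloch_apply_energy//.
elim: (size q) => [|m IH]; first by rewrite !big_ord0.
rewrite !big_ord_recr/= IH iter_hamiltonian_cinvbloch//.
by apply/eqP; rewrite eq_complex /= !mul0r ?subr0 ?addr0 !eqxx.
Qed.

Lemma l2norm2_cinvbloch Ga Gb : vsqint P Ga -> vsqint P Gb ->
  l2norm2 (cinvbloch Ga Gb) = ((ip P Ga Ga)%:E + (ip P Gb Gb)%:E)%E.
Proof.
move=> sa sb; rewrite -!(bloch_isometry psi_cont psi_orth)//.
rewrite -esumD; last 2 first.
- by move=> y _; rewrite lee_fin sqr_ge0.
- by move=> y _; rewrite lee_fin sqr_ge0.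
by apply: eq_esum => y _; rewrite /sqmod.
Qed.

Lemma cinvbloch_onto (f : vertex N -> R[i]) : in_l2 f ->
  exists Ga Gb, [/\ vsqint P Ga, vsqint P Gb & f = cinvbloch Ga Gb].
Proof.
move=> f2.
have part (h : R[i] -> R) : (forall z, h z ^+ 2 <= sqmod z) ->
    (\esum_(y in [set: vertex N]) ((h (f y)) ^+ 2)%:E < +oo)%E.
  by move=> hz; apply: le_lt_trans f2; apply: le_esum => y _; rewrite lee_fin.
have re_le (z : R[i]) : complex.Re z ^+ 2 <= sqmod z by rewrite lerDl sqr_ge0.
have im_le (z : R[i]) : complex.Im z ^+ 2 <= sqmod z by rewrite lerDr sqr_ge0.
have [Ga sa aE] := bloch_onto psi_cont psi_orth
  (part (@complex.Re R) re_le).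
have [Gb sb bE] := bloch_onto psi_cont psi_orth
  (part (@complex.Im R) im_le).
exists Ga, Gb; split => //; apply/funext => y.
by rewrite /cinvbloch /invbloch aE bE; case: (f y).
Qed.

(** The polynomial ((x - t v_k) / 4)^n is at most 1 in modulus on the disc of
    band [k] and at least (5/4)^n on every other band. Applied to the
    Hamiltonian, it would make a component in another band grow without bound,
    while the total mass of the spectral measure bounds the result. *)
Lemma spectral_concentrated (k : 'I_p) Ga Gb nu : vsqint P Ga -> vsqint P Gb ->
  is_spectral_measure (hamiltonian v t) (cinvbloch Ga Gb) nu ->
  {ae nu, forall x, `|x - t * v 0 k| <= 4} ->
  forall k' b, k' != k -> (\int[P]_x ((Ga (k', b) x) ^+ 2)%:E = 0 /\
                          \int[P]_x ((Gb (k', b) x) ^+ 2)%:E = 0)%E.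
Proof.
move=> sa sb nuP nuS k' b kk'.
(* s = (5/4)^2, as the other bands lie at distance at least L >= 5 from t v_k *)
pose M := fine (nu setT); pose s : R := 25 / 16.
pose q n : {poly R} := ((4^-1)%:P * ('X - (t * v 0 k)%:P)) ^+ n.
have qE n x : (q n).[x] = ((x - t * v 0 k) / 4) ^+ n.
  by rewrite /q horner_exp hornerM !hornerE mulrC.
have bound n : (l2norm2 (poly_op (hamiltonian v t) (q n) (cinvbloch Ga Gb)) <= M%:E)%E.
  rewrite nuP; apply: (@le_trans _ _ (\int[nu]_x (cst 1 x))%E).
    apply: ae_ge0_le_integral => //.
    - by move=> x _; rewrite lee_fin sqr_ge0.
    - apply/measurable_EFinP; apply: measurable_funX.
      by apply: continuous_measurable_fun => x; exact: continuous_horner.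
    - case: nuS => A [mA A0 subA]; exists A; split => // x /= nx; apply: subA => /= xk.
      apply: nx => _; rewrite lee_fin qE -(ger0_norm (sqr_ge0 _)) !normrX.
      rewrite exprn_ile1// exprn_ile1// normrM normfV [`|4|]ger0_norm//.
      by rewrite ler_pdivrMr// mul1r.
  by rewrite integral_cst//= mul1e /M fineK// fin_num_measure.
have low n x : s ^+ n <= (q n).[energy k' x] ^+ 2.
  have [gap L5 _ _] := reg.
  have kk : k != k' by rewrite eq_sym.
  have h := far_gap gap kk (energy_near reg k' x).
  rewrite qE -exprM mulnC exprM lerXn2r ?nnegrE ?sqr_ge0 ?divr_ge0//.
  rewrite expr_div_n -[X in _ <= X / _](real_normK (num_real _)).
  move: h L5; set z := `|_| => h L5; rewrite /s; nra.
have zero G : vsqint P G ->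
    (forall n, (ip P (apply_energy (q n) G) (apply_energy (q n) G))%:E <= M%:E)%E ->
    (\int[P]_x ((G (k', b) x) ^+ 2)%:E = 0)%E.
  move=> sG GM.
  set A := (\int[P]_x _)%E.
  have A0 : (0 <= A)%E by apply: integral_ge0 => x _; rewrite lee_fin sqr_ge0.
  have Afin : A \is a fin_num by rewrite ge0_fin_numE//; case: (sG (k', b)).
  have sA n : s ^+ n * fine A <= M.
    rewrite -lee_fin EFinM fineK//; apply: le_trans (GM n).
    apply: le_trans (ip_comp_le (k', b) (vsqint_apply_energy (q n) sG)).
    rewrite -ge0_integralZl//; last 3 first.
    - by apply: measurable_sqr; case: (sG (k', b)).
    - by move=> x _; rewrite lee_fin sqr_ge0.
    - by rewrite lee_fin exprn_ge0// divr_ge0.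
    apply: ge0_le_integral => //.
    - by move=> x _; rewrite -EFinM lee_fin mulr_ge0 ?sqr_ge0// exprn_ge0// divr_ge0.
    - by apply: measurable_funeM; apply: measurable_sqr; case: (sG (k', b)).
    - by apply: measurable_sqr; case: (vsqint_apply_energy (q n) sG (k', b)).
    - move=> x _; rewrite -EFinM lee_fin /apply_energy [leRHS]exprMn.
      by rewrite ler_wpM2r ?sqr_ge0// low.
  have a0 : 0 <= fine A by exact: fine_ge0.
  have : fine A <= 0.
    have cz : geometric M (16 / 25 : R) n @[n --> \oo] --> (0 : R).
      by apply: cvg_geometric; rewrite ger0_norm; lra.
    apply: (cvgr_to_ge cz); apply: nearW => n /=.
    have s1 : s ^+ n * (16 / 25) ^+ n = 1.
      by rewrite -exprMn (_ : s * (16 / 25) = 1) ?expr1n// /s; field.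
    apply: (@le_trans _ _ (s ^+ n * (16 / 25) ^+ n * fine A)); first by rewrite s1 mul1r.
    by rewrite mulrAC ler_wpM2r ?exprn_ge0// divr_ge0.
  by move=> a1; rewrite -(fineK Afin); congr _%:E; apply/eqP; rewrite eq_le a1.
have bound' n : ((ip P (apply_energy (q n) Ga) (apply_energy (q n) Ga))%:E +
    (ip P (apply_energy (q n) Gb) (apply_energy (q n) Gb))%:E <= M%:E)%E.
  rewrite -l2norm2_cinvbloch; [|exact: vsqint_apply_energy..].
  by rewrite -poly_op_cinvbloch.
split; apply: zero => // n; apply: le_trans (bound' n).
  by rewrite leeDl// lee_fin ip_ge0.
by rewrite leeDr// lee_fin ip_ge0.
Qed.

End SpectralTransform.

(** * Measures with a density, and inverses of monotone functions *)

Section Density.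
Context d (T : measurableType d) (R : realType) (m : {measure set T -> \bar R}).
Variable h : T -> R.
Hypothesis mh : measurable_fun [set: T] h.
Hypothesis h_ge0 : forall x, 0 <= h x.
Hypothesis h_fin : (\int[m]_x (h x)%:E < +oo)%E.
Local Open Scope ereal_scope.

Let dens (A : set T) := \int[m]_(x in A) (h x)%:E.

Let dens0 : dens set0 = 0. Proof. by rewrite /dens integral_set0. Qed.

Let dens_ge0 A : 0 <= dens A.
Proof. by apply: integral_ge0 => x _; rewrite lee_fin. Qed.

Let dens_sigma_additive : semi_sigma_additive dens.
Proof.
move=> /= F mF tF mUF; rewrite /dens; apply: cvg_toP.
  apply: ereal_nondecreasing_is_cvgn => i j ij.
  by apply: lee_sum_nneg_natr => // k _ _; exact: dens_ge0.
rewrite ge0_integral_bigcup//=.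
- by apply: measurable_funTS; exact/measurable_EFinP.
- by move=> x _; rewrite lee_fin.
Qed.

HB.instance Definition _ := isMeasure.Build _ _ _ dens dens0 dens_ge0 dens_sigma_additive.

Let dens_fin : fin_num_fun dens.
Proof.
move=> A mA; rewrite ge0_fin_numE//.
apply: le_lt_trans h_fin; apply: ge0_subset_integral => //.
- exact/measurable_EFinP.
- by move=> x _; rewrite lee_fin.
Qed.

HB.instance Definition _ := Measure_isFinite.Build _ _ _ dens dens_fin.

Import HBNNSimple.

Let dens_indic E : measurable E ->
  \int[dens]_x (\1_E x)%:E = \int[m]_x ((\1_E x)%:E * (h x)%:E).
Proof.
move=> mE; rewrite integral_indic// setIT /dens [LHS]integral_mkcond.
apply: eq_integral => x _; rewrite patchE indicE; case: ifPn => _.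
  by rewrite mul1e.
by rewrite mul0e.
Qed.

Let dens_nnsfun (f : {nnsfun T >-> R}) :
  \int[dens]_x (f x)%:E = \int[m]_x ((f x)%:E * (h x)%:E).
Proof.
under [LHS]eq_integral do rewrite fimfunE -fsumEFin//.
rewrite [LHS]ge0_integral_fsum//; last 2 first.
  - by move=> r; exact/measurable_EFinP/measurableT_comp.
  - by move=> n x _; rewrite EFinM nnfun_muleindic_ge0.
under [RHS]eq_integral.
  move=> x xD; rewrite fimfunE -fsumEFin// ge0_mule_fsuml; last first.
    by move=> r; rewrite EFinM nnfun_muleindic_ge0.
  over.
rewrite [RHS]ge0_integral_fsum//; last 2 first.
  - move=> r; apply: emeasurable_funM; last exact/measurable_EFinP.
    exact/measurable_EFinP/measurableT_comp.
  - move=> r x _; rewrite mule_ge0 ?lee_fin//.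
    by have := nnfun_muleindic_ge0 f r x; rewrite -EFinM lee_fin.
apply: eq_fsbigr => r rf.
rewrite integralZl_indic_nnsfun//= dens_indic//.
have [r0|r0] := leP 0%R r; last first.
  rewrite preimage_nnfun0// indic0 /=.
  under eq_integral do rewrite mul0e.
  under [RHS]eq_integral do rewrite mulr0 mul0e.
  by rewrite integral0 mule0.
rewrite -ge0_integralZl//.
- by apply: eq_integral => x _; rewrite EFinM muleA.
- apply: emeasurable_funM; last exact/measurable_EFinP.
  exact/measurable_EFinP/measurable_indic.
- by move=> x _; rewrite -EFinM lee_fin mulr_ge0.
Qed.

(** The density formula, known for indicators, extends to simple functions by
    linearity and to nonnegative functions by monotone convergence. *)
Lemma density_exists : exists nu : {finite_measure set T -> \bar R},
  forall F : T -> R, measurable_fun [set: T] F -> (forall x, 0 <= F x)%R ->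
  \int[nu]_x (F x)%:E = \int[m]_x ((F x * h x)%:E).
Proof.
exists dens => F mF F0.
have mF' : measurable_fun [set: T] (EFin \o F) by exact/measurable_EFinP.
pose f_ := nnsfun_approx measurableT mF'.
have f_cvg x : (f_ n x)%:E @[n --> \oo] --> (F x)%:E.
  by apply: (cvg_nnsfun_approx measurableT mF') => // y _; rewrite lee_fin.
have nd x : {homo (fun n => (f_ n x)%:E) : a b / (a <= b)%N >-> a <= b}.
  by move=> a b ab; rewrite lee_fin; exact/lefP/nd_nnsfun_approx.
transitivity (limn (fun n => \int[dens]_x (f_ n x)%:E)).
  rewrite -monotone_convergence//=.
  - by apply: eq_integral => x _; apply/esym/cvg_lim => //; exact: f_cvg.
  - by move=> n; exact/measurable_EFinP/measurable_funTS.
  - by move=> n x _; rewrite lee_fin.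
transitivity (limn (fun n => \int[m]_x ((f_ n x)%:E * (h x)%:E))).
  by apply: congr_lim; apply/funext => n; exact: dens_nnsfun.
rewrite -monotone_convergence//=.
- apply: eq_integral => x _; apply/cvg_lim => //; rewrite EFinM.
  by apply: cvgeZr => //; exact: f_cvg.
- move=> n; apply: emeasurable_funM; last exact/measurable_EFinP.
  exact/measurable_EFinP/measurable_funTS.
- by move=> n x _; rewrite mule_ge0 ?lee_fin.
- by move=> x _ a b ab; rewrite lee_wpmul2r ?lee_fin//; have := nd x a b ab; rewrite lee_fin.
Qed.
End Density.

Section MonotoneInverse.
Variable R : realType.

(** The inverse z |-> sup {x in [0, b] | phi x <= z} is nondecreasing on the
    whole line, hence measurable. *)
Lemma measurable_left_inverse (phi : R -> R) (b : R) : 0 <= b ->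
  (forall x y, 0 <= x -> x < y -> y <= b -> phi x < phi y) ->
  exists2 inv : R -> R, measurable_fun [set: measurableTypeR R] inv &
    forall x, 0 <= x <= b -> inv (phi x) = x.
Proof.
move=> b0 mono.
pose A (z : R) := [set x : R | 0 <= x <= b /\ phi x <= z].
have ubA z : has_ubound (A z) by exists b => x [/andP[]].
exists (fun z => sup (A z)).
  apply: nondecreasing_measurable => // z z' zz'.
  have [->|/set0P A0] := eqVneq (A z) set0.
    rewrite sup0; have [->|/set0P[x Ax]] := eqVneq (A z') set0; first by rewrite sup0.
    by apply: le_trans (ub_le_sup (ubA z') Ax); case: Ax => /andP[].
  apply: ge_sup => // x [xb xz]; apply: ub_le_sup => //; split => //.
  exact: le_trans zz'.
move=> x /andP[x0 xb]; apply/eqP; rewrite eq_le; apply/andP; split.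
  apply: ge_sup; first by exists x; split; rewrite ?x0.
  move=> y [/andP[y0 yb]]; apply: contraTT; rewrite -!ltNge => xy.
  exact: mono.
by apply: ub_le_sup => //; split; rewrite ?x0.
Qed.
End MonotoneInverse.

(** * Multiplicity of a band *)

Section BandMultiplicity.
Variables (R : realType) (N : nat).
Notation p := (N.*2.+1).
Notation P := (half_period R).
Notation I := ('I_p * bool)%type.
Variables (v : 'rV[R]_p) (t L : R).
Hypothesis reg : regime v t L.
Variable psi : 'I_p -> 'I_p -> R -> R.
Hypothesis psi_cont : forall k i, continuous (psi k i).
Hypothesis psi_orth : forall k k' th, \sum_i psi k i th * psi k' i th = (k == k')%:R.
Hypothesis psi_eig : forall k th,
  eigeneq v t (weight th) (energy v t k th) (fun i => psi k i th).
Notation energy := (energy v t).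
Notation cinvbloch := (cinvbloch psi).
Variable k : 'I_p.
Hypothesis k_lt : (k.+1 < p)%N.

Let mE : measurable_fun [set: measurableTypeR R]
    (energy k : measurableTypeR R -> measurableTypeR R) := measurable_energy reg k.
Let energy_mixin := isMeasurableFun.Build _ _ _ _ _ mE.
Let energy_mfun : {mfun (measurableTypeR R) >-> (measurableTypeR R)} :=
  HB.pack (energy k) energy_mixin.

(** This measure plays the part of a scalar spectral measure of the band: the
    Hamiltonian acts there as two copies of multiplication by the variable. *)
Definition band_measure := distribution P energy_mfun.

Notation mu := band_measure.

Lemma band_measureE (f : R -> R) : measurable_fun [set: measurableTypeR R] f ->
  (forall x, 0 <= f x) ->
  (\int[mu]_x (f x)%:E = \int[P]_th (f (energy k th))%:E)%E.
Proof.
move=> mf f0; rewrite (ge0_integral_distribution energy_mfun (f := EFin \o f))//.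
  exact/measurable_EFinP.
Qed.

Lemma band_measure_sqr (f : R -> R) : measurable_fun [set: measurableTypeR R] f ->
  (\int[mu]_x ((f x) ^+ 2)%:E = \int[P]_th ((f (energy k th)) ^+ 2)%:E)%E.
Proof.
move=> mf; rewrite (band_measureE (f := fun x => f x ^+ 2))//.
  exact: measurable_funX.
by move=> x; rewrite sqr_ge0.
Qed.

Lemma bandE : band v t (k%:Z - N%:Z) = [set energy k th | th in `[0, pi]%classic].
Proof.
have bf a : band_fun v t (k%:Z - N%:Z) a = eigval v t a k.
  by rewrite /band_fun /eigval subrK.
rewrite /band; apply/seteqP; split => x /= [].
  move=> a; rewrite in_itv/= => /weight_onto[th th0 <-] <-.
  by exists th; rewrite ?in_itv// bf.
by move=> th _ <-; exists (weight th); rewrite ?in_itv/= ?weight02// bf.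
Qed.

Lemma energy_in_band th : band v t (k%:Z - N%:Z) (energy k th).
Proof.
have [th' th'0 e] := weight_onto (weight02 th).
by rewrite bandE; exists th'; rewrite /= ?in_itv//; congr (eigval _ _ _ _).
Qed.

Lemma band_near x : band v t (k%:Z - N%:Z) x -> `|x - t * v 0 k| <= 4.
Proof. by rewrite bandE => -[th _ <-]; exact: (energy_near reg). Qed.

Lemma half_period_open_gt0 (V : set R) th : open V -> 0 <= th <= pi -> V th ->
  (0 < P V)%E.
Proof.
move=> oV /andP[th0 thp] Vth; have p0 := pi_gt0 R.
have /nbhs_ballP[e /= e0 eV] : nbhs th V by exact: open_nbhs_nbhs.
pose lo := Num.max 0 (th - e); pose hi := Num.min pi (th + e).
have lohi : lo < hi by rewrite /lo /hi gt_max !lt_min p0/=; lra.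
have sub : `]lo, hi[%classic `<=` V `&` `[0, pi]%classic.
  move=> x /=; rewrite !in_itv/= /lo /hi gt_max lt_min => /andP[/andP[x0 xe] /andP[xp xe']].
  split; last by rewrite !ltW.
  by apply: eV; rewrite /ball/= distrC ltr_norml; lra.
have mV : measurable V by exact: open_measurable.
rewrite half_periodE//.
have : (0 < lebesgue_measure (V `&` `[0%R, pi]%classic))%E.
  apply: (@lt_le_trans _ _ (lebesgue_measure `]lo, hi[%classic)).
    by rewrite lebesgue_measure_itv/= lte_fin lohi -EFinD lte_fin subr_gt0.
  by apply: le_measure => //; rewrite inE//; exact: measurableI.
by move=> V0; rewrite mule_gt0// lte_fin invr_gt0.
Qed.

Lemma band_closed : closed (band v t (k%:Z - N%:Z)).
Proof.
rewrite bandE; apply: compact_closed; first exact: Rhausdorff.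
apply: continuous_compact; last exact: segment_compact.
by apply: continuous_subspaceT => x; exact: (energy_continuous reg).
Qed.

(** The band is the image of [0, pi] by a continuous function, so the preimage
    of an open set that meets it contains an interval of positive length. *)
Lemma band_support : is_support (band v t (k%:Z - N%:Z)) mu.
Proof.
split.
  exists (~` band v t (k%:Z - N%:Z)); split => //.
    by apply: measurableC; apply: closed_measurable; exact: band_closed.
  rewrite /band_measure /distribution /pushforward /=.
  rewrite (_ : _ @^-1` _ = set0) ?measure0//; apply/seteqP; split => // th /=.
  by apply; exact: energy_in_band.
move=> U oU [x [Ux]]; rewrite bandE => -[th /=]; rewrite in_itv/= => th0 thx.
rewrite /band_measure /distribution /pushforward /=.
apply: (half_period_open_gt0 _ th0); last by rewrite /= thx.
by apply: open_comp => // y _; exact: (energy_continuous reg).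
Qed.

Definition branch (b : bool) : 'I_2 := if b then ord0 else ord_max.

(** Composition with the energy: a pair of functions of the spectral variable
    becomes a function of the momentum that is carried by band [k]. *)
Definition embed (g : 'I_2 -> R -> R) : I -> R -> R :=
  fun kb th => if kb.1 == k then g (branch kb.2) (energy k th) else 0.

Definition real_L2 (g : 'I_2 -> R -> R) := forall i, sqint mu (g i).

Lemma vsqint_embed g : real_L2 g -> vsqint P (embed g).
Proof.
move=> sg [k' b]; rewrite /embed /=; case: eqP => _; last exact: sqint_cst.
have [mg ig] := sg (branch b); split; first exact: measurableT_comp mg mE.
by move: ig; rewrite band_measure_sqr.
Qed.

Lemma ip_embed g : real_L2 g ->
  ((ip P (embed g) (embed g))%:E = \sum_(i < 2) \int[mu]_x ((g i x) ^+ 2)%:E)%E.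
Proof.
move=> sg; rewrite ip_normE; last exact: vsqint_embed.
have -> : (\sum_(kb : I) \int[P]_x (embed g kb x ^+ 2)%:E =
    \sum_k' \sum_b \int[P]_x (embed g (k', b) x ^+ 2)%:E)%E.
  by rewrite pair_bigA; apply: eq_bigr => -[? ?].
rewrite (bigD1 k)//= [X in (_ + X)%E]big1 ?adde0; last first.
  move=> k' /negbTE k'k; rewrite big1// => b _.
  by under eq_integral do rewrite /embed /= k'k expr0n/=; rewrite integral0.
rewrite big_bool big_ord_recl big_ord1 /embed /= eqxx.
rewrite (_ : lift ord0 ord0 = ord_max); last exact: val_inj.
have [m0 _] := sg ord0; have [m1 _] := sg ord_max.
by rewrite !band_measure_sqr.
Qed.

Local Open Scope complex_scope.

Lemma in_L2_parts (g : 'I_2 -> R -> R[i]) : in_L2 mu g <->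
  real_L2 (fun i x => complex.Re (g i x)) /\ real_L2 (fun i x => complex.Im (g i x)).
Proof.
have sq_le (f1 f2 : R -> R) : measurable_fun [set: measurableTypeR R] f1 ->
    measurable_fun [set: measurableTypeR R] f2 ->
    (\int[mu]_x (f1 x ^+ 2 + f2 x ^+ 2)%:E =
     \int[mu]_x (f1 x ^+ 2)%:E + \int[mu]_x (f2 x ^+ 2)%:E)%E.
  move=> m1 m2; under eq_integral do rewrite EFinD.
  rewrite ge0_integralD//.
  - by move=> x _; rewrite lee_fin sqr_ge0.
  - exact: measurable_sqr.
  - by move=> x _; rewrite lee_fin sqr_ge0.
  - exact: measurable_sqr.
split=> [gL|[gr gi] i].
  split => i; have [mr mi fin] := gL i; split => //;
    move: fin; rewrite /sqmod sq_le//; apply: le_lt_trans.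
    by rewrite leeDl// integral_ge0// => x _; rewrite lee_fin sqr_ge0.
  by rewrite leeDr// integral_ge0// => x _; rewrite lee_fin sqr_ge0.
have [mr fr] := gr i; have [mi fi] := gi i; split => //.
by rewrite /sqmod sq_le// lte_add_pinfty.
Qed.

Definition band_transform (g : 'I_2 -> R -> R[i]) : vertex N -> R[i] :=
  cinvbloch (embed (fun i x => complex.Re (g i x))) (embed (fun i x => complex.Im (g i x))).

Lemma band_transform_linear (c : R[i]) (g h : 'I_2 -> R -> R[i]) :
  in_L2 mu g -> in_L2 mu h -> forall y,
  band_transform (fun i x => c * g i x + h i x) y = c * band_transform g y + band_transform h y.
Proof.
move=> /in_L2_parts[gr gi] /in_L2_parts[hr hi] y.
rewrite /band_transform /cinvbloch.
have sgr := vsqint_embed gr; have sgi := vsqint_embed gi.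
have shr := vsqint_embed hr; have shi := vsqint_embed hi.
have sB := vsqint_bloch psi_cont psi_orth y.
set gR := embed _ in sgr; set gI := embed _ in sgi.
set hR := embed _ in shr; set hI := embed _ in shi.
have -> : embed (fun i x => complex.Re (c * g i x + h i x)) =
    vlin (complex.Re c) gR (vlin (- complex.Im c) gI hR).
  apply/funext => -[k' b]; apply/funext => th; rewrite /vlin /gR /gI /hR /embed /=.
  by case: eqP => _; [case: c => a e; case: (g _ _) => ? ?; case: (h _ _) => ? ? /=|]; ring.
have -> : embed (fun i x => complex.Im (c * g i x + h i x)) =
    vlin (complex.Re c) gI (vlin (complex.Im c) gR hI).
  apply/funext => -[k' b]; apply/funext => th; rewrite /vlin /gR /gI /hI /embed /=.
  by case: eqP => _; [case: c => a e; case: (g _ _) => ? ?; case: (h _ _) => ? ? /=|]; ring.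
rewrite /invbloch !ip_linr//; try exact: vsqint_lin.
by case: c => a e; apply/eqP; rewrite eq_complex /=; apply/andP; split; apply/eqP; ring.
Qed.

Lemma band_transform_norm g : in_L2 mu g ->
  (l2norm2 (band_transform g) = \sum_(i < 2) \int[mu]_x (sqmod (g i x))%:E)%E.
Proof.
move=> /in_L2_parts[gr gi].
rewrite (l2norm2_cinvbloch psi_cont psi_orth) ?ip_embed//; try exact: vsqint_embed.
rewrite -big_split/=; apply: eq_bigr => i _.
have [mr _] := gr i; have [mi _] := gi i.
rewrite /sqmod; under [RHS]eq_integral do rewrite EFinD.
rewrite ge0_integralD//.
- by move=> x _; rewrite lee_fin sqr_ge0.
- exact: measurable_sqr.
- by move=> x _; rewrite lee_fin sqr_ge0.
- exact: measurable_sqr.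
Qed.

Lemma embed_energy (g : 'I_2 -> R -> R) (q : {poly R}) :
  apply_energy v t q (embed g) = embed (fun i x => q.[x] * g i x).
Proof.
apply/funext => -[k' b]; apply/funext => th; rewrite /apply_energy /embed /=.
by case: eqP => [->|_]; rewrite ?mulr0.
Qed.

Lemma apply_energy_X (G : I -> R -> R) :
  (fun kb th => energy kb.1 th * G kb th) = apply_energy v t 'X G.
Proof. by apply/funext => kb; apply/funext => th; rewrite /apply_energy hornerX. Qed.

Lemma band_transform_poly q (g : 'I_2 -> R -> R[i]) :
  cinvbloch (apply_energy v t q (embed (fun i x => complex.Re (g i x))))
            (apply_energy v t q (embed (fun i x => complex.Im (g i x)))) =
  band_transform (fun i x => (q.[x])%:C * g i x).
Proof.
rewrite /band_transform !embed_energy; congr (cinvbloch (embed _) (embed _)).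
  by apply/funext => i; apply/funext => x; case: (g i x) => a b /=; rewrite mul0r subr0.
by apply/funext => i; apply/funext => x; case: (g i x) => a b /=; rewrite mul0r addr0.
Qed.

Lemma band_transform_energy (g : 'I_2 -> R -> R[i]) : in_L2 mu g -> forall y,
  hamiltonian v t (band_transform g) y = band_transform (fun i x => x%:C * g i x) y.
Proof.
move=> /in_L2_parts[gr gi] y.
rewrite (hamiltonian_cinvbloch reg psi_cont psi_orth psi_eig); try exact: vsqint_embed.
rewrite !apply_energy_X band_transform_poly; congr (band_transform _ y).
by apply/funext => i; apply/funext => x; rewrite hornerX.
Qed.

Lemma half_period_integral_sqr (f1 f2 : R -> R) :
  measurable_fun [set: measurableTypeR R] f1 -> measurable_fun [set: measurableTypeR R] f2 ->
  (forall x, 0 <= x <= pi -> f1 x = f2 x) ->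
  (\int[P]_x ((f1 x) ^+ 2)%:E = \int[P]_x ((f2 x) ^+ 2)%:E)%E.
Proof.
move=> m1 m2 f12; apply: ge0_ae_eq_integral => //.
- exact: measurable_sqr.
- exact: measurable_sqr.
- by move=> x _; rewrite lee_fin sqr_ge0.
- by move=> x _; rewrite lee_fin sqr_ge0.
apply: filterS (half_period_ae R); first exact: (ae_filter_ringOfSetsType P).
by move=> x /andP[x0 xp] _; rewrite f12// !ltW.
Qed.

Lemma invbloch_eq (G E : I -> R -> R) : vsqint P G -> vsqint P E ->
  (forall kb, \int[P]_x ((G kb x - E kb x) ^+ 2)%:E = 0)%E ->
  invbloch psi G = invbloch psi E.
Proof.
move=> sG sE GE; apply/funext => y.
have sD : vsqint P (vlin (-1) E G) by exact: vsqint_lin.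
have D0 : ip P (vlin (-1) E G) (vlin (-1) E G) = 0.
  apply/EFin_inj; rewrite ip_normE// big1// => kb _; rewrite -[RHS](GE kb).
  by apply: eq_integral => x _; rewrite /vlin mulN1r addrC.
have sB := vsqint_bloch psi_cont psi_orth y.
have := ip_CauchySchwarz sB sD; rewrite D0 mulr0 ip_linr// => h.
have : - 1 * ip P (bloch psi y) E + ip P (bloch psi y) G == 0.
  by rewrite -sqrf_eq0 eq_le h sqr_ge0.
by rewrite mulN1r addrC subr_eq0 => /eqP.
Qed.

Lemma branch_onto i : exists b, i = branch b.
Proof. by case: i => [[|[|//]]] H; [exists true|exists false]; exact: val_inj. Qed.

Lemma real_L2_poly (q : {poly R}) g : real_L2 g -> real_L2 (fun i x => q.[x] * g i x).
Proof.
move=> sg i; have [b ->] := branch_onto i.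
have mq : measurable_fun [set: measurableTypeR R] (fun x => q.[x] * g (branch b) x).
  apply: measurable_funM; last by case: (sg (branch b)).
  by apply: continuous_measurable_fun => x; exact: continuous_horner.
split => //; rewrite band_measure_sqr//.
have [_] := vsqint_apply_energy reg q (vsqint_embed sg) (k, b).
by rewrite /apply_energy /embed /= eqxx.
Qed.

Lemma in_L2_poly (q : {poly R}) (g : 'I_2 -> R -> R[i]) :
  in_L2 mu g -> in_L2 mu (fun i x => (q.[x])%:C * g i x).
Proof.
move=> /in_L2_parts[/(real_L2_poly q) gr /(real_L2_poly q) gi]; apply/in_L2_parts; split => i.
  have := gr i; congr (sqint _ _); apply/funext => x.
  by case: (g i x) => a b /=; rewrite mul0r subr0.
have := gi i; congr (sqint _ _); apply/funext => x.
by case: (g i x) => a b /=; rewrite mul0r addr0.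
Qed.

Lemma sqmod_ge0 (z : R[i]) : 0 <= sqmod z.
Proof. by rewrite addr_ge0 ?sqr_ge0. Qed.

(** The spectral measure of the image of [g] is [mu] with the density
    |g_0|^2 + |g_1|^2. *)
Lemma band_transform_spectral (g : 'I_2 -> R -> R[i]) : in_L2 mu g ->
  spectral_subspace (hamiltonian v t) (band v t (k%:Z - N%:Z)) (band_transform g).
Proof.
move=> gL; have /in_L2_parts[gr gi] := gL.
have fin i : (\int[mu]_x (sqmod (g i x))%:E < +oo)%E by case: (gL i).
have msq i : measurable_fun [set: measurableTypeR R] (fun x => sqmod (g i x)).
  by have [mr mi _] := gL i; apply: measurable_funD; exact: measurable_funX.
split.
  rewrite /in_l2 band_transform_norm// big_ord_recl big_ord1.
  by rewrite lte_add_pinfty.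
pose h x := sqmod (g ord0 x) + sqmod (g ord_max x).
have mh : measurable_fun [set: measurableTypeR R] h by exact: measurable_funD.
have h0 x : 0 <= h x by rewrite addr_ge0 ?sqmod_ge0.
have split_h (F : R -> R) : measurable_fun [set: measurableTypeR R] F ->
    (forall x, 0 <= F x) ->
    (\int[mu]_x (F x * h x)%:E =
     \sum_(i < 2) \int[mu]_x (F x * sqmod (g i x))%:E)%E.
  move=> mF F0; rewrite big_ord_recl big_ord1.
  rewrite (_ : lift ord0 ord0 = ord_max); last exact: val_inj.
  rewrite -ge0_integralD//.
  - by apply: eq_integral => x _; rewrite -EFinD mulrDr.
  - by move=> x _; rewrite lee_fin mulr_ge0 ?sqmod_ge0.
  - by apply/measurable_EFinP; exact: measurable_funM.
  - by move=> x _; rewrite lee_fin mulr_ge0 ?sqmod_ge0.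
  - by apply/measurable_EFinP; exact: measurable_funM.
have hfin : (\int[mu]_x (h x)%:E < +oo)%E.
  under eq_integral do rewrite -[h _]mul1r.
  rewrite (split_h (cst 1))//.
  rewrite big_ord_recl big_ord1.
  under eq_integral do rewrite mul1r.
  under [X in (_ + X < _)%E]eq_integral do rewrite mul1r.
  by rewrite lte_add_pinfty.
have [nu nuE] := density_exists mh h0 hfin.
exists nu; split.
  move=> q; have /in_L2_parts[gr' gi'] := gL.
  rewrite /band_transform (poly_op_cinvbloch reg psi_cont psi_orth psi_eig);
    try exact: vsqint_embed.
  rewrite band_transform_poly band_transform_norm; last exact: in_L2_poly.
  rewrite nuE; last 2 first.
  - apply: measurable_funX; apply: continuous_measurable_fun => x; exact: continuous_horner.
  - by move=> x; rewrite sqr_ge0.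
  rewrite split_h; last 2 first.
  - apply: measurable_funX; apply: continuous_measurable_fun => x; exact: continuous_horner.
  - by move=> x; rewrite sqr_ge0.
  apply: eq_bigr => i _; apply: eq_integral => x _; congr _%:E.
  by rewrite /sqmod; case: (g i x) => a b /=; ring.
have mS : measurable (~` band v t (k%:Z - N%:Z) : set (measurableTypeR R)).
  by apply: measurableC; apply: closed_measurable; exact: band_closed.
exists (~` band v t (k%:Z - N%:Z)); split => //.
rewrite -[X in nu X]setIT -integral_indic// nuE//.
rewrite (band_measureE (f := fun x => \1_(~` band v t (k%:Z - N%:Z)) x * h x)); last 2 first.
- by apply: measurable_funM => //; exact: measurable_indic.
- by move=> x; rewrite mulr_ge0.
rewrite integral0_eq// => th _; rewrite indicE memNset ?mul0r//.
by move=> /(_ (energy_in_band th)).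
Qed.

(** A vector of the spectral subspace is carried by band [k], where the energy
    is an injective function of the momentum: its Bloch components are
    functions of the energy. *)
Lemma spectral_band_transform f :
  spectral_subspace (hamiltonian v t) (band v t (k%:Z - N%:Z)) f ->
  exists2 g, in_L2 mu g & forall y, f y = band_transform g y.
Proof.
move=> [f2 [nu [nuP nuS]]].
have [Ga [Gb [sa sb fE]]] := cinvbloch_onto psi_cont psi_orth f2.
rewrite fE in nuP.
have nuS' : {ae nu, forall x, `|x - t * v 0 k| <= 4}.
  apply: filterS nuS; first exact: (ae_filter_ringOfSetsType nu).
  by move=> x; exact: band_near.
have conc := spectral_concentrated reg psi_cont psi_orth psi_eig sa sb nuP nuS'.
(* the sign that makes s * energy increasing *)
pose s : R := - (-1) ^+ (~~ odd k).
have mono th th' : 0 <= th -> th < th' -> th' <= pi -> s * energy k th < s * energy k th'.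
  move=> th0 tt tp; have := energy_strict reg k_lt th0 tt tp.
  by rewrite /s !mulNr; lra.
have [inv minv invK] := measurable_left_inverse (pi_ge0 R) mono.
pose back x := inv (s * x).
have mback : measurable_fun [set: measurableTypeR R] back.
  by apply: measurableT_comp => //; exact: measurable_funM.
pose gpart (G : I -> R -> R) (i : 'I_2) x := G (k, i == ord0) (back x).
have branchK b : (branch b == ord0) = b by case: b.
have part (G : I -> R -> R) : vsqint P G ->
    (forall k' b, k' != k -> \int[P]_x ((G (k', b) x) ^+ 2)%:E = 0)%E ->
    real_L2 (gpart G) /\ invbloch psi G = invbloch psi (embed (gpart G)).
  move=> sG G0.
  have mG b : measurable_fun [set: measurableTypeR R] (fun x => G (k, b) (back x)).
    by apply: measurableT_comp => //; case: (sG (k, b)).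
  have mGE b : measurable_fun [set: measurableTypeR R] (fun th => G (k, b) (back (energy k th))).
    exact: (measurableT_comp (mG b) mE).
  have backK th : 0 <= th <= pi -> back (energy k th) = th by move=> h; exact: invK.
  have L2 : real_L2 (gpart G).
    move=> i; split; first exact: mG.
    rewrite band_measure_sqr; last exact: mG.
    rewrite (@half_period_integral_sqr _ (G (k, i == ord0))).
    - by case: (sG (k, i == ord0)).
    - exact: mGE.
    - by case: (sG (k, i == ord0)).
    - by move=> x xp; rewrite /gpart backK.
  split => //; apply: invbloch_eq => //; first exact: vsqint_embed.
  move=> [k' b]; rewrite /embed /=; case: eqP => [->|/eqP k'k]; last first.
    by under eq_integral do rewrite subr0; exact: G0.
  rewrite (@half_period_integral_sqr _ (cst 0)).
  - by under eq_integral do rewrite /= expr0n/=; rewrite integral0.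
  - apply: measurable_funB; first by case: (sG (k, b)).
    by rewrite /gpart branchK; exact: mGE.
  - exact: measurable_cst.
  - by move=> x xp; rewrite /gpart branchK backK// subrr.
have [la ea] := part Ga sa (fun k' b kk => (conc k' b kk).1).
have [lb eb] := part Gb sb (fun k' b kk => (conc k' b kk).2).
exists (fun i x => gpart Ga i x +i* gpart Gb i x).
  by apply/in_L2_parts; split.
by move=> y; rewrite fE /band_transform /cinvbloch ea eb.
Qed.

Lemma band_multiplicity :
  has_multiplicity (hamiltonian v t) 2 (band v t (k%:Z - N%:Z)).
Proof.
exists mu, band_transform; split.
- exact: band_support.
- exact: band_transform_linear.
- exact: band_transform_norm.
- exact: band_transform_energy.
move=> f; split; first exact: spectral_band_transform.
move=> [g gL fE]; have -> : f = band_transform g by apply/funext.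
exact: band_transform_spectral.
Qed.

End BandMultiplicity.

(** * The spectral bands at large coupling *)

Theorem theorem1p6 (R : realType) (N : nat) (v : 'rV[R]_(N.*2.+1)) :
  (0 < N)%N ->
  (forall k : nat, (1 <= k < N.*2.+1)%N -> vcoord v k < vcoord v k.+1) ->
  [/\ forall (k : nat) (sgn : bool), (1 <= k <= N.*2.+1)%N ->
        exists2 e : R -> R, e =O_ (pinfty_filter R) (fun t : R => t^-1) &
          \forall t \near +oo_R,
            band_end v (sgn (+) odd k) (k%:Z - N%:Z - 1) t =
              t * vcoord v k - (xi v sgn k + e t) / t,
      forall k : nat, (1 <= k < N.*2.+1)%N ->
        exists2 e : R -> R, e =O_ (pinfty_filter R) (fun t : R => t^-1) &
          \forall t \near +oo_R,
            band_length v (k%:Z - N%:Z - 1) t =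
              (4 + e t) /
              (t * `|vcoord v (if odd k then k.+1 else k.-1) - vcoord v k|),
      (band_length v N%:Z : R -> R) =O_ (pinfty_filter R) (fun t : R => t ^- 2) &
      \forall t \near +oo_R, forall j : int, - N%:Z <= j <= N%:Z - 1 ->
        has_multiplicity (hamiltonian v t) 2 (band v t j)].
Proof.
move=> N0 v_incr; split.
- by move=> k sgn; exact: band_end_asymp.
- exact: band_length_asymp.
- exact: top_band_length_asymp.
have [delta [T0 [_ _ reg]]] := regime_eventually v_incr.
near=> t => j /andP[jl jr].
have [_ regt] : 9 <= t * delta /\ regime v t (t * delta - 4).
  by apply: reg; near: t; apply: nbhs_pinfty_ge; rewrite num_real.
have [psi [psi_cont psi_eig psi_orth]] := fiber_basis regt.
have jN : (absz (j + N%:Z)%R < N.*2)%N by lia.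
pose k : 'I_(N.*2.+1) := Ordinal (leqW jN).
have -> : j = k%:Z - N%:Z by rewrite /=; lia.
exact: (band_multiplicity regt psi_cont psi_orth psi_eig).
Unshelve. all: by end_near. Qed.
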